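(* Let $\mathcal{G}$ be an essentially principal, purely infinite, minimal, étale Cantor groupoid such that $H_1(\mathsf{F}(\mathcal{G}))$ is finite (this is for example the case if the groupoid homology groups $H_0(\mathcal{G})$ and $H_1(\mathcal{G})$ are finite). Then every faithful ergodic measure-preserving action of $\mathsf{F}(\mathcal{G})$ is essentially free.
   Context: A groupoid is a small category in which every morphism is invertible; $\mathcal{G}^{(0)}$ is its set of units, $s(\gamma)=\gamma^{-1}\gamma$, $r(\gamma)=\gamma\gamma^{-1}$. All topological groupoids are Hausdorff. A bisection is an open set $B\subseteq\mathcal{G}$ such that $s|_B$ and $r|_B$ are homeomorphisms onto open subsets of $\mathcal{G}^{(0)}$. $\mathcal{G}$ is étale if $s,r$ are local homeomorphisms; it is a Cantor groupoid if $\mathcal{G}^{(0)}$ is homeomorphic to the Cantor space. $\mathcal{G}$ is minimal if every orbit $\{r(\gamma): s(\gamma)=x\}$, $x\in\mathcal{G}^{(0)}$, is dense in $\mathcal{G}^{(0)}$. $\mathcal{G}$ is essentially principal if the set of $x\in\mathcal{G}^{(0)}$ with $\{\gamma: s(\gamma)=r(\gamma)=x\}=\{x\}$ is dense in $\mathcal{G}^{(0)}$. $\mathcal{G}$ is purely infinite if for every compact open $X\subseteq\mathcal{G}^{(0)}$ there are compact open bisections $B,B'$ with $s(B)=s(B')=X$ and with $r(B),r(B')$ disjoint and contained in $X$. Topological full group: for a compact open bisection $B$ with $s(B)=r(B)=\mathcal{G}^{(0)}$ let $\alpha_B=r\circ(s|_B)^{-1}\in\mathrm{Homeo}(\mathcal{G}^{(0)})$;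 $\mathsf{F}(\mathcal{G})$ is the group of all such $\alpha_B$. $H_1(\mathsf{F}(\mathcal{G}))$ is the first integral group homology, i.e. the abelianisation of $\mathsf{F}(\mathcal{G})$. Groupoid homology: let $\mathcal{G}^{(n)}$ be the space of composable $n$-tuples. For a local homeomorphism $f\colon Y\to Z$ and $\varphi\in C_c(Y,\mathbb{Z})$ set $f_*(\varphi)(z)=\sum_{f(y)=z}\varphi(y)$. Let $d_i\colon\mathcal{G}^{(n)}\to\mathcal{G}^{(n-1)}$ ($n\geq2$) be the maps: $d_0$ drops the first entry, $d_n$ drops the last entry, and $d_i$ ($0<i<n$) multiplies the $i$-th and $(i+1)$-st entries. $H_n(\mathcal{G})$ is the $n$-th homology of the complex $C_c(\mathcal{G}^{(n)},\mathbb{Z})$ with $\partial_1=s_*-r_*$ and $\partial_n=\sum_{i=0}^n(-1)^i(d_i)_*$ for $n\geq2$ (and $\partial_0=0$). Actions are measure-preserving actions on a standard probability space $(Z,\mu)$. As usual, faithful means that no nontrivial element acts trivially $\mu$-almost everywhere, and essentially free means that $\mu(\{z: gz=z\})=0$ for every $g\neq1$. *)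

(* Defs.v *)
From HB Require Import structures.
From mathcomp Require Import all_boot all_order all_algebra.
From mathcomp Require Import all_classical all_reals all_analysis.

Set Implicit Arguments.
Unset Strict Implicit.
Unset Printing Implicit Defensive.

Import Order.TTheory GRing.Theory Num.Theory.

Local Open Scope classical_set_scope.

Definition homeomorphism (X Y : topologicalType) (f : X -> Y) : Prop :=
  exists g : Y -> X,
    [/\ continuous f, continuous g, cancel f g & cancel g f].

Definition homeomorphic (X Y : topologicalType) : Prop :=
  exists f : X -> Y, homeomorphism f.

(* f restricts to a homeomorphism from A onto f @` A. *)
Definition homeo_on (X Y : topologicalType) (A : set X) (f : X -> Y) : Prop :=
  {within A, continuous f} /\
  exists2 g : Y -> X, {within f @` A, continuous g} & {in A, cancel f g}.

Definition local_homeomorphism (X Y : topologicalType) (f : X -> Y) : Prop :=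
  forall x : X, exists U : set X,
    [/\ open U, U x, open (f @` U) & homeo_on U f].

(* [gmul] is total, but only its values on composable pairs (the domain of the
   left factor is the range of the right one) are constrained or used. *)
Record topGroupoid := TopGroupoid {
  garrow :> topologicalType;
  gmul : garrow -> garrow -> garrow;
  ginv : garrow -> garrow;
  gdom := fun x : garrow => gmul (ginv x) x;
  gran := fun x : garrow => gmul x (ginv x);
  gdom_mul : forall x y, gdom x = gran y -> gdom (gmul x y) = gdom y;
  gran_mul : forall x y, gdom x = gran y -> gran (gmul x y) = gran x;
  gmulA : forall x y z, gdom x = gran y -> gdom y = gran z ->
    gmul x (gmul y z) = gmul (gmul x y) z;
  gmul_dom : forall x, gmul x (gdom x) = x;
  gran_mul_id : forall x, gmul (gran x) x = x;
  gdom_inv : forall x, gdom (ginv x) = gran x;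
  gran_inv : forall x, gran (ginv x) = gdom x;
  ginv_continuous : continuous ginv;
  gmul_continuous :
    {within [set p : garrow * garrow | gdom p.1 = gran p.2],
      continuous (fun p => gmul p.1 p.2)};
  garrow_hausdorff : hausdorff_space garrow
}.

Section Groupoid.
Variable G : topGroupoid.

(* The unit space, with the subspace topology inherited from G. *)
Definition units : set G := range (@gdom G).

Lemma gran_unit (x : G) : units (gran x).
Proof. by exists (ginv x) => //; rewrite gdom_inv. Qed.

Definition src (x : G) : units := exist _ (gdom x) (mem_set (imageT _ x)).
Definition rng (x : G) : units := exist _ (gran x) (mem_set (gran_unit x)).

Definition bisection (B : set G) : Prop :=
  [/\ open B, open (src @` B), homeo_on B src,
      open (rng @` B) & homeo_on B rng].

Definition etale : Prop :=
  local_homeomorphism src /\ local_homeomorphism rng.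

Definition minimal : Prop :=
  forall x : units, dense [set rng y | y in [set y : G | src y = x]].

Definition essentially_principal : Prop :=
  dense [set x : units |
    [set y : G | src y = x /\ rng y = x] = [set \val x]].

Definition purely_infinite : Prop :=
  forall X : set units, compact X -> open X ->
  exists B B' : set G,
    [/\ compact B /\ bisection B,
        compact B' /\ bisection B',
        src @` B = X /\ src @` B' = X,
        (rng @` B) `&` (rng @` B') = set0 &
        rng @` B `<=` X /\ rng @` B' `<=` X].

End Groupoid.

Arguments units : clear implicits.
Arguments src {G}.
Arguments rng {G}.

Record etaleCantorGroupoid := EtaleCantorGroupoid {
  ecg_groupoid :> topGroupoid;
  ecg_etale : etale ecg_groupoid;
  ecg_cantor : homeomorphic (units ecg_groupoid) cantor_space
}.

Section HomeoGroup.
Variable X : topologicalType.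

Definition homeo : Type := {f : X -> X | `[< homeomorphism f >]}.
HB.instance Definition _ := SubChoice.on homeo.

Lemma homeoP (f : homeo) : homeomorphism (val f).
Proof. by apply/asboolP; exact: (valP f). Qed.

Lemma homeo1_subproof : `[< homeomorphism (@idfun X) >].
Proof. by apply/asboolP; exists idfun; split => // x; exact: cvg_id. Qed.

Lemma homeoM_subproof (f g : homeo) :
  `[< homeomorphism (val f \o val g) >].
Proof.
apply/asboolP; have [f' [cf cf' fK f'K]] := homeoP f.
have [g' [cg cg' gK g'K]] := homeoP g.
exists (g' \o f'); split.
- by move=> x; apply: continuous_comp; [exact: cg | exact: cf].
- by move=> x; apply: continuous_comp; [exact: cf' | exact: cg'].
- exact: can_comp.
- exact: can_comp.
Qed.

Definition homeoV_fun (f : homeo) : X -> X := sval (cid (homeoP f)).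

Lemma homeoV_funP (f : homeo) :
  [/\ continuous (val f), continuous (homeoV_fun f),
      cancel (val f) (homeoV_fun f) & cancel (homeoV_fun f) (val f)].
Proof. exact: svalP (cid (homeoP f)). Qed.

Lemma homeoV_subproof (f : homeo) : `[< homeomorphism (homeoV_fun f) >].
Proof.
by apply/asboolP; exists (val f); have [? ? ? ?] := homeoV_funP f.
Qed.

Definition homeo1 : homeo := Sub idfun homeo1_subproof.
Definition homeoM (f g : homeo) : homeo :=
  Sub (val f \o val g) (homeoM_subproof f g).
Definition homeoV (f : homeo) : homeo :=
  Sub (homeoV_fun f) (homeoV_subproof f).

Lemma homeoA : associative homeoM. Proof. by move=> f g h; exact: val_inj. Qed.
Lemma homeo1M : left_id homeo1 homeoM.
Proof. by move=> f; exact: val_inj. Qed.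
Lemma homeoM1 : right_id homeo1 homeoM.
Proof. by move=> f; exact: val_inj. Qed.
Lemma homeoVM : left_inverse homeo1 homeoV homeoM.
Proof.
move=> f; apply: val_inj; apply/funext => x /=.
by have [_ _ + _] := homeoV_funP f; exact.
Qed.
Lemma homeoMV : right_inverse homeo1 homeoV homeoM.
Proof.
move=> f; apply: val_inj; apply/funext => x /=.
by have [_ _ _] := homeoV_funP f; exact.
Qed.

HB.instance Definition _ :=
  isGroup.Build homeo homeoA homeo1M homeoM1 homeoVM homeoMV.

End HomeoGroup.

Section FullGroup.
Variable G : etaleCantorGroupoid.

(* The last clause says that h is the homeomorphism of the unit space obtained
   by composing rng with the inverse of the restriction of src to B. *)
Definition full_bisection_homeo (h : homeo (units G)) : Prop :=
  exists B : set G,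
    [/\ compact B, bisection B, src @` B = setT, rng @` B = setT &
        forall y : G, B y -> val h (src y) = rng y].

Definition full_group_pred : {pred homeo (units G)} :=
  fun h => `[< full_bisection_homeo h >].

Lemma local_homeomorphism_continuous (X Y : topologicalType) (f : X -> Y) :
  local_homeomorphism f -> continuous f.
Proof.
move=> lf x; have [U [oU Ux _ [cU _]]] := lf x.
by move: cU; rewrite continuous_open_subspace // => /(_ x (mem_set Ux)).
Qed.

Lemma src_continuous : continuous (@src G).
Proof. exact/local_homeomorphism_continuous/(ecg_etale G).1. Qed.

Lemma rng_continuous : continuous (@rng G).
Proof. exact/local_homeomorphism_continuous/(ecg_etale G).2. Qed.

Lemma val_units_continuous : continuous (fun x : units G => val x : G).
Proof. exact: initial_continuous. Qed.

Lemma units_compact : compact [set: units G].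
Proof.
have [f [g [cf cg fK gK]]] := ecg_cantor G.
have -> : [set: units G] = g @` setT.
  by rewrite eqEsubset; split => // x _; exists (f x).
apply: continuous_compact; last exact: cantor_space_compact.
exact: continuous_subspaceT.
Qed.

Lemma gmul_comp_continuous (X : topologicalType) (u v : X -> G) :
  continuous u -> continuous v -> (forall x, gdom (u x) = gran (v x)) ->
  continuous (fun x => gmul (u x) (v x)).
Proof.
move=> cu cv uv x.
have /subspace_continuousP/(_ (u x, v x) (uv x)) := @gmul_continuous G.
move=> cm W /cm nW.
have cuv : (fun y => (u y, v y)) @ x --> (u x, v x).
  by apply: cvg_pair; [exact: cu | exact: cv].
have := cuv _ nW; rewrite /= nbhs_simpl /=.
by apply: filterS => y /= /(_ (uv y)).
Qed.

Lemma gdom_id (u : units G) : gdom (val u) = val u.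
Proof.
by case: u => /= u /set_mem [x _ <-]; rewrite gdom_mul // gdom_inv.
Qed.

Lemma gran_id (u : units G) : gran (val u) = val u.
Proof.
case: u => /= u /set_mem [x _ <-].
by rewrite gran_mul ?gran_inv // gdom_inv.
Qed.

Lemma src_val (u : units G) : src (val u) = u.
Proof. by apply: val_inj; rewrite /= gdom_id. Qed.

Lemma rng_val (u : units G) : rng (val u) = u.
Proof. by apply: val_inj; rewrite /= gran_id. Qed.

Lemma units_open : open (units G).
Proof.
rewrite openE => u [x _ ux].
have [U [oU Uu _ [_ [g _ gK]]]] := (ecg_etale G).1 u.
have srcu : gdom u = u by rewrite -ux; exact: gdom_id (src x).
rewrite /interior nbhsE.
exists (U `&` (fun y => val (src y) : G) @^-1` U); last first.
  move=> y [Uy Usy]; exists y => //.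
  rewrite -[RHS](gK y) ?inE// -[LHS](gK (gdom y)) ?inE//.
  by rewrite -[in RHS](src_val (src y)).
split; last by split => //=; rewrite /preimage/= srcu.
apply: openI => //; apply: open_comp => // y _.
by apply: continuous_comp;
  [exact: src_continuous | exact: val_units_continuous].
Qed.

Lemma full_bisection_homeoP (h : homeo (units G)) :
  full_bisection_homeo h <->
  exists t : units G -> G,
    [/\ continuous t, cancel t src, open (range t) &
        forall x, rng (t x) = val h x].
Proof.
have [ch ch' hK h'K] := homeoV_funP h.
split=> [[B [cB [oB _ [_ [t ct tK]] _ _] sB rB hB]] | [t [ct tK ot ht]]].
- have tP x : B (t x) /\ src (t x) = x.
    have : [set: units G] x by [].
    by rewrite -sB => -[y By <-]; rewrite tK ?inE.
  have tB : range t = B.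
    rewrite eqEsubset; split => [_ [x _ <-]|y By]; first exact: (tP x).1.
    by exists (src y) => //; rewrite tK ?inE.
  exists t; split.
  + by move: ct; rewrite sB -continuous_subspace_setT.
  + by move=> x; exact: (tP x).2.
  + by rewrite tB.
  + by move=> x; rewrite -hB ?(tP x).2//; exact: (tP x).1.
- have sT : src @` range t = setT.
    rewrite eqEsubset; split => // x _.
    by exists (t x); [exists x | rewrite tK].
  have rT : rng @` range t = setT.
    rewrite eqEsubset; split => // x _.
    exists (t (homeoV_fun h x)); first by exists (homeoV_fun h x).
    by rewrite ht h'K.
  exists (range t); split => //.
  + apply: continuous_compact; last exact: units_compact.
    exact: continuous_subspaceT.
  + split => //; rewrite ?sT ?rT; try exact: openT.
    * split; first exact/continuous_subspaceT/src_continuous.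
      exists t; first by rewrite sT; exact: continuous_subspaceT.
      by move=> _ /set_mem [x _ <-]; rewrite tK.
    * split; first exact/continuous_subspaceT/rng_continuous.
      exists (t \o homeoV_fun h).
        rewrite rT; apply: continuous_subspaceT => x.
        by apply: continuous_comp; [exact: ch' | exact: ct].
      by move=> _ /set_mem [x _ <-] /=; rewrite ht hK.
  + by move=> _ [x _ <-]; rewrite tK ht.
Qed.

Lemma full_group_closed : group_closed full_group_pred.
Proof.
split=> [|f h /asboolP/full_bisection_homeoP [t [ct tK ot ft]]
             /asboolP/full_bisection_homeoP [u [cu uK ou hu]]];
  apply/asboolP/full_bisection_homeoP.
  exists (fun x : units G => val x); split.
  - exact: val_units_continuous.
  - exact: src_val.
  - suff -> : range (fun x : units G => val x : G) = units G.
      exact: units_open.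
    rewrite eqEsubset; split => [_ [x _ <-]|x ux].
      by case: x => x /= /set_mem.
    by exists (exist _ x (mem_set ux)).
  - by move=> x; rewrite rng_val.
have [ch ch' hK h'K] := homeoV_funP h.
set k := homeoV_fun h in ch' hK h'K *.
have ctk : continuous (t \o k).
  by move=> x; apply: continuous_comp; [exact: ch' | exact: ct].
have cuk : continuous (u \o k).
  by move=> x; apply: continuous_comp; [exact: ch' | exact: cu].
have domt x : gdom (t x) = val x by rewrite -[in RHS](tK x).
have domu x : gdom (u x) = val x by rewrite -[in RHS](uK x).
have ranu x : gran (u x) = val (val h x) by rewrite -hu.
have tu x : gdom (t x) = gran (ginv (u x)) by rewrite gran_inv domt domu.
exists (fun x => gmul ((t \o k) x) (ginv ((u \o k) x))); split => /=.
- apply: gmul_comp_continuous => //.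
  by move=> x; apply: continuous_comp; [exact: cuk | exact: ginv_continuous].
- move=> x; apply: val_inj.
  by rewrite /= gdom_mul // gdom_inv ranu h'K.
- pose w (y : G) := gmul y (u (k (src y))).
  have cw : continuous w.
    apply: gmul_comp_continuous => //.
    + by move=> y; exact: cvg_id.
    + move=> y; apply: (@continuous_comp _ _ _ src (u \o k)).
        exact: src_continuous.
      exact: cuk.
    + by move=> y; rewrite ranu h'K.
  suff -> : [set gmul (t (k x)) (ginv (u (k x))) | x in [set: units G]] =
      w @^-1` range t by apply: open_comp.
  have uV x : gmul (ginv (u x)) (u x) = val x by rewrite -domu.
  rewrite eqEsubset; split => [_ [x _ <-]|y [z _]]; rewrite /preimage /w /=.
  + exists (k x) => //.
    have -> : src (gmul (t (k x)) (ginv (u (k x)))) = x.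
      by apply: val_inj; rewrite /= gdom_mul // gdom_inv ranu h'K.
    by rewrite -gmulA ?gdom_inv // uV -domt gmul_dom.
  + set x := k (src y) => tz.
    have yu : gdom y = gran (u x) by rewrite ranu h'K.
    have zx : z = x by apply: val_inj; rewrite -domt tz gdom_mul // domu.
    exists (src y) => //=; rewrite -/x -[X in t X]zx tz -gmulA ?gran_inv //.
    by rewrite -[gmul (u x) _]/(gran (u x)) -yu gmul_dom.
- move=> x; apply: val_inj.
  by rewrite /= gran_mul // -[gran _]/(val (rng _)) ft.
Qed.

Definition full_group : Type := {h : homeo (units G) | full_group_pred h}.
HB.instance Definition _ := SubChoice.on full_group.
HB.instance Definition _ :=
  SubChoice_isSubGroup.Build (homeo (units G)) full_group_pred full_group
    full_group_closed.

End FullGroup.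

Section Abelianisation.
Variable K : groupType.
Local Open Scope group_scope.

Definition commutator_subgroup : set K :=
  [set x | forall H : set K, H 1 ->
     (forall a b, H a -> H b -> H (a * b)) ->
     (forall a, H a -> H a^-1) ->
     (forall a b, H [~ a, b]) -> H x].

(* The underlying set of the abelianisation: the set of cosets of the
   commutator subgroup. *)
Definition abelianisation : set (set K) :=
  [set [set a * b | b in commutator_subgroup] | a in [set: K]].

End Abelianisation.

Arguments commutator_subgroup : clear implicits.
Arguments abelianisation : clear implicits.

Section Homology.
Local Open Scope ring_scope.

Definition Cc (Y : topologicalType) : set (Y -> int) :=
  [set phi : Y -> int | continuous (phi : Y -> discrete_topology int) /\
             compact (closure [set y | phi y != 0])].

(* The finitely supported sum vanishes by convention on infinite supports,
   which do not occur for f a local homeomorphism and phi in [Cc Y]. *)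
Definition pushforward_int (Y Z : topologicalType) (f : Y -> Z)
    (phi : Y -> int) : Z -> int :=
  fun z => \sum_(y \in f @^-1` [set z]) phi y.

(* The underlying set of the quotient of A by its subgroup B. *)
Definition cosets (V : zmodType) (A B : set V) : set (set V) :=
  [set [set a + b | b in B] | a in A].

Variable G : topGroupoid.

Definition composable : set (G * G) := [set p | gdom p.1 = gran p.2].

Definition face0 (p : composable) : G := (val p).2.
Definition face1 (p : composable) : G := gmul (val p).1 (val p).2.
Definition face2 (p : composable) : G := (val p).1.

Definition boundary1 (phi : G -> int) : units G -> int :=
  pushforward_int src phi - pushforward_int rng phi.

Definition boundary2 (phi : composable -> int) : G -> int :=
  pushforward_int face0 phi - pushforward_int face1 phi
    + pushforward_int face2 phi.

Definition homology0 : set (set (units G -> int)) :=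
  cosets (@Cc (units G)) (boundary1 @` @Cc G).

Definition homology1 : set (set (G -> int)) :=
  cosets (@Cc G `&` [set phi | boundary1 phi = 0])
         (boundary2 @` @Cc composable).

End Homology.

Arguments homology0 : clear implicits.
Arguments homology1 : clear implicits.

(* A standard Borel space is one isomorphic to a Polish space with its Borel
   sigma-algebra. *)
Definition standard_borel (R : realType) (d : measure_display)
    (Z : measurableType d) : Prop :=
  exists (P : completePseudoMetricType R) (f : Z -> P) (g : P -> Z),
    [/\ hausdorff_space P,
        exists2 D : set P, countable D & dense D,
        cancel f g,
        cancel g f &
        forall A : set Z, measurable A <-> <<s @open P >> (f @` A)].

Section Actions.
Variables (K : groupType) (R : realType) (d : measure_display).
Variables (Z : measurableType d) (mu : probability Z R).

Record pmp_action := PmpAction {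
  act :> K -> Z -> Z;
  act1 : forall z, act 1%g z = z;
  actM : forall g h z, act (g * h)%g z = act g (act h z);
  act_measurable : forall g, measurable_fun setT (act g);
  act_preserving : forall g A, measurable A -> mu (act g @^-1` A) = mu A
}.

Variable a : pmp_action.

Definition faithful_action : Prop :=
  forall g : K, g <> 1%g -> ~ {ae mu, forall z, a g z = z}.

(* Invariance is up to null sets; for countable groups this is equivalent to
   considering strictly invariant sets only. *)
Definition ergodic_action : Prop :=
  forall A : set Z, measurable A ->
    (forall g, mu ((a g @^-1` A) `+` A) = 0%E) ->
    mu A = 0%E \/ mu A = 1%E.

Definition essentially_free_action : Prop :=
  forall g : K, g <> 1%g -> mu [set z | a g z = z] = 0%E.

End Actions.

(* Main.v *)
From HB Require Import structures.
Require Import Defs.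
From mathcomp Require Import all_boot all_order all_algebra fingroup perm cyclic.
From mathcomp Require Import all_classical all_reals all_analysis measurable_realfun.
From mathcomp Require Import zify.

(** Let X be the unit space of G and F its full group. Everything rests on two
    facts. By pure infiniteness and minimality, infinitely many disjoint copies
    of X fit into any nonempty open set ([copy_seq_in]). Any two finite families
    of copies of a clopen set, neither of which fills X, are conjugate in F
    ([homogeneity]).

    Freeness. Suppose that g <> 1 has a fixed-point set of positive measure. Take
    a clopen set A that g moves off itself. Conjugating g by elements that are
    trivial on A gives infinitely many elements that move A into disjoint sets,
    and two of them, g1 and g2, have common fixed points on a set S of positive
    measure ([fixset_meet]). Put n copies of X into A and let Sym(n) permute
    them. On average a point z of S returns to S under a definite proportion of
    Sym(n) ([many_returns]). If s is a return, then s times an element supported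
    in g1(A) fixes z, and likewise with g2(A). The permutations with this
    property form a subgroup of bounded index, which contains all elements of
    order p for a fixed large prime p; in the commutator of two of them the
    corrections supported in g1(A) and g2(A) cancel ([returns_commutator_fix]).
    So the common fixed points of all commutators of elements of order p of
    Sym(n) have measure bounded below, uniformly in n. By homogeneity this
    measure depends on n only, and not on the copies. Hence the set Y of points
    fixed for all n is, up to null sets, the same for a sequence of copies and
    for any subsequence, then for any two disjoint sequences, and finally for a
    sequence and its translates under F ([common_fix_invariant]). By ergodicity Y
    has full measure. As Sym(p + 1) has noncommuting elements of order p
    ([noncommuting_order]), a nontrivial element of F then acts trivially, which
    contradicts faithfulness.

    Finiteness of the abelianisation. Consider the transpositions, which exchange
    two disjoint copies of a clopen set A. By homogeneity the class of such an
    element in the abelianisation depends on A only ([theta_swap]). This class is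
    additive in A and invariant under bisections ([theta_slice]), so that it is a
    function of the class of the indicator of A in H_0(G); the subgroup generated
    by the transpositions is therefore finite if H_0(G) is. Modulo
    transpositions, an element of F acting on finitely many levels, that is,
    copies of X, is determined by the number of times it follows each arrow that
    is not a unit ([realizes_count]). The boundary of a composable pair (U, V) of
    bisections replaces the arrows of U V by those of U and V, and both
    configurations, closed up by the inverses of U and V, are followed by
    products of transpositions ([realizes_rectangle]). Hence elements with
    homologous bisections agree modulo commutators and transpositions
    ([homologous_class]), and the abelianisation modulo transpositions is finite
    if H_1(G) is. *)

Set Implicit Arguments.
Unset Strict Implicit.
Unset Printing Implicit Defensive.

Import Order.TTheory GRing.Theory Num.Theory.

(** A large subset of a finite group generates a subgroup of index less than p,
    whose cosets cannot be permuted nontrivially by an element of order p. *)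
Lemma large_subset_contains (gT : finGroupType) (M : {group gT}) (R : {set gT})
    (p : nat) (x : gT) : prime p -> R \subset M -> (#|gT| < p * #|R|)%N ->
  (x ^+ p = 1)%g -> x \in M.
Proof.
move=> pp RM gR xp.
have gTE : #|gT| = #|(finset.setTfor gT)| by rewrite cardsT.
have iM : (#|(finset.setTfor gT) : M|%g < p)%N.
  rewrite -(ltn_pmul2l (cardG_gt0 M)).
  have /= -> := Lagrange (finset.subsetT M).
  rewrite -gTE [X in (_ < X)%N]mulnC.
  by apply: leq_trans gR _; rewrite leq_mul2l subset_leq_card ?orbT.
have ix : (#|<[x]> : M|%g <= #|finset.setTfor gT : M|%g)%N.
  by apply: subset_leq_card; apply: imsetS; exact: finset.subsetT.
have : (#|<[x]> : M|%g %| p)%N.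
  by apply: dvdn_trans (dvdn_indexg _ _) _; rewrite order_dvdn xp.
have [_ dp] := primeP pp; move=> /dp /orP[|/eqP e].
  by rewrite indexg_eq1 cycle_subG.
by move: ix; rewrite e leqNgt iM.
Qed.


Local Open Scope classical_set_scope.

(** * The unit space and compact open bisections *)

(** Induction along a finite clopen partition of a compact clopen set. If K could
    not be covered by finitely many sets all of whose clopen subsets satisfy P,
    the complements of such finite unions would form a proper filter on K, and
    a cluster point of it would contradict the local hypothesis. *)
Lemma compact_clopen_ind (Y : topologicalType) (K : set Y) (P : set Y -> Prop) :
  compact K -> clopen K -> P set0 ->
  (forall x, K x -> exists A, [/\ clopen A, A x &
     forall B, clopen B -> B `<=` A -> P B]) ->
  (forall A B, clopen A -> clopen B -> A `&` B = set0 -> P A -> P B ->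
     P (A `|` B)) ->
  P K.
Proof.
move=> cK oK P0 Ploc PU.
pose HP B := forall C, clopen C -> C `<=` B -> P C.
have HPU A B : clopen A -> clopen B -> HP A -> HP B -> HP (A `|` B).
  move=> oA oB hA hB C oC CAB; rewrite -(setUIDK C A); apply: PU.
  - exact: clopenI.
  - by rewrite setDE; apply: clopenI => //; apply: clopenC.
  - by apply/seteqP; split => // x [[_ ?] [_]].
  - by apply: hA; [exact: clopenI | exact: subIsetr].
  - apply: hB; first by rewrite setDE; apply: clopenI => //; apply: clopenC.
    by move=> x [/CAB[]].
pose F (U : set Y) := exists B, [/\ clopen B, HP B & K `\` B `<=` U].
have FF : Filter F.
  split.
  - exists set0; split => //; first exact: clopen0.
    by move=> C _; rewrite subset0 => ->.
  - move=> U V [A [oA hA KA]] [B [oB hB KB]]; exists (A `|` B); split.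
    + exact: clopenU.
    + exact: HPU.
    + move=> x [Kx nAB]; split; [apply: KA | apply: KB]; split => // ?; apply: nAB.
        by left.
      by right.
  - by move=> U V UV [A [oA hA KA]]; exists A; split => // x /KA /UV.
have [[B [oB hB KB]]|nF0] := pselect (F set0).
  by apply: hB => // x Kx; apply: contrapT => nB; exact: (KB x).
have FP : ProperFilter F by split.
have FK : F K by exists set0; split; [exact: clopen0 | move=> C _; rewrite subset0 => -> | move=> x []].
have [x [Kx clx]] := cK F FP FK.
have [A [oA Ax hA]] := Ploc x Kx.
have FA : F (~` A) by exists A; split => // y [].
have nA : nbhs x A by apply: open_nbhs_nbhs; split => //; exact: oA.1.
by have [y [nAy Ay]] := clx _ _ FA nA.
Qed.

Lemma homeo_on_open (Y Z : topologicalType) (f : Y -> Z) (W U : set Y) :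
  homeo_on W f -> open W -> open (f @` W) -> open U -> U `<=` W -> open (f @` U).
Proof.
move=> [_ [g cg gK]] oW ofW oU UW.
have -> : f @` U = (f @` W) `&` g @^-1` U.
  apply/seteqP; split => [_ [x Ux <-]|_ [[x Wx <-]]].
    split; first by exists x => //; exact: UW.
    by rewrite /preimage/= gK ?inE//; exact: UW.
  by rewrite /preimage/= gK ?inE// => Ux; exists x.
by rewrite open_setSI//; move/continuousP: cg; exact.
Qed.

Lemma local_homeomorphism_open (Y Z : topologicalType) (f : Y -> Z) (U : set Y) :
  local_homeomorphism f -> open U -> open (f @` U).
Proof.
move=> lf oU; rewrite openE => _ [x Ux <-].
have [W [oW Wx ofW hW]] := lf x.
have oUW : open (f @` (U `&` W)).
  by apply: (homeo_on_open hW) => //; exact: openI.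
rewrite /interior nbhsE; exists (f @` (U `&` W)).
  by split => //; exists x.
by apply: image_subset; exact: subIsetl.
Qed.

Section LocalMaps.
Variable G : etaleCantorGroupoid.
Local Notation X := (units G).
Implicit Types (A B : set X) (f g h a b : X -> X) (x y z : X).

Lemma units_zero_dimensional : zero_dimensional X.
Proof.
have [f [g [cf cg fK gK]]] := ecg_cantor G.
move=> x y xy.
have fxy : f x != f y by apply: contra_neq xy => /(can_inj fK).
have [U [oU Ux Uy]] := cantor_zero_dimensional fxy.
by exists (f @^-1` U); split => //; exact: preimage_clopen.
Qed.

Lemma units_nonempty : exists x : X, True.
Proof. by have [k [k' _]] := ecg_cantor G; exists (k' point). Qed.

Lemma units_hausdorff : hausdorff_space X.
Proof.
rewrite open_hausdorff => x y xy.
have [U [[oU cU] Ux Uy]] := units_zero_dimensional xy.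
exists (U, ~` U) => /=; first by split; apply/mem_set.
by split => //=; [exact: closed_openC | rewrite setICr].
Qed.

Lemma clopen_basis x (U : set X) : open U -> U x ->
  exists A, [/\ clopen A, A x & A `<=` U].
Proof.
move=> oU Ux.
have := @zero_dimensional_cvg _ x units_hausdorff units_zero_dimensional
  (@units_compact G).
move=> /(_ U) []; first by apply: open_nbhs_nbhs.
by move=> A [Ax oA] AU; exists A.
Qed.

Lemma clopen_compact A : clopen A -> compact A.
Proof. by move=> [_ cA]; exact: (subclosed_compact cA (@units_compact G)). Qed.

Lemma compact_open_clopen A : compact A -> open A -> clopen A.
Proof. by move=> cA oA; split => //; exact: compact_closed units_hausdorff cA. Qed.

Lemma clopen_ind (P : set X -> Prop) :
  P set0 ->
  (forall x, exists A, [/\ clopen A, A x & forall B, clopen B -> B `<=` A -> P B]) ->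
  (forall A B, clopen A -> clopen B -> A `&` B = set0 -> P A -> P B ->
     P (A `|` B)) ->
  P setT.
Proof.
move=> P0 Pl PU; apply: compact_clopen_ind => //.
exact: units_compact.
exact: clopenT.
Qed.

Lemma src_open (U : set G) : open U -> open (src @` U).
Proof. by move=> oU; apply: local_homeomorphism_open => //; exact: (ecg_etale G).1. Qed.

Lemma rng_open (U : set G) : open U -> open (rng @` U).
Proof. by move=> oU; apply: local_homeomorphism_open => //; exact: (ecg_etale G).2. Qed.

(** A compact open bisection. *)
Definition slice (U : set G) : Prop :=
  [/\ open U, compact U, set_inj U src & set_inj U rng].

(** The unit space is compact and zero-dimensional, so that the local inverses of
    src can be restricted to small clopen sets. *)
Lemma slice_basis (u : G) (O : set G) : open O -> O u ->
  exists U, [/\ slice U, U u & U `<=` O].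
Proof.
move=> oO Ou.
have [W [oW Wu osW [csW [t ct tK]]]] := (ecg_etale G).1 u.
have [V [oV Vu orV [crV [t' ct' t'K]]]] := (ecg_etale G).2 u.
have hW : homeo_on W (@src G) by split => //; exists t.
pose N := W `&` (V `&` O).
have NW : N `<=` W by exact: subIsetl.
have oN : open N by do 2?apply: openI.
have Nu : N u by [].
have [A [oA Au AN]] : exists A, [/\ clopen A, A (src u) & A `<=` src @` N].
  apply: clopen_basis; last by exists u.
  exact: (homeo_on_open hW).
have tA x : A x -> N (t x) /\ src (t x) = x.
  by move=> /AN [y Ny <-]; rewrite tK ?inE//; exact: NW.
exists (t @` A); split; last by move=> _ [x /tA [] [_ [_ ?]] _ <-].
- split.
  + have -> : t @` A = N `&` src @^-1` A.
      apply/seteqP; split => [_ [x Ax <-]|y [Ny Ay]].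
        by have [? sx] := tA x Ax; split => //; rewrite /preimage/= sx.
      by exists (src y) => //; rewrite tK ?inE//; exact: NW.
    apply: openI => //; apply: open_comp => [? _|]; last exact: oA.1.
    exact: src_continuous.
  + apply: continuous_compact; last exact: clopen_compact.
    apply: continuous_subspaceW ct => x /AN.
    exact: image_subset.
  + move=> _ _ /set_mem[x Ax <-] /set_mem[y Ay <-].
    by rewrite (tA x Ax).2 (tA y Ay).2 => ->.
  + move=> _ _ /set_mem[x /tA[[_ [Vx _]] _] <-] /set_mem[y /tA[[_ [Vy _]] _] <-].
    by move=> /(congr1 t'); rewrite !t'K ?inE.
- by exists (src u) => //; rewrite tK ?inE.
Qed.

(** Near x, the map f is given by arrows of G, that is, it belongs to the
    pseudogroup of G. *)
Definition germ f x : Prop :=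
  exists U u, [/\ open U, U u, src u = x & forall v : G, U v -> f (src v) = rng v].

Lemma germ_near f g x : germ f x -> nbhs x [set y | f y = g y] -> germ g x.
Proof.
move=> [U [u [oU Uu ux fU]]]; rewrite nbhsE => -[W [oW Wx] Wfg].
exists (U `&` src @^-1` W), u; split => //.
- apply: openI => //; apply: open_comp => // ? _; exact: src_continuous.
- by rewrite /preimage/=; split => //; rewrite ux.
- by move=> v [Uv Wv]; rewrite -(Wfg _ Wv) fU.
Qed.

Lemma germ_eqon A f g x : open A -> A x -> (forall y, A y -> f y = g y) ->
  germ f x -> germ g x.
Proof.
move=> oA Ax fg lf; apply: (germ_near lf).
by rewrite nbhsE; exists A.
Qed.

Lemma germ_id x : germ id x.
Proof.
exists (units G), (val x); split; first exact: units_open.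
- by case: x => x /= /set_mem.
- by rewrite src_val.
- move=> v uv; have [w <-] : exists w : X, val w = v.
    by exists (SigSub (mem_set uv)).
  by rewrite src_val rng_val.
Qed.

Lemma germ_cont f x : germ f x -> {for x, continuous f}.
Proof.
move=> [U [u [oU Uu ux fU]]] W /=.
have -> : f x = rng u by rewrite -ux fU.
move=> /(@rng_continuous G); rewrite /= nbhsE => -[V [oV Vu] VW].
rewrite nbhs_simpl/= nbhsE; exists (src @` (U `&` V)).
  by split; [apply: src_open; exact: openI | exists u].
by move=> _ [v [Uv Vv] <-]; rewrite /preimage/= fU //; exact: VW.
Qed.

(** The section of src through U, extended by the units off src(U). *)
Definition sect (U : set G) (x : X) : G := xget (val x) [set u | U u /\ src u = x].

Lemma sectK (U : set G) u : slice U -> U u -> sect U (src u) = u.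
Proof.
move=> [_ _ sU _] Uu; rewrite /sect; case: xgetP => [v -> [Uv vu]|/(_ u)].
  by apply: sU; rewrite ?inE.
by case.
Qed.

Lemma sect_out (U : set G) x : ~ (src @` U) x -> sect U x = val x.
Proof.
by move=> nx; rewrite /sect; case: xgetP => // u _ [Uu ux]; case: nx; exists u.
Qed.

Lemma src_sect (U : set G) x : slice U -> src (sect U x) = x.
Proof.
move=> sU; have [[u Uu <-]|nx] := pselect ((src @` U) x); first by rewrite sectK.
by rewrite sect_out // src_val.
Qed.

Lemma slice_src_clopen (U : set G) : slice U -> clopen (src @` U).
Proof.
move=> [oU cU _ _]; apply: compact_open_clopen; last exact: src_open.
by apply: continuous_compact => //; apply: continuous_subspaceT; exact: src_continuous.
Qed.

Lemma slice_rng_clopen (U : set G) : slice U -> clopen (rng @` U).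
Proof.
move=> [oU cU _ _]; apply: compact_open_clopen; last exact: rng_open.
by apply: continuous_compact => //; apply: continuous_subspaceT; exact: rng_continuous.
Qed.

Lemma sect_cont (U : set G) : slice U -> continuous (sect U).
Proof.
move=> sU x W; have [oU _ _ _] := sU.
have [[u Uu <-]|nx] := pselect ((src @` U) x).
  rewrite sectK // => /filterI /(_ (open_nbhs_nbhs (conj oU Uu))).
  rewrite nbhsE => -[V [oV Vu] VWU]; rewrite nbhs_simpl/= nbhsE.
  exists (src @` V); first by split; [exact: src_open | exists u].
  by move=> _ [v /VWU [Wv Uv] <-]; rewrite /preimage/= sectK.
rewrite sect_out // => /(@val_units_continuous G) /= nW.
have /filterI/(_ nW) : nbhs x (~` (src @` U)).
  apply: open_nbhs_nbhs; split => //; apply: closed_openC.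
  by case: (slice_src_clopen sU).
by apply: filterS => y [ny]; rewrite /preimage/= sect_out.
Qed.

Lemma src_eq (u v : G) : src u = src v <-> gdom u = gdom v.
Proof. by split => [/(congr1 val)//|e]; exact: val_inj. Qed.

Lemma src_rng_eq (u v : G) : src u = rng v <-> gdom u = gran v.
Proof. by split => [/(congr1 val)//|e]; exact: val_inj. Qed.

Lemma src_mul (u v : G) : src u = rng v -> src (gmul u v) = src v.
Proof. by move/src_rng_eq => e; apply: val_inj; rewrite /= gdom_mul. Qed.

Lemma rng_mul (u v : G) : src u = rng v -> rng (gmul u v) = rng u.
Proof. by move/src_rng_eq => e; apply: val_inj; rewrite /= gran_mul. Qed.

Lemma src_inv (u : G) : src (ginv u) = rng u.
Proof. by apply: val_inj; rewrite /= gdom_inv. Qed.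

Lemma rng_inv (u : G) : rng (ginv u) = src u.
Proof. by apply: val_inj; rewrite /= gran_inv. Qed.

Lemma gmulK (u v : G) : src u = rng v -> gmul (gmul u v) (ginv v) = u.
Proof.
move/src_rng_eq => e; rewrite -gmulA // ?gran_inv//.
by rewrite -[gmul v _]/(gran v) -e gmul_dom.
Qed.

Lemma gmulVK (u v : G) : src u = src v -> gmul (gmul u (ginv v)) v = u.
Proof.
move/src_eq => e; rewrite -gmulA // ?gran_inv ?gdom_inv//.
by rewrite -[gmul _ v]/(gdom v) -e gmul_dom.
Qed.

Lemma ginvK (u : G) : ginv (ginv u) = u.
Proof.
rewrite -[LHS]gmul_dom gdom_inv gran_inv /gdom gmulA ?gdom_inv ?gran_inv//.
by rewrite -[gmul (ginv _) (ginv u)]/(gdom (ginv u)) gdom_inv gran_mul_id.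
Qed.

Definition gprod (U V : set G) : set G :=
  [set w | exists u v, [/\ U u, V v, src u = rng v & w = gmul u v]].

Lemma gmul_cvg (Y : topologicalType) (p q : Y -> G) (y : Y) (D : set Y) :
  open D -> D y -> {for y, continuous p} -> {for y, continuous q} ->
  (forall w, D w -> src (p w) = rng (q w)) ->
  {for y, continuous (fun w => gmul (p w) (q w))}.
Proof.
move=> oD Dy cp cq pq.
have py : gdom (p y) = gran (q y) by apply/src_rng_eq; exact: pq.
have /subspace_continuousP/(_ (p y, q y) py) := @gmul_continuous G.
move=> cm W /cm nW.
have cpq : (fun w => (p w, q w)) @ y --> (p y, q y) by apply: cvg_pair.
have := cpq _ nW; rewrite /= nbhs_simpl /= => /(filterI (open_nbhs_nbhs (conj oD Dy))).
by apply: filterS => w /= [/pq/src_rng_eq pqw]; exact.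
Qed.

(** If w is near u v, then w v'^-1 is near u, where v' is the arrow with the same
    source as w on a bisection through v. *)
Lemma gprod_open (U V : set G) : open U -> open V -> open (gprod U V).
Proof.
move=> oU oV; rewrite openE => w [u [v [Uu Vv uv ->]]].
have [V' [[oV' cV' sV' rV'] V'v V'V]] := slice_basis oV Vv.
have sV := And4 oV' cV' sV' rV'; pose t := sect V'.
have tK v' : V' v' -> t (src v') = v' by exact: sectK.
have ct := sect_cont sV.
pose D := src @^-1` (src @` V').
have oD : open D.
  by apply: open_comp; [move=> ? _; exact: src_continuous | exact: src_open].
have Dw : D (gmul u v) by exists v => //; rewrite src_mul.
have tD (z : G) : D z -> V' (t (src z)) /\ src (t (src z)) = src z.
  by move=> [x V'x <-]; rewrite tK.
have ctw : {for gmul u v, continuous (t \o src)}.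
  apply: continuous_comp; first exact: src_continuous.
  exact: ct.
have cti : {for gmul u v, continuous (fun z : G => ginv (t (src z)))}.
  by apply: continuous_comp ctw _; exact: ginv_continuous.
have := gmul_cvg oD Dw (@cvg_id _ _) cti.
have Hs (z : G) : D z -> src z = rng (ginv (t (src z))).
  by move=> /tD [_ e]; rewrite rng_inv.
move=> /(_ Hs) /(_ U).
rewrite /= src_mul // tK // gmulK // => /(_ (open_nbhs_nbhs (conj oU Uu))).
move=> /(filterI (open_nbhs_nbhs (conj oD Dw))); apply: filterS.
move=> z [Dz]; rewrite /preimage/= => Uz; have [V't st] := tD z Dz.
exists (gmul z (ginv (t (src z)))), (t (src z)); split => //.
- exact: V'V.
- by rewrite src_mul ?src_inv//; exact: Hs.
- by rewrite gmulVK.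
Qed.

Lemma germ_comp f g x : germ f x -> germ g (f x) -> germ (g \o f) x.
Proof.
move=> [U [u [oU Uu ux fU]]] [V [v [oV Vv vx gV]]].
have vu : src v = rng u by rewrite vx -ux fU.
exists (gprod V U), (gmul v u); split.
- exact: gprod_open.
- by exists v, u.
- by rewrite src_mul.
- move=> _ [v' [u' [Vv' Uu' e ->]]].
  by rewrite src_mul // rng_mul //= fU // -e gV.
Qed.

Lemma ginv_open (U : set G) : open U -> open (@ginv G @` U).
Proof.
move=> oU; have -> : @ginv G @` U = @ginv G @^-1` U.
  apply/seteqP; split => [_ [u Uu <-]|u Uu]; first by rewrite /preimage/= ginvK.
  by exists (ginv u) => //; rewrite ginvK.
by apply: open_comp => // ? _; exact: ginv_continuous.
Qed.

Lemma germ_inv A f g x : open A -> A x -> (forall y, A y -> g (f y) = y) ->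
  germ f x -> germ g (f x).
Proof.
move=> oA Ax gK [U [u [oU Uu ux fU]]].
exists (@ginv G @` (U `&` src @^-1` A)), (ginv u); split.
- apply: ginv_open; apply: openI => //.
  by apply: open_comp => // ? _; exact: src_continuous.
- by exists u => //; split => //; rewrite /preimage/= ux.
- by rewrite src_inv -ux fU.
- move=> _ [v [Uv Av] <-]; rewrite src_inv rng_inv -fU // gK //.
Qed.

Lemma germ_image_open A f : open A -> (forall x, A x -> germ f x) -> open (f @` A).
Proof.
move=> oA lf; rewrite openE => _ [x Ax <-].
have [U [u [oU Uu ux fU]]] := lf x Ax.
rewrite /interior nbhsE; exists (rng @` (U `&` src @^-1` A)).
  split; first apply: rng_open.
    apply: openI => //; apply: open_comp => // ? _; exact: src_continuous.
  by exists u; [split => //; rewrite /preimage/= ux | rewrite -ux fU].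
by move=> _ [v [Uv Av] <-]; exists (src v) => //; rewrite fU.
Qed.

Lemma germ_image_clopen A f : clopen A -> (forall x, A x -> germ f x) ->
  clopen (f @` A).
Proof.
move=> oA lf; apply: compact_open_clopen; last exact: (germ_image_open oA.1).
apply: continuous_compact; last exact: clopen_compact.
rewrite continuous_open_subspace; last by case: oA.
by move=> x /set_mem/lf/germ_cont.
Qed.

(** A homeomorphism that is locally given by arrows of G is given by a single
    compact open bisection, glued from the local ones along a finite clopen
    partition. *)
Lemma full_group_of f g : cancel f g -> cancel g f -> (forall x, germ f x) ->
  exists h : full_group G, forall x, val (val h) x = f x.
Proof.
move=> fK gK lf.
have lg x : germ g x.
  by rewrite -(gK x); apply: (@germ_inv setT f g) => //; exact: openT.
have hf : homeomorphism f.
  by exists g; split => // x; apply: germ_cont.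
suff [t [ct tK rt]] : exists t : X -> G, [/\ continuous t, cancel t src & forall x, rng (t x) = f x].
  have ot : open (range t).
    rewrite openE => _ [x _ <-].
    have [W [[oW cW sW rW] Wx _]] := slice_basis openT (I : setT (t x)).
    have oV : open (W `&` (t \o src) @^-1` W).
      apply: openI => //; apply: open_comp => // y _.
      by apply: continuous_comp; [exact: src_continuous | exact: ct].
    rewrite /interior nbhsE; eexists; first split; [exact: oV | | ].
      by split => //; rewrite /preimage/= tK.
    move=> y [Wy Wty]; exists (src y) => //.
    by apply: sW; rewrite ?inE// tK.
  have hp : `[< homeomorphism f >] by apply/asboolP.
  pose h0 : homeo X := Sub f hp.
  have fp : full_group_pred h0.
    by apply/asboolP/full_bisection_homeoP; exists t; split.
  by exists (Sub h0 fp) => x; rewrite !SubK.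
suff [t [ct tK rt]] : exists t : X -> G, [/\ (forall x, setT x -> {for x, continuous t}),
    (forall x, setT x -> src (t x) = x) & (forall x, setT x -> rng (t x) = f x)].
  by exists t; split => // x; [exact: ct | exact: tK | exact: rt].
pose P A := exists t : X -> G, [/\ (forall x, A x -> {for x, continuous t}),
    (forall x, A x -> src (t x) = x) & (forall x, A x -> rng (t x) = f x)].
apply: (@clopen_ind P).
- by exists (fun x => val x); split.
- move=> x; have [U [u [oU Uu ux fU]]] := lf x.
  have [W [sW Wu WU]] := slice_basis oU Uu.
  have [oW _ _ _] := sW; pose t := sect W.
  have tK w : W w -> t (src w) = w by exact: sectK.
  have ct := sect_cont sW.
  have [A [oA Ax AW]] : exists A, [/\ clopen A, A x & A `<=` src @` W].
    by apply: clopen_basis; [exact: src_open | exists u].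
  exists A; split => // B oB BA; exists t; split => y /BA/AW [v Wv <-].
  + exact: ct.
  + by rewrite tK.
  + by rewrite tK // fU //; exact: WU.
- move=> A B oA oB AB [t [ct tK rt]] [t' [ct' tK' rt']].
  pose s x := if `[< A x >] then t x else t' x.
  have sA x : A x -> s x = t x by move=> ?; rewrite /s asboolT.
  have sB x : B x -> s x = t' x.
    move=> Bx; rewrite /s asboolF // => Ax.
    by have : (A `&` B) x by []; rewrite AB.
  exists s; split.
  + move=> x [Ax|Bx] W /=.
      rewrite (sA x Ax) => /(ct x Ax) /= /(filterI (open_nbhs_nbhs (conj oA.1 Ax))).
      by apply: filterS => y [Ay]; rewrite /preimage/= sA.
    rewrite (sB x Bx) => /(ct' x Bx) /= /(filterI (open_nbhs_nbhs (conj oB.1 Bx))).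
    by apply: filterS => y [By]; rewrite /preimage/= sB.
  + by move=> x [Ax|Bx]; [rewrite sA // tK | rewrite sB // tK'].
  + by move=> x [Ax|Bx]; [rewrite sA // rt | rewrite sB // rt'].
Qed.

(** The homeomorphism from src(U) to rng(U) given by a slice U, extended by the
    identity. *)
Definition smap (U : set G) x : X := rng (sect U x).

Lemma smapE (U : set G) u : slice U -> U u -> smap U (src u) = rng u.
Proof. by move=> sU Uu; rewrite /smap sectK. Qed.

Lemma smap_germ (U : set G) x : slice U -> (src @` U) x -> germ (smap U) x.
Proof.
move=> sU [u Uu <-]; exists U, u; split => //; first by case: sU.
by move=> v Uv; rewrite smapE.
Qed.

Lemma smap_inj (U : set G) x y : slice U -> (src @` U) x -> (src @` U) y ->
  smap U x = smap U y -> x = y.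
Proof.
move=> sU [u Uu <-] [v Uv <-]; rewrite !smapE // => uv.
by congr src; case: sU => _ _ _; apply; rewrite ?inE.
Qed.

Lemma bisection_slice (U : set G) : compact U -> bisection U -> slice U.
Proof.
move=> cU [oU _ [_ [t _ tK]] _ [_ [t' _ t'K]]]; split => //.
- by move=> u v Uu Uv /(congr1 t); rewrite !tK.
- by move=> u v Uu Uv /(congr1 t'); rewrite !t'K.
Qed.

End LocalMaps.

(** * Elements of the full group that permute copies of a clopen set *)

Section Copies.
Local Open Scope group_scope.

Section Vertical.
Variable G : etaleCantorGroupoid.
Local Notation X := (units G).
Local Notation F := (full_group G).
Implicit Types (A B C : set X) (f g h k : F) (x y z : X).

Definition ap (h : F) : X -> X := val (val h).

Lemma apM f g x : ap (f * g) x = ap f (ap g x). Proof. by []. Qed.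

Lemma ap1 x : ap 1 x = x. Proof. by []. Qed.

Lemma apKV f x : ap f (ap f^-1 x) = x.
Proof. by rewrite -apM mulgV. Qed.

Lemma apVK f x : ap f^-1 (ap f x) = x.
Proof. by rewrite -apM mulVg. Qed.

Lemma ap_inj f : injective (ap f).
Proof. exact: can_inj (apVK f). Qed.

Lemma ap_ext f g : (forall x, ap f x = ap g x) -> f = g.
Proof. by move=> fg; do 2!apply: val_inj; apply/funext. Qed.

Lemma ap_germ f x : germ (ap f) x.
Proof.
have /asboolP/full_bisection_homeoP [t [ct tK ot ft]] := valP f.
exists (range t), (t x); split => //.
by move=> _ [y _ <-]; rewrite tK.
Qed.

Lemma ap_clopen f A : clopen A -> clopen (ap f @` A).
Proof. by move=> oA; apply: germ_image_clopen => // x _; exact: ap_germ. Qed.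

(** Separate a moved point from its image by a clopen set. *)
Lemma moved_off f : f <> 1 -> exists A, [/\ clopen A, A !=set0 &
  forall x y, A x -> A y -> x <> ap f y].
Proof.
move=> f1; have [x fx] : exists x, ap f x <> x.
  apply: contrapT => n; apply: f1; apply: ap_ext => x.
  by apply: contrapT => fx; apply: n; exists x.
have xfx : x != ap f x by apply/eqP => /esym.
have [U [oU Ux nUfx]] := units_zero_dimensional xfx.
exists (U `&` ap f @^-1` (~` U)); split; last 2 first.
- by exists x.
- by move=> y z [Uy _] [_ nUfz] yz; apply: nUfz; rewrite -yz.
apply: clopenI => //; apply: preimage_clopen; first exact: clopenC.
by move=> y; apply: germ_cont; exact: ap_germ.
Qed.

(** The family a embeds |I| disjoint copies of A into the unit space, by maps
    that are locally given by arrows of G. *)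
Definition copies (I : Type) A (a : I -> X -> X) : Prop :=
  [/\ clopen A, forall i x, A x -> germ (a i) x &
      forall i j x y, A x -> A y -> a i x = a j y -> i = j /\ x = y].

Lemma copiesS (I : Type) A B (a : I -> X -> X) : clopen A -> A `<=` B -> copies B a -> copies A a.
Proof.
move=> oA AB [_ la ia]; split => // [i x /AB|i j x y /AB Bx /AB By]; first exact: la.
exact: ia.
Qed.

Definition union_copies (I : Type) A (a : I -> X -> X) : set X :=
  [set y | exists i x, A x /\ a i x = y].

Lemma union_copies_clopen (I : finType) A (a : I -> X -> X) : copies A a -> clopen (union_copies A a).
Proof.
move=> [oA la _].
have -> : union_copies A a = \big[setU/set0]_(i <- enum I) (a i @` A).
  rewrite -bigcup_seq; apply/seteqP; split => [y [i [x [Ax <-]]]|y [i _ [x Ax <-]]].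
    by exists i; [rewrite /= mem_enum | exists x].
  by exists i, x.
elim/big_ind: _ => [|U V|i _]; [exact: clopen0 | exact: clopenU |].
by apply: germ_image_clopen => // x; exact: la.
Qed.

(** A map that sends a(y) to b(y) is b composed with the local inverse of a. *)
Lemma germ_conj B (a b c : X -> X) x : open B -> B x ->
  (forall y, B y -> germ a y) -> (forall y z, B y -> B z -> a y = a z -> y = z) ->
  germ b x -> (forall y, B y -> c (a y) = b y) -> germ c (a x).
Proof.
move=> oB Bx la inja lb cab.
pose g w := xget x [set y | B y /\ a y = w].
have gK y : B y -> g (a y) = y.
  move=> By; rewrite /g; case: xgetP => [z _ [Bz /inja]|/(_ y)]; first exact.
  by case.
have lg : germ g (a x) by apply: (germ_inv oB) => //; exact: la.
have lbg : germ (b \o g) (a x) by apply: germ_comp => //; rewrite gK.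
apply: (@germ_eqon _ (a @` B) (b \o g)) => //.
- exact: germ_image_open.
- by move=> _ [y By <-] /=; rewrite gK // cab.
Qed.

Section PermuteCopies.
Variable I : finType.
Implicit Types (a : I -> X -> X) (s : X -> {perm I}).

(** The permutation may vary with the base point, in a locally constant way. *)
Definition loc_const A s : Prop :=
  forall x, A x -> exists B, [/\ open B, B x & forall y, B y -> s y = s x].

Definition permutes_copies A a s f : Prop :=
  (forall i x, A x -> ap f (a i x) = a (s x i) x) /\
  (forall y, ~ union_copies A a y -> ap f y = y).

Lemma permutes_copies_ex A a s : copies A a -> loc_const A s -> exists f, permutes_copies A a s f.
Proof.
move=> ea ls; have [oA la inja] := ea.
have ex (t : X -> {perm I}) y : exists z,
    (forall i x, A x -> a i x = y -> z = a (t x i) x) /\ (~ union_copies A a y -> z = y).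
  have [[i [x [Ax axy]]]|ny] := pselect (union_copies A a y).
    exists (a (t x i) x); split => [j x' Ax'|[]]; last by exists i, x.
    by rewrite -axy => /(inja _ _ _ _ Ax' Ax) [-> ->].
  by exists y; split => // i x Ax axy; case: ny; exists i, x.
pose V t y := projT1 (cid (ex t y)).
have Va t i x : A x -> V t (a i x) = a (t x i) x.
  by move=> Ax; rewrite /V; case: cid => z /= [az _]; exact: az.
have Vn t y : ~ union_copies A a y -> V t y = y.
  by rewrite /V; case: cid => z /= [_ zn]; exact: zn.
have VK (t t' : X -> {perm I}) : (forall x, cancel (t x) (t' x)) -> cancel (V t) (V t').
  move=> tK y; have [[i [x [Ax <-]]]|ny] := pselect (union_copies A a y).
    by rewrite !Va // tK.
  by rewrite !Vn.
have lV y : germ (V s) y.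
  have [[i [x [Ax <-]]]|ny] := pselect (union_copies A a y).
    have [B [oB Bx sB]] := ls x Ax.
    apply: (@germ_conj (A `&` B) _ (a (s x i))).
    - by apply: openI => //; case: oA.
    - by [].
    - by move=> y' [Ay' _]; exact: la.
    - by move=> y' z [Ay' _] [Az _] /(inja _ _ _ _ Ay' Az) [].
    - exact: la.
    - by move=> y' [Ay' By']; rewrite Va // sB.
  apply: (@germ_eqon _ (~` union_copies A a) id); last exact: germ_id.
  - by apply: closed_openC; case: (union_copies_clopen ea).
  - by [].
  - by move=> y' ny'; rewrite Vn.
have [f hf] := full_group_of (VK s (fun x => (s x)^-1) (fun x => permK (s x)))
  (VK (fun x => (s x)^-1) s (fun x => permKV (s x))) lV.
by exists f; split => [i x Ax|y ny]; rewrite /ap hf ?Va ?Vn.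
Qed.

(** The element of the full group that permutes the copies a_i(A) of A, by the
    permutation s x on the fibre over x. *)
Definition permute_copies A a s : F := xget 1 [set f | permutes_copies A a s f].

Lemma permute_copiesP A a s : copies A a -> loc_const A s -> permutes_copies A a s (permute_copies A a s).
Proof.
move=> ea ls; rewrite /permute_copies; case: xgetP => // n.
by have [f fs] := permutes_copies_ex ea ls; case: (n f).
Qed.

Lemma permutes_copies_uniq A a s f g : permutes_copies A a s f -> permutes_copies A a s g -> f = g.
Proof.
move=> [fa fn] [ga gn]; apply: ap_ext => y.
have [[i [x [Ax <-]]]|ny] := pselect (union_copies A a y); first by rewrite fa // ga.
by rewrite fn // gn.
Qed.

Lemma loc_const_cst A (p : {perm I}) : loc_const A (fun=> p).
Proof. by move=> x _; exists setT; split => //; exact: openT. Qed.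

Lemma permute_copiesM A a (p r : {perm I}) : copies A a ->
  permute_copies A a (fun=> r * p) = permute_copies A a (fun=> p) * permute_copies A a (fun=> r).
Proof.
move=> ea; apply: (permutes_copies_uniq (permute_copiesP ea (loc_const_cst _))).
have [pa pn] := permute_copiesP ea (@loc_const_cst A p).
have [ra rn] := permute_copiesP ea (@loc_const_cst A r).
split => [i x Ax|y ny]; first by rewrite apM ra // pa // permM.
by rewrite apM rn // pn.
Qed.

Lemma permute_copies1 A a : copies A a -> permute_copies A a (fun=> 1) = 1.
Proof.
move=> ea; apply: (permutes_copies_uniq (permute_copiesP ea (loc_const_cst _))).
by split => // i x Ax; rewrite perm1.
Qed.

End PermuteCopies.

Definition pair_of (b c : X -> X) (i : bool) : X -> X := if i then c else b.

(** The transposition that exchanges the copies b(A) and c(A) of A. *)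
Definition swap A b c : F := permute_copies A (pair_of b c) (fun=> tperm true false).

Definition disjoint_copies A b c : Prop := copies A (pair_of b c).

Lemma swapP A b c : disjoint_copies A b c ->
  [/\ forall x, A x -> ap (swap A b c) (b x) = c x,
      forall x, A x -> ap (swap A b c) (c x) = b x &
      forall y, ~ (b @` A) y -> ~ (c @` A) y -> ap (swap A b c) y = y].
Proof.
move=> ea; have [sa sn] := permute_copiesP ea (@loc_const_cst _ A (tperm true false)).
split=> [x Ax|x Ax|y nb nc].
- by have := sa false x Ax; rewrite tpermR.
- by have := sa true x Ax; rewrite tpermL.
- by apply: sn => -[[] [x [Ax e]]]; [apply: nc | apply: nb]; exists x.
Qed.

Lemma swap_uniq A b c f : disjoint_copies A b c ->
  (forall x, A x -> ap f (b x) = c x) ->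
  (forall x, A x -> ap f (c x) = b x) ->
  (forall y, ~ (b @` A) y -> ~ (c @` A) y -> ap f y = y) -> f = swap A b c.
Proof.
move=> /swapP [sb sc sn] fb fc fn; apply: ap_ext => y.
have [[x Ax <-]|nb] := pselect ((b @` A) y); first by rewrite fb ?sb.
have [[x Ax <-]|nc] := pselect ((c @` A) y); first by rewrite fc ?sc.
by rewrite fn // sn.
Qed.

Lemma disjoint_copiesP A b c : clopen A ->
  (forall x, A x -> germ b x) -> (forall x, A x -> germ c x) ->
  (forall x y, A x -> A y -> b x = b y -> x = y) ->
  (forall x y, A x -> A y -> c x = c y -> x = y) ->
  (forall x y, A x -> A y -> b x <> c y) -> disjoint_copies A b c.
Proof.
move=> oA lb lc ib ic bc; split => // [[] x Ax|[] [] x y Ax Ay /= e]; rewrite /pair_of.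
- exact: lc.
- exact: lb.
- by split => //; exact: ic.
- by case: (bc y x).
- by case: (bc x y).
- by split => //; exact: ib.
Qed.

Lemma swap_inv A b c : disjoint_copies A b c -> swap A b c * swap A b c = 1.
Proof.
move=> d; have [sb sc sn] := swapP d; apply: ap_ext => y; rewrite apM ap1.
have [[x Ax <-]|nb] := pselect ((b @` A) y); first by rewrite sb ?sc.
have [[x Ax <-]|nc] := pselect ((c @` A) y); first by rewrite sc ?sb.
by rewrite !sn // sn.
Qed.

End Vertical.
Section Room.
Variable G : etaleCantorGroupoid.
Hypothesis hpi : purely_infinite G.
Hypothesis hmin : minimal G.
Local Notation X := (units G).
Local Notation F := (full_group G).
Implicit Types (A B C : set X) (f g h k : F) (x y z : X).

(** The form in which pure infiniteness is used. *)
Lemma pi_split A : clopen A -> exists b c : X -> X,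
  [/\ disjoint_copies A b c, forall x, A x -> A (b x) & forall x, A x -> A (c x)].
Proof.
move=> oA; have [B [B' [[cB bB] [cB' bB'] [sB sB'] BB' [rB rB']]]] :=
  hpi (clopen_compact oA) oA.1.
have slB := bisection_slice cB bB; have slB' := bisection_slice cB' bB'.
have inB x : A x -> (rng @` B) (smap B x).
  by rewrite -sB => -[u Bu <-]; exists u => //; rewrite smapE.
have inB' x : A x -> (rng @` B') (smap B' x).
  by rewrite -sB' => -[u Bu <-]; exists u => //; rewrite smapE.
exists (smap B), (smap B'); split.
- apply: disjoint_copiesP => //.
  + by move=> x Ax; apply: smap_germ => //; rewrite sB.
  + by move=> x Ax; apply: smap_germ => //; rewrite sB'.
  + by move=> x y Ax Ay; apply: smap_inj => //; rewrite sB.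
  + by move=> x y Ax Ay; apply: smap_inj => //; rewrite sB'.
  + move=> x y Ax Ay e.
    have : (rng @` B `&` rng @` B') (smap B x).
      by split; [exact: inB | rewrite e; exact: inB'].
    by rewrite BB'.
- by move=> x /inB; apply: rB.
- by move=> x /inB'; apply: rB'.
Qed.

(** Every copy of the unit space fits into any nonempty open set: minimality
    does it locally, and pure infiniteness keeps the finitely many local copies
    disjoint. *)
Lemma copy_in (O : set X) : open O -> O !=set0 -> exists w : X -> X,
  [/\ forall x, germ w x, injective w & forall x, O (w x)].
Proof.
move=> oO [x0 Ox0]; have [D [oD Dx0 DO]] := clopen_basis oO Ox0.
have [b [c [dbc Db Dc]]] := pi_split oD.
have [_ lbc ibc] := dbc.
pose P A := exists w : X -> X, [/\ forall x, A x -> germ w x,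
  (forall x y, A x -> A y -> w x = w y -> x = y) & forall x, A x -> D (w x)].
suff [w [lw iw Dw]] : P setT.
  exists w; split => // [x|x y|x]; [exact: lw | exact: iw |].
  by apply: DO; exact: Dw.
apply: (@clopen_ind _ P).
- by exists id; split.
- move=> x; have [y0 [Dy [u ux uy]]] := @hmin x D (ex_intro _ x0 Dx0) oD.1.
  rewrite -{}uy in Dy.
  have oU : open (@rng G @^-1` D).
    by apply: open_comp; [move=> ? _; exact: rng_continuous | case: oD].
  have [U [sU Uu UD]] := slice_basis oU (Dy : (@rng G @^-1` D) u).
  exists (src @` U); split; [exact: slice_src_clopen | by exists u |].
  move=> B oB BU; exists (smap U); split.
  + by move=> y /BU; exact: smap_germ.
  + by move=> y z /BU Uy /BU Uz; exact: smap_inj.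
  + by move=> y /BU [v Uv <-]; rewrite smapE //; exact: UD.
- move=> A B oA oB AB [w [lw iw Dw]] [w' [lw' iw' Dw']].
  pose v x := if `[< A x >] then b (w x) else c (w' x).
  have vA x : A x -> v x = b (w x) by move=> ?; rewrite /v asboolT.
  have vB x : B x -> v x = c (w' x).
    move=> Bx; rewrite /v asboolF // => Ax.
    by have : (A `&` B) x by []; rewrite AB.
  exists v; split.
  + move=> x [Ax|Bx].
      apply: (@germ_eqon _ A (b \o w)) => //; first by case: oA.
        by move=> y Ay; rewrite vA.
      by apply: germ_comp; [exact: lw | apply: (lbc false); exact: Dw].
    apply: (@germ_eqon _ B (c \o w')) => //; first by case: oB.
      by move=> y Ay; rewrite vB.
    by apply: germ_comp; [exact: lw' | apply: (lbc true); exact: Dw'].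
  + move=> x y [Ax|Bx] [Ay|By]; [rewrite vA // (vA y)//|rewrite vA // vB//|rewrite vB // vA//|rewrite vB // (vB y)//] => e.
    * have [_] := ibc false false _ _ (Dw x Ax) (Dw y Ay) e; exact: iw.
    * by have [] := ibc false true _ _ (Dw x Ax) (Dw' y By) e.
    * by have [] := ibc true false _ _ (Dw' x Bx) (Dw y Ay) e.
    * have [_] := ibc true true _ _ (Dw' x Bx) (Dw' y By) e; exact: iw'.
  + by move=> x [Ax|Bx]; [rewrite vA //; apply/Db/Dw | rewrite vB //; apply/Dc/Dw'].
Qed.

Definition copy_seq (e : nat -> X -> X) := copies setT e.

(** The maps c^i b, for two disjoint self-embeddings b and c of the unit space,
    have disjoint images. *)
Lemma copy_seq_in (O : set X) : open O -> O !=set0 ->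
  exists e : nat -> X -> X, copy_seq e /\ forall i x, O (e i x).
Proof.
move=> oO O0; have [w [lw iw Ow]] := copy_in oO O0.
have [b [c [dbc _ _]]] := pi_split (@clopenT X).
have [_ lbc ibc] := dbc.
have ic : injective c by move=> x y /(ibc true true _ _ I I) [].
have lci i x : germ (iter i c) x.
  elim: i x => [|i IH] x; first exact: germ_id.
  exact: (germ_comp (IH x) (lbc true _ I)).
have ii i : injective (iter i c) by elim: i => // i IH x y /ic /IH.
exists (fun i x => w (iter i c (b x))); split => //; split; first exact: clopenT.
  move=> i x _; apply: (@germ_comp _ (iter i c \o b) w) => //.
  by apply: germ_comp => //; exact: (lbc false).
have lt i j x y : i < j -> iter i c (b x) <> iter j c (b y).
  move=> ij; rewrite -(subnKC ij) addSnnS iterD => /ii /= e.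
  by have [] := ibc false true _ _ I I e.
move=> i j x y _ _ /iw; case: (ltngtP i j) => [ij|ij|->].
- by move/lt => /(_ ij).
- by move/esym/lt => /(_ ij).
- by move=> /ii e; have [_] := ibc false false _ _ I I e.
Qed.

(** If the first of two disjoint copies of A inside A swallows B, the second
    one is disjoint from B. *)
Lemma two_rooms A B : clopen A -> clopen B -> A !=set0 -> B !=set0 ->
  exists C D, [/\ clopen C, clopen D, C !=set0, D !=set0 &
    [/\ C `<=` A, D `<=` B & C `&` D = set0]].
Proof.
move=> oA oB [x Ax] [y By].
have [b [c [dbc Ab Ac]]] := pi_split oA; have [_ lbc ibc] := dbc.
have ob : clopen (b @` A) by apply: germ_image_clopen => // z; exact: (lbc false).
have oc : clopen (c @` A) by apply: germ_image_clopen => // z; exact: (lbc true).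
have bA : b @` A `<=` A by move=> _ [z Az <-]; exact: Ab.
have cA : c @` A `<=` A by move=> _ [z Az <-]; exact: Ac.
have [[z [Bz nz]]|n] := pselect ((B `\` (b @` A)) !=set0).
  exists (b @` A), (B `\` (b @` A)); split => //.
  - by rewrite setDE; apply: clopenI => //; exact: clopenC.
  - by exists (b x), x.
  - by exists z.
  - by split => //; apply/seteqP; split => // t [? []].
exists (c @` A), B; split => //; first by exists (c x), x.
  by exists y.
split => //; apply/seteqP; split => // _ [[z Az <-] Bz].
have [t At tz] : (b @` A) (c z).
  by apply: contrapT => nb; apply: n; exists (c z).
by have [] := ibc false true _ _ At Az tz.
Qed.

(** Exchange the two families. *)
Lemma homogeneity_disjoint (I : finType) A (a b : I -> X -> X) :
  copies A a -> copies A b -> union_copies A a `&` union_copies A b = set0 ->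
  exists h, forall i x, A x -> ap h (a i x) = b i x.
Proof.
move=> [oA la ia] [_ lb ib] ab.
pose c (p : bool * I) := if p.1 then b p.2 else a p.2.
have ec : copies A c.
  have ne i j x y : A x -> A y -> a i x <> b j y.
    move=> Ax Ay e; have : (union_copies A a `&` union_copies A b) (a i x).
      by split; [exists i, x | exists j, y].
    by rewrite ab.
  split => // [[[] i] x Ax|[[] i] [[] j] x y Ax Ay]; rewrite /c /=.
  - exact: lb.
  - exact: la.
  - by move=> /(ib _ _ _ _ Ax Ay) [-> ->].
  - by move=> /esym /ne => /(_ Ay Ax).
  - by move=> /ne => /(_ Ax Ay).
  - by move=> /(ia _ _ _ _ Ax Ay) [-> ->].
have nK : involutive (fun p : bool * I => (~~ p.1, p.2)) by case=> [[] i].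
pose p := perm (inv_inj nK).
have [hc _] := permute_copiesP ec (@loc_const_cst _ _ A p).
exists (permute_copies A c (fun=> p)) => i x Ax.
by have := hc (false, i) x Ax; rewrite permE.
Qed.

(** Homogeneity: any two families of copies of A, neither of which fills the
    unit space, are conjugate in the full group. Exchange the first with copies
    in its complement, those with copies in the complement of the second, and
    the latter with the second. *)
Lemma homogeneity (I : finType) A (a b : I -> X -> X) :
  copies A a -> copies A b -> ~` union_copies A a !=set0 -> ~` union_copies A b !=set0 ->
  exists h, forall i x, A x -> ap h (a i x) = b i x.
Proof.
move=> ea eb na nb.
have oCa : clopen (~` union_copies A a) by apply: clopenC => //; exact: union_copies_clopen.
have oCb : clopen (~` union_copies A b) by apply: clopenC => //; exact: union_copies_clopen.
have [C [D [oC oD C0 D0 [Ca Db CD]]]] :=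
  two_rooms oCa oCb na nb.
have [oA _ _] := ea.
have room (O : set X) : clopen O -> O !=set0 -> exists c : I -> X -> X,
    copies A c /\ union_copies A c `<=` O.
  move=> oO O0; have [e [[_ le ie] Oe]] := copy_seq_in oO.1 O0.
  exists (fun i => e (enum_rank i)); split; last by move=> _ [i [x [_ <-]]].
  split => // [i x _|i j x y _ _ /(ie _ _ _ _ Logic.I Logic.I) [+ ->]]; first exact: le.
  by move/ord_inj/enum_rank_inj => ->.
have [c [ec cC]] := room C oC C0; have [d [ed dD]] := room D oD D0.
have [h1 h1P] : exists h, forall i x, A x -> ap h (a i x) = c i x.
  apply: homogeneity_disjoint => //; apply/seteqP; split => // x [ax /cC/Ca n]; exact: n.
have [h2 h2P] : exists h, forall i x, A x -> ap h (c i x) = d i x.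
  apply: homogeneity_disjoint => //; apply/seteqP; split => // x [/cC ? /dD ?].
  by have : (C `&` D) x by []; rewrite CD.
have [h3 h3P] : exists h, forall i x, A x -> ap h (d i x) = b i x.
  apply: homogeneity_disjoint => //; apply/seteqP; split => // x [/dD/Db n bx]; exact: n.
by exists (h3 * (h2 * h1)) => i x Ax; rewrite !apM h1P // h2P // h3P.
Qed.

End Room.

End Copies.

(** * Measure-preserving actions *)

Section MeasurePreservingActions.
Local Open Scope ring_scope.

(** Inverse images of the balls around a countable dense set. They separate
    points, which makes fixed-point sets measurable. *)
Lemma standard_borel_separating (R : realType) (d : measure_display)
    (Z : measurableType d) : standard_borel R Z ->
  exists B : nat -> nat -> set Z, (forall n m, measurable (B n m)) /\
    forall z w, (forall n m, B n m z <-> B n m w) -> z = w.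
Proof.
move=> [P [f [g [hP [D cD dD] fK gK mZ]]]].
have /countable_injP [c ic] := cD.
pose O n m : set P := \bigcup_(x in [set x | D x /\ c x = n]) (ball x m.+1%:R^-1)°.
exists (fun n m => f @^-1` (O n m)); split.
  move=> n m; apply/mZ.
  have -> : f @` (f @^-1` O n m) = O n m.
    apply/seteqP; split => [_ [z Oz <-] //|y Oy].
    by exists (g y) => //; rewrite /preimage/= gK.
  by apply: sub_gen_smallest; apply: bigcup_open => x _; exact: open_interior.
move=> z w zw; rewrite -(fK z) -(fK w); congr g.
apply: contrapT => /eqP fzw; move: hP; rewrite open_hausdorff.
move=> /(_ _ _ fzw) [[U V] /= [/set_mem Uz /set_mem Vw]] [oU oV /eqP UV].
have /nbhs_ballP [e /= e0 eU] : nbhs (f z) U by exact: open_nbhs_nbhs.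
(* Half of e, because x lies within a radius of f z and f w within a radius of x. *)
have [m me] : exists m : nat, m.+1%:R^-1 < e / 2.
  exists (Num.truncn (e / 2)^-1); rewrite invf_plt ?posrE ?divr_gt0//.
  exact: truncnS_gt.
have m0 : 0 < m.+1%:R^-1 :> R by rewrite invr_gt0.
have [] := dD (ball (f z) (m.+1%:R^-1 / 2))°.
- exists (f z); apply: nbhsx_ballx; exact: divr_gt0.
- exact: open_interior.
move=> x [/interior_subset zx Dx].
have xz : (ball x m.+1%:R^-1)° (f z).
  rewrite /interior; apply/nbhs_ballP; exists (m.+1%:R^-1 / 2); first exact: divr_gt0.
  by move=> y zy; apply: (@ball_split _ _ (f z)) => //; exact: ball_sym.
have /zw [x' [Dx' cx']] : (f @^-1` O (c x) m) z by exists x.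
move=> /interior_subset x'w.
have x'x : x' = x by apply: ic; rewrite ?inE.
have : (U `&` V) (f w); last by rewrite UV.
split => //; apply: eU.
rewrite x'x in x'w.
apply: (@ball_split _ _ x); last by apply: le_ball x'w; exact: ltW.
apply: le_ball zx; rewrite (le_trans _ (ltW me))// ler_pdivrMr//.
by rewrite ler_pMr // ler1n.
Qed.

Section MeasurePreserving.
Variables (K : groupType) (R : realType) (d : measure_display).
Variables (Z : measurableType d) (mu : probability Z R) (a : pmp_action K mu).

Definition fixset (g : K) : set Z := [set z | a g z = z].

Lemma fixset_measurable g : standard_borel R Z -> measurable (fixset g).
Proof.
move=> /standard_borel_separating [B [mB sB]].
have mgB n m : measurable (a g @^-1` B n m).
  by rewrite -[_ @^-1` _]setTI; exact: act_measurable.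
have -> : fixset g = \bigcap_n \bigcap_m
    ~` ((B n m `\` a g @^-1` B n m) `|` (a g @^-1` B n m `\` B n m)).
  apply/seteqP; split => [z zz n _ m _|z zz].
    by rewrite /preimage/= zz => -[[? ?]|[? ?]].
  apply: sB => n m; have := zz n I m I => h; split => hz.
    by apply: contrapT => nz; apply: h; right.
  by apply: contrapT => nz; apply: h; left.
apply: bigcapT_measurable => n; apply: bigcapT_measurable => m.
by apply: measurableC; apply: measurableU; exact: measurableD.
Qed.

Lemma act_preimage_measurable g A : measurable A -> measurable (a g @^-1` A).
Proof. by move=> mA; rewrite -[_ @^-1` _]setTI; exact: act_measurable. Qed.

Lemma actVK g z : a g^-1%g (a g z) = z.
Proof. by rewrite -actM mulVg act1. Qed.

Lemma actKV g z : a g (a g^-1%g z) = z.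
Proof. by rewrite -actM mulgV act1. Qed.

Lemma fixsetJ g h : fixset (h * g * h^-1)%g = a h^-1%g @^-1` fixset g.
Proof.
apply/seteqP; split => z; rewrite /fixset/= /preimage/=.
  by rewrite !actM => e; rewrite -[LHS](actVK h) e.
by rewrite !actM => ->; rewrite actKV.
Qed.

(** Pairwise almost disjoint sets have additive measures. *)
Lemma pairwise_null_bound (S : nat -> set Z) (c : R) n :
  (forall i, measurable (S i)) -> (forall i, mu (S i) = c%:E) ->
  (forall i j, (i < j)%N -> mu (S i `&` S j) = 0%E) -> n%:R * c <= 1.
Proof.
move=> mS muS nS; pose U m := \bigcup_(i in `I_m) S i.
have mU m : measurable (U m) by exact: bigcup_measurable.
suff muU m : mu (U m) = (m%:R * c)%:E.
  by rewrite -lee_fin -muU; exact: probability_le1.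
elim: m => [|m IH]; first by rewrite /U II0 bigcup_set0 measure0 mul0r.
have nU : mu (S m `&` U m) = 0%E.
  apply/negligibleP; first exact: measurableI.
  pose T i := if (i < m)%N then S i `&` S m else set0.
  have sT : S m `&` U m `<=` \bigcup_i T i.
    by move=> z [Smz [i /= im Siz]]; exists i => //; rewrite /T im.
  apply: (negligibleS sT); apply: negligible_bigcup => i; rewrite /T.
  case: ifPn => im; last exact: negligible_set0.
  by apply/negligibleP; [exact: measurableI | exact: nS].
have muSD : mu (S m `\` U m) = c%:E.
  have e : mu (S m) = (mu (S m `\` U m) + mu (S m `&` U m))%E by exact: measureDI.
  by rewrite nU adde0 muS in e.
have -> : U m.+1 = U m `|` (S m `\` U m).
  apply/seteqP; split => [z [i /= im Siz]|z [[i /= im Siz]|[Sz _]]].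
  - have [Uz|nUz] := pselect (U m z); [by left|right; split => //].
    move: im; rewrite ltnS leq_eqVlt => /orP[/eqP <- //|im].
    by case: nUz; exists i.
  - by exists i => //=; exact: ltnW.
  - by exists m => /=.
have e : mu (U m `|` (S m `\` U m)) = (mu (U m) + mu (S m `\` U m))%E.
  apply: measureU => //; first exact: measurableD.
  by apply/seteqP; split => // z [? []].
by rewrite e IH muSD -EFinD -[in RHS]natr1 mulrDl mul1r.
Qed.

(** Averaging over a finite group of transformations: outside a set of measure
    at most 1/p, a point of S returns to S under more than a proportion 1/p of
    the group. The number of returns is invariant under the group, so that the
    part of S where it is small has the same measure as its average share of
    the orbit. *)
Lemma many_returns (gT : finGroupType) (rho : gT -> K) (S : set Z) (p : nat) :
  (forall s t, rho (s * t)%g = (rho s * rho t)%g) -> measurable S -> (0 < p)%N ->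
  exists Q : set Z, [/\ measurable Q, (mu (S `\` Q) <= (p%:R^-1)%:E)%E &
    forall z, Q z -> (#|gT| < p * #|[pred s : gT | `[< S (a (rho s)^-1%g z) >] ]|)%N].
Proof.
move=> rhoM mS p0.
have rho1 : rho 1%g = 1%g by apply: (@mulgI _ (rho 1%g)); rewrite -rhoM !mulg1.
have rhoV s : rho s^-1%g = (rho s)^-1%g.
  by apply: (@mulgI _ (rho s)); rewrite -rhoM !mulgV.
pose E s := a (rho s)^-1%g @^-1` S.
have mE s : measurable (E s) by exact: act_preimage_measurable.
pose f z : R := \sum_(s : gT) \1_(E s) z.
have mf : measurable_fun setT f.
  by apply: measurable_sum => s; exact: measurable_indic.
have fE z : f z = #|[pred s : gT | `[< S (a (rho s)^-1%g z) >] ]|%:R.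
  rewrite /f -sum1_card natr_sum [RHS]big_mkcond /=; apply: eq_bigr => s _.
  rewrite indicE inE; have [h|h] := pselect (S (a (rho s)^-1%g z));
    [by rewrite asboolT // mem_set | by rewrite asboolF // memNset].
pose Q := [set z | #|gT|%:R / p%:R < f z].
have mQ : measurable Q.
  have := mf measurableT `]#|gT|%:R / p%:R, +oo[%classic (measurable_itv _).
  by rewrite setTI; congr measurable; apply/seteqP; split => z; rewrite /Q /= in_itv/= andbT.
have p0' : 0 < p%:R :> R by rewrite ltr0n.
have N0 : 0 < #|gT|%:R :> R by rewrite ltr0n; apply/card_gt0P; exists 1%g.
exists Q; split => //; last first.
  by move=> z; rewrite /Q /= fE ltr_pdivrMr // -natrM ltr_nat mulnC.
have fact s z : f (a (rho s)^-1%g z) = f z.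
  rewrite /f (reindex_inj (mulgI s^-1%g)) /=; apply: eq_bigr => t _.
  rewrite !indicE; congr (_%:R); congr nat_of_bool; apply/idP/idP; rewrite !inE /E /preimage/=;
    by rewrite rhoM rhoV invMg invgK actM actKV.
pose T s := E s `\` Q.
have mT s : measurable (T s) by exact: measurableD.
have muT s : mu (T s) = mu (S `\` Q).
  rewrite -[RHS](act_preserving a (rho s)^-1%g); last exact: measurableD.
  congr (mu _); apply/seteqP; split => z [Ez nQ]; split => //; move: nQ;
    by rewrite /Q /preimage /= fact.
have muSQ : mu (S `\` Q) \is a fin_num by rewrite fin_num_measure //; exact: measurableD.
have sumT : (\sum_(s : gT) mu (T s))%E = (#|gT|%:R * fine (mu (S `\` Q)))%:E.
  under eq_bigr do rewrite muT -(fineK muSQ).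
  by rewrite sumEFin sumr_const cardT -cardE mulr_natl.
suff : (\sum_(s : gT) mu (T s) <= (#|gT|%:R / p%:R)%:E)%E.
  rewrite sumT lee_fin ler_pM2l // => h.
  by rewrite -(fineK muSQ) lee_fin.
have -> : (\sum_(s : gT) mu (T s) = \int[mu]_z (\sum_(s : gT) (\1_(T s) z)%:E))%E.
  rewrite ge0_integral_sum //.
  - by apply: eq_bigr => s _; rewrite integral_indic // setIT.
  - by move=> s; apply/measurable_EFinP; exact: measurable_indic.
apply: (@le_trans _ _ (\int[mu]_z (cst (#|gT|%:R / p%:R)%:E z))%E).
  apply: ge0_le_integral => //.
  - by move=> z _; apply: sume_ge0.
  - by apply: emeasurable_sum => s; apply/measurable_EFinP; exact: measurable_indic.
  - move=> z _; rewrite sumEFin lee_fin.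
    have [Qz|nQz] := pselect (Q z).
      rewrite big1 ?divr_ge0 // => s _; rewrite indicE memNset // => -[_]; exact.
    rewrite leNgt; apply: contra_notN nQz => /lt_le_trans; apply.
    apply: ler_sum => s _; rewrite !indicE ler_nat.
    have [Ts|nTs] := pselect (T s z); last by rewrite memNset.
    by rewrite mem_set // mem_set //; case: Ts.
rewrite integral_cst // -[leRHS]mule1; apply: lee_wpmul2l.
  by rewrite lee_fin divr_ge0 // ltW.
by rewrite le_eqVlt; apply/orP; left; apply/eqP; exact: probability_setT.
Qed.

Lemma equal_measure_ae (A B : set Z) : measurable A -> measurable B -> B `<=` A ->
  mu A = mu B -> mu (A `+` B) = 0%E.
Proof.
move=> mA mB BA AB.
have -> : A `+` B = A `\` B.
  by rewrite /setY; apply/seteqP; split => z; [move=> [//|[/BA]] | left].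
have fB : mu B \is a fin_num by exact: fin_num_measure.
have fD : mu (A `\` B) \is a fin_num by apply: fin_num_measure; exact: measurableD.
have : mu A = (mu (A `\` B) + mu (A `&` B))%E by exact: measureDI.
rewrite (setIidr BA) AB -(fineK fB) -(fineK fD) -EFinD => -[e].
by congr _%:E; apply: (addIr (fine (mu B))); rewrite add0r -e.
Qed.

Lemma setY_null_trans (A B C : set Z) : measurable A -> measurable B -> measurable C ->
  mu (A `+` B) = 0%E -> mu (B `+` C) = 0%E -> mu (A `+` C) = 0%E.
Proof.
move=> mA mB mC AB BC.
have mY (D E : set Z) : measurable D -> measurable E -> measurable (D `+` E).
  by move=> ? ?; apply: measurableU; exact: measurableD.
apply/negligibleP; first exact: mY.
have sub : A `+` C `<=` (A `+` B) `|` (B `+` C).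
  move=> z; have [Bz|nBz] := pselect (B z); rewrite /setY /=; tauto.
apply: (negligibleS sub); apply: negligibleU; apply/negligibleP => //; exact: mY.
Qed.

End MeasurePreserving.

End MeasurePreservingActions.

(** * Nontrivial elements have null fixed-point sets *)

Section EssentialFreeness.
Local Open Scope group_scope.

Section Supports.
Variable G : etaleCantorGroupoid.
Local Notation X := (units G).
Local Notation F := (full_group G).
Implicit Types (f g h : F) (A B : set X) (x y : X).

Definition supp f A : Prop := forall y, ~ A y -> ap f y = y.

Lemma suppM f g A : supp f A -> supp g A -> supp (f * g) A.
Proof. by move=> fA gA y nA; rewrite apM gA // fA. Qed.

Lemma suppV f A : supp f A -> supp f^-1 A.
Proof. by move=> fA y nA; apply: (@ap_inj _ f); rewrite apKV fA. Qed.

Lemma supp_stable f A y : supp f A -> A y -> A (ap f y).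
Proof.
move=> fA Ay; apply: contrapT => nA.
by apply: (nA); have := fA _ nA; move/ap_inj => ->.
Qed.

Lemma supp_comm f g A B : supp f A -> supp g B -> A `&` B = set0 -> f * g = g * f.
Proof.
move=> fA gB AB; apply: ap_ext => y; rewrite !apM.
have nAB z : A z -> ~ B z by move=> Az Bz; have : (A `&` B) z by []; rewrite AB.
have [Ay|nAy] := pselect (A y).
  by rewrite !(gB _ (nAB _ _)) //; exact: supp_stable.
rewrite (fA y) //; have [By|nBy] := pselect (B y); last by rewrite gB // fA.
by rewrite fA // => /nAB; apply; exact: supp_stable.
Qed.

Section LevelPermutations.
Variables (I : finType) (e : I -> X -> X).
Hypothesis ee : copies setT e.

(** The inverse makes [levels] a homomorphism, since permutations are composed
    from left to right and elements of the full group from right to left. *)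
Definition levels (s : {perm I}) : F := permute_copies setT e (fun=> s^-1).

Lemma levelsM s t : levels (s * t) = levels s * levels t.
Proof. by rewrite /levels invMg permute_copiesM. Qed.

Lemma levels1 : levels 1 = 1.
Proof. by rewrite /levels invg1 permute_copies1. Qed.

Lemma levelsX s n : levels (s ^+ n) = levels s ^+ n.
Proof. by elim: n => [|n IH]; rewrite ?levels1 // !expgS levelsM IH. Qed.

Lemma levelsE s i x : ap (levels s) (e i x) = e (s^-1 i) x.
Proof. by have [+ _] := permute_copiesP ee (@loc_const_cst _ _ setT s^-1); exact. Qed.

Lemma levels_supp s : supp (levels s) (union_copies setT e).
Proof. by have [_ +] := permute_copiesP ee (@loc_const_cst _ _ setT s^-1); exact. Qed.

Lemma levels_inj (x : X) : injective levels.
Proof.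
move=> s t st; apply: invg_inj; apply/permP => i.
have := levelsE s i x; rewrite st levelsE.
by have [_ _ ie] := ee; move=> /(ie _ _ _ _ Logic.I Logic.I) [].
Qed.
End LevelPermutations.

(** The elements of the full group that permute a set E of copies of the unit
    space. Describing them by E rather than by an index set makes the group
    visibly monotone in E and equivariant under conjugation. *)
Definition sym_copies (E : set (X -> X)) : set F :=
  [set f | (forall e, E e -> exists2 e', E e' & forall x, ap f (e x) = e' x) /\
    supp f [set y | exists e x, E e /\ e x = y]].

Definition disjoint_maps (E : set (X -> X)) : Prop :=
  forall e e' x y, E e -> E e' -> e x = e' y -> e = e' /\ x = y.

Lemma sym_copies_mono (E E' : set (X -> X)) : disjoint_maps E' -> E `<=` E' -> sym_copies E `<=` sym_copies E'.
Proof.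
move=> dE' EE' f [fE fs]; split => [e E'e|y ny].
  have [Ee|nEe] := pselect (E e).
    by have [e' Ee' fe] := fE e Ee; exists e' => //; exact: EE'.
  exists e => // x; apply: fs => -[e' [x' [Ee' /esym e'e]]].
  by have [ee' _] := dE' _ _ _ _ E'e (EE' _ Ee') e'e; apply: nEe; rewrite ee'.
by apply: fs => -[e [x [/EE' Ee ex]]]; apply: ny; exists e, x.
Qed.

Lemma sym_copiesJ (E : set (X -> X)) f h : sym_copies E f ->
  sym_copies [set ap h \o e | e in E] (h * f * h^-1).
Proof.
move=> [fE fs]; split => [_ [e Ee <-]|y ny].
  have [e' Ee' fe] := fE e Ee; exists (ap h \o e'); first by exists e'.
  by move=> x /=; rewrite !apM apVK fe.
rewrite !apM fs ?apKV // => -[e [x [Ee ex]]]; apply: ny.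
by exists (ap h \o e), x; split; [exists e | rewrite /= ex apKV].
Qed.

Lemma sym_copies_levelsP (I : finType) (e : I -> X -> X) f : copies setT e ->
  sym_copies (range e) f <-> exists s, f = levels e s.
Proof.
move=> ee; have [_ _ ie] := ee; split=> [[fE fs]|[s ->]]; last first.
  split=> [_ [i _ <-]|y ny].
    by exists (e (s^-1 i)); [exists (s^-1 i) | move=> x; rewrite levelsE].
  apply: levels_supp => // -[i [x [_ ix]]]; apply: ny.
  by exists (e i), x; split => //; exists i.
have [x0 _] := units_nonempty G.
have sg i : exists j, forall x, ap f (e i x) = e j x.
  by have [|_ [j _ <-] fe] := fE (e i); [exists i | exists j].
pose s i := projT1 (cid (sg i)).
have sE i x : ap f (e i x) = e (s i) x by rewrite /s; case: cid.
have sI : injective s.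
  move=> i j ij; have : ap f (e i x0) = ap f (e j x0) by rewrite !sE ij.
  by move=> /ap_inj /(ie _ _ _ _ Logic.I Logic.I) [].
exists (perm sI)^-1; apply: ap_ext => y.
have [[i [x [_ <-]]]|ny] := pselect (union_copies setT e y).
  by rewrite sE levelsE // invgK permE.
rewrite (levels_supp ee) // fs // => -[_ [x [[i _ <-] ix]]]; apply: ny.
by exists i, x.
Qed.

Definition initial (e : nat -> X -> X) n : set (X -> X) := range (fun i : 'I_n => e i).

Lemma initial_copies (e : nat -> X -> X) n : copy_seq e -> @copies G 'I_n setT (fun i => e i).
Proof.
move=> [oT le ie]; split => // [i x|i j x y tx ty]; first exact: le.
by move=> /(ie _ _ _ _ tx ty) [/ord_inj -> ->].
Qed.

Lemma range_disjoint_maps (I : Type) (e : I -> X -> X) : copies setT e -> disjoint_maps (range e).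
Proof.
move=> [_ _ ie] _ _ x y [i _ <-] [j _ <-].
by move=> /(ie _ _ _ _ Logic.I Logic.I) [-> ->].
Qed.

Lemma copy_seq_comp (e : nat -> X -> X) h : copy_seq e -> copy_seq (fun i => ap h \o e i).
Proof.
move=> [oT le ie]; split => // [i x tx|i j x y tx ty].
  by apply: germ_comp; [exact: le | exact: ap_germ].
by move=> /= /ap_inj /(ie _ _ _ _ tx ty).
Qed.

Lemma initial_comp e h n : initial (fun i => ap h \o e i) n = [set ap h \o c | c in initial e n].
Proof.
apply/seteqP; split => [_ [i _ <-]|_ [_ [i _ <-] <-]]; last by exists i.
by exists (e i) => //; exists i.
Qed.

End Supports.
Section Freeness.
Variable G : etaleCantorGroupoid.
Hypothesis hpi : purely_infinite G.
Hypothesis hmin : minimal G.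
Local Notation X := (units G).
Local Notation F := (full_group G).
Variables (R : realType) (d : measure_display) (Z : measurableType d).
Variables (mu : probability Z R) (a : pmp_action F mu).
Hypothesis sb : standard_borel R Z.
Implicit Types (f g h : F) (A B : set X) (x y : X) (e b : nat -> X -> X).

(** Commutators, because it is in them that the corrections of the double
    commutator trick cancel. *)
Definition commutator_fix (p : nat) (E : set (X -> X)) : set Z :=
  [set z | forall f g, sym_copies E f -> sym_copies E g -> f ^+ p = 1 -> g ^+ p = 1 ->
    a (f * g * f^-1 * g^-1) z = z].

Lemma commutator_fix_mono p (E E' : set (X -> X)) : disjoint_maps E' -> E `<=` E' ->
  commutator_fix p E' `<=` commutator_fix p E.
Proof.
by move=> dE' EE' z zE f g fE gE; apply: zE; exact: sym_copies_mono fE || exact: sym_copies_mono gE.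
Qed.

Lemma conjX f h n : (h * f * h^-1) ^+ n = h * f ^+ n * h^-1.
Proof.
elim: n => [|n IH]; first by rewrite !expg0 mulg1 mulgV.
by rewrite !expgS IH !mulgA mulgVK.
Qed.

(** Conjugating the copies by h translates the common fixed points by h. *)
Lemma commutator_fixJ p (E : set (X -> X)) h :
  commutator_fix p [set ap h \o e | e in E] = a h^-1 @^-1` commutator_fix p E.
Proof.
have sub k (E' : set (X -> X)) : commutator_fix p [set ap k \o e | e in E'] `<=` a k^-1 @^-1` commutator_fix p E'.
  move=> z zE f g fE gE fp gp.
  have := zE _ _ (sym_copiesJ k fE) (sym_copiesJ k gE); rewrite !conjX fp gp !mulg1 mulgV => /(_ erefl erefl).
  rewrite !invMg invgK !mulgA !mulgVK !Defs.actM => e.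
  by rewrite -[RHS](congr1 (a k^-1) e) actVK.
apply/seteqP; split; first exact: sub.
have EE : E = [set ap h^-1 \o e | e in [set ap h \o e | e in E]].
  apply/seteqP; split => [e Ee|_ [_ [e Ee <-] <-]].
    exists (ap h \o e); first by exists e.
    by apply/funext => x /=; rewrite apVK.
  by have -> : ap h^-1 \o (ap h \o e) = e by apply/funext => x /=; rewrite apVK.
move=> z; rewrite /preimage/= {1}EE => /sub.
by rewrite /preimage/= invgK actKV.
Qed.

Lemma commutator_fix_measurable p e n : copy_seq e -> measurable (commutator_fix p (initial e n)).
Proof.
move=> ee; pose E := initial e n; have en := initial_copies n ee.
pose C := [set c | exists f g, [/\ sym_copies E f, sym_copies E g, f ^+ p = 1, g ^+ p = 1 &
  c = f * g * f^-1 * g^-1]].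
have -> : commutator_fix p E = \bigcap_(c in C) fixset a c.
  apply/seteqP; split => [z zE _ [f [g [fE gE fp gp ->]]]|z zC f g fE gE fp gp].
    exact: zE.
  by apply: zC; exists f, g.
apply: fin_bigcap_measurable => [|c _]; last exact: fixset_measurable.
apply: (@sub_finite_set _ _ [set levels (fun i : 'I_n => e i) st.1 *
  levels (fun i : 'I_n => e i) st.2 * (levels (fun i : 'I_n => e i) st.1)^-1 *
  (levels (fun i : 'I_n => e i) st.2)^-1 | st in [set: {perm 'I_n} * {perm 'I_n}]]).
  move=> _ [f [g [/(sym_copies_levelsP _ en)[s ->] /(sym_copies_levelsP _ en)[t ->] _ _ ->]]].
  by exists (s, t).
apply: finite_image; exact: finite_finset.
Qed.

(** Initial segments of the same length of two sequences of copies are conjugate: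
    the remaining copies are the room that homogeneity asks for. *)
Lemma commutator_fix_measure p e b n : copy_seq e -> copy_seq b ->
  mu (commutator_fix p (initial e n)) = mu (commutator_fix p (initial b n)).
Proof.
move=> ee eb.
have miss (c : nat -> X -> X) : copy_seq c -> ~` union_copies setT (fun i : 'I_n => c i) !=set0.
  move=> [_ _ ic]; have [x0 _] := units_nonempty G.
  exists (c n x0) => -[i [x [_ /(ic _ _ _ _ I I)[ni _]]]].
  by have := ltn_ord i; rewrite ni ltnn.
have [h hP] := homogeneity hpi hmin (initial_copies n ee) (initial_copies n eb) (miss _ ee) (miss _ eb).
have -> : initial b n = [set ap h \o c | c in initial e n].
  apply/seteqP; split => [_ [i _ <-]|_ [_ [i _ <-] <-]].
    by exists (e i); [exists i | apply/funext => x; exact: hP].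
  by exists i => //; apply/funext => x; rewrite -hP.
rewrite commutator_fixJ act_preserving //; exact: commutator_fix_measurable.
Qed.

Definition common_fix p e : set Z := \bigcap_n commutator_fix p (initial e n).

Lemma common_fix_measurable p e : copy_seq e -> measurable (common_fix p e).
Proof. by move=> ee; apply: bigcapT_measurable => n; exact: commutator_fix_measurable. Qed.

Lemma common_fix_cvg p e : copy_seq e ->
  mu (commutator_fix p (initial e n)) @[n --> \oo] --> mu (common_fix p e).
Proof.
move=> ee; apply: nonincreasing_cvg_mu.
- by rewrite ltey_eq fin_num_measure //; exact: commutator_fix_measurable.
- by move=> n; exact: commutator_fix_measurable.
- exact: common_fix_measurable.
- move=> m n mn; apply/subsetPset; apply: commutator_fix_mono.
    exact: range_disjoint_maps (initial_copies n ee).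
  by move=> _ [i _ <-]; exists (widen_ord mn i).
Qed.

(** A larger set of copies has fewer common fixed points, but both sets are
    decreasing limits of sets with the same measures. *)
Lemma common_fix_sub p e b : copy_seq e -> copy_seq b -> range e `<=` range b ->
  mu (common_fix p e `+` common_fix p b) = 0%E.
Proof.
move=> ee eb eb_; apply: equal_measure_ae; [exact: common_fix_measurable..| |].
  move=> z zb n _.
  have /choice [k kP] : forall i, exists j, b j = e i.
    by move=> i; have [|j _ bj] := eb_ (e i); [exists i | exists j].
  pose m := (\max_(i < n) k i).+1.
  apply: (commutator_fix_mono (range_disjoint_maps (initial_copies m eb))) (zb m I).
  move=> _ [i _ <-].
  have kim : (k i < m)%N by rewrite ltnS (leq_bigmax (F := fun i : 'I_n => k i)).
  by exists (Ordinal kim) => //=.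
have ce := common_fix_cvg (p := p) ee; have cb := common_fix_cvg (p := p) eb.
have eqf : (fun n => mu (commutator_fix p (initial e n))) = (fun n => mu (commutator_fix p (initial b n))).
  by apply/funext => n; exact: commutator_fix_measure.
rewrite eqf in ce; exact: (cvg_unique (@ereal_hausdorff R) ce cb).
Qed.

(** Compare both sequences with their interleaving. *)
Lemma common_fix_disjoint p e b A B : copy_seq e -> copy_seq b -> A `&` B = set0 ->
  (forall i x, A (e i x)) -> (forall i x, B (b i x)) ->
  mu (common_fix p e `+` common_fix p b) = 0%E.
Proof.
move=> ee eb AB eA bB.
pose c k := if odd k then b k./2 else e k./2.
have ce i : c i.*2 = e i by rewrite /c odd_double doubleK.
have cb i : c i.*2.+1 = b i by rewrite /c /= odd_double /= uphalf_double.
have nAB x y : A x -> B y -> x <> y.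
  by move=> Ax By xy; have : (A `&` B) x; [split; rewrite // xy | rewrite AB].
have ec : copy_seq c.
  have [_ le ie] := ee; have [_ lb ib] := eb.
  split; [exact: clopenT | |].
    by move=> i x _; rewrite /c; case: ifP => _; [exact: lb | exact: le].
  move=> i j x y _ _; rewrite /c.
  have oi := odd_double_half i; have oj := odd_double_half j.
  case: (odd i) oi => oi; case: (odd j) oj => oj.
  - by move=> /(ib _ _ _ _ I I) [ij ->]; split => //; rewrite -oi -oj ij.
  - by move=> /esym/nAB h; case: h.
  - by move=> /nAB h; case: h.
  - by move=> /(ie _ _ _ _ I I) [ij ->]; split => //; rewrite -oi -oj ij.
have mc := common_fix_measurable p ec.
apply: (setY_null_trans (B := common_fix p c)) => //; try exact: common_fix_measurable.
  by apply: common_fix_sub => // _ [i _ <-]; exists i.*2.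
rewrite setYC; apply: common_fix_sub => // _ [i _ <-]; exists i.*2.+1 => //.
Qed.

(** Two families of copies that both leave some room have the same common fixed
    points, through copies in the room of the one and of the other. *)
Lemma common_fix_invariant p e A h : copy_seq e -> clopen A -> A !=set0 ->
  (forall i x, ~ A (e i x)) -> mu ((a h @^-1` common_fix p e) `+` common_fix p e) = 0%E.
Proof.
move=> ee oA A0 eA.
have -> : a h @^-1` common_fix p e = common_fix p (fun i => ap h^-1 \o e i).
  rewrite /common_fix preimage_bigcap; apply: eq_bigcapr => n _.
  by rewrite initial_comp commutator_fixJ invgK.
have ehe := copy_seq_comp h^-1 ee.
set he := (fun i => _) in ehe *.
have oB := ap_clopen h^-1 oA.
have B0 : ap h^-1 @` A !=set0 by have [x Ax] := A0; exists (ap h^-1 x), x.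
have [C [D [oC oD C0 D0 [CA DB CD]]]] := two_rooms hpi oA oB A0 B0.
have [b [eb bC]] := copy_seq_in hpi hmin oC.1 C0.
have [c [ec cD]] := copy_seq_in hpi hmin oD.1 D0.
have [me mhe mb mc] : [/\ measurable (common_fix p e), measurable (common_fix p he),
  measurable (common_fix p b) & measurable (common_fix p c)] by split; exact: common_fix_measurable.
rewrite setYC; apply: (setY_null_trans (B := common_fix p b)) => //.
  apply: (@common_fix_disjoint p e b (~` A) A) => //; first exact: setICl.
  by move=> i x; exact: CA.
apply: (setY_null_trans (B := common_fix p c)) => //; first exact: (@common_fix_disjoint p b c C D).
apply: (@common_fix_disjoint p c he (ap h^-1 @` A) (~` (ap h^-1 @` A))) => //.
- exact: setICr.
- by move=> i x; exact: DB.
- by move=> i x [y Ay] /ap_inj ye; apply: (eA i x); rewrite -ye.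
Qed.
End Freeness.
Lemma noncommuting_order (p : nat) : prime p -> (2 < p)%N ->
  exists s t : {perm option 'I_p}, [/\ s ^+ p = 1, t ^+ p = 1 & s * t <> t * s].
Proof.
case: p => // p pp p2.
pose c (o : option 'I_p.+1) := omap (@ordS p.+1) o.
have cI : injective c.
  by case=> [i|] [j|] // /Some_inj /(can_inj (@ordSK p.+1)) ->.
(* A p-cycle that fixes one point, and its conjugate by the transposition that
   exchanges this point with a point of the cycle. *)
pose s := perm cI; pose i0 : 'I_p.+1 := ord0.
pose r := tperm None (Some i0).
have iterv n (i : 'I_p.+1) : val (iter n (@ordS p.+1) i) = ((i + n) %% p.+1)%N.
  elim: n => [|n IH]; first by rewrite addn0 modn_small.
  by rewrite iterS /= IH -addn1 modnDml addn1 addnS.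
have sX n : s ^+ n = 1 <-> forall i, iter n (@ordS p.+1) i = i.
  have sn (o : option 'I_p.+1) : (s ^+ n) o = omap (iter n (@ordS p.+1)) o.
    rewrite permX; elim: n => [|n IH]; first by case: o.
    by rewrite iterS IH permE; case: (o).
  split => [s1 i|h]; first by have := sn (Some i); rewrite s1 perm1 => -[].
  by apply/permP => -[i|]; rewrite sn perm1 //= h.
have sp : s ^+ p.+1 = 1.
  by apply/sX => i; apply: val_inj; rewrite iterv modnDr modn_small.
exists s, (s ^ r); split => //; first by rewrite -conjXg sp conj1g.
have s1 : s None = None by rewrite permE.
have s2 (i : 'I_p.+1) : s (Some i) = Some (ordS i) by rewrite permE.
have tN : (s ^ r) None = Some (ordS i0).
  have -> : None = r (Some i0) by rewrite tpermR.
  rewrite permJ s2 tpermD //; apply/eqP => /Some_inj/(congr1 val) /=.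
  by rewrite modn_small // ltnW.
move: (s ^ r) tN => t tN /permP/(_ None); rewrite !permM s1 tN s2 => /Some_inj/(congr1 val) /=.
by rewrite (modn_small (ltnW p2)) (modn_small p2).
Qed.

Section Freeness.
Variable G : etaleCantorGroupoid.
Local Notation X := (units G).
Local Notation F := (full_group G).
Variables (R : realType) (d : measure_display) (Z : measurableType d).
Variables (mu : probability Z R) (a : pmp_action F mu).
Implicit Types (f g h : F) (A B : set X) (x y : X) (e b : nat -> X -> X).

Lemma fixM f g z : a f z = z -> a g z = z -> a (f * g) z = z.
Proof. by rewrite Defs.actM => fz ->. Qed.

Lemma fixV f z : a f z = z -> a f^-1 z = z.
Proof. by move=> fz; rewrite -{1}fz actVK. Qed.

Lemma commutator_cancel f g h k : h * g = g * h -> h * f = f * h -> k * f = f * k ->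
  k * g = g * k -> h * k = k * h ->
  (f * h) * (g * k) * (f * h)^-1 * (g * k)^-1 = f * g * f^-1 * g^-1.
Proof.
move=> hg hf kf kg hk.
have -> : (f * h) * (g * k) = f * g * (h * k) by rewrite !mulgA -(mulgA f h) hg !mulgA.
rewrite -mulgA -invMg.
have -> : (g * k) * (f * h) = g * f * (h * k) by rewrite -!mulgA (mulgA k) kf -!mulgA hk.
by rewrite invMg mulgA -(mulgA (f * g)) mulgV mulg1 invMg mulgA.
Qed.

(** The double commutator trick, made quantitative. If g1 and g2 move A into
    disjoint sets B1 and B2 away from A and fix z, then every return of z to the
    common fixed points of g1 and g2 under a permutation s of levels inside A
    makes s, corrected by some element supported in B1 (or in B2), fix z. The
    permutations that can be corrected form a subgroup; with many returns it
    contains all elements of order p, and in a commutator of two of them the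
    corrections disappear. *)
Lemma returns_commutator_fix (I : finType) (c : I -> X -> X) A B1 B2 (g1 g2 : F) (p : nat) z :
  copies setT c -> (forall i x, A (c i x)) -> prime p ->
  A `&` B1 = set0 -> A `&` B2 = set0 -> B1 `&` B2 = set0 ->
  (forall x, A x -> B1 (ap g1 x)) -> (forall x, A x -> B2 (ap g2 x)) ->
  a g1 z = z -> a g2 z = z ->
  (#|{perm I}| < p * #|[pred s : {perm I} |
     `[< (fixset a g1 `&` fixset a g2) (a (levels c s)^-1 z) >] ]|)%N ->
  commutator_fix a p (range c) z.
Proof.
move=> ec cA pp AB1 AB2 B12 g1A g2A g1z g2z many.
have lA s : supp (levels c s) A.
  move=> y ny; apply: levels_supp => // -[i [x [_ xy]]]; apply: ny.
  by rewrite -xy.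
have key B (g : F) : A `&` B = set0 -> (forall x, A x -> B (ap g x)) -> a g z = z ->
    (forall s, (fixset a g1 `&` fixset a g2) (a (levels c s)^-1 z) ->
       fixset a g (a (levels c s)^-1 z)) ->
    forall s, s ^+ p = 1 -> exists2 h, supp h B & a (levels c s * h) z = z.
  move=> AB gA gz ret.
  pose M := finset (fun s : {perm I} => `[< exists2 h, supp h B & a (levels c s * h) z = z >]).
  have gM : group_set M.
    apply/group_setP; split.
      rewrite finset.inE; apply/asboolP; exists 1; first by move=> y _.
      by rewrite mulg1 levels1 // Defs.act1.
    move=> s t; rewrite !finset.inE => /asboolP[h hB sh] /asboolP[k kB tk].
    apply/asboolP; exists (h * k); first exact: suppM.
    have comm : levels c t * h = h * levels c t by exact: (supp_comm (lA t) hB).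
    have -> : levels c (s * t) * (h * k) = (levels c s * h) * (levels c t * k).
      by rewrite levelsM // -!mulgA; congr (_ * _); rewrite !mulgA comm.
    exact: fixM.
  pose Q := finset (fun s : {perm I} => `[< (fixset a g1 `&` fixset a g2) (a (levels c s)^-1 z) >]).
  have QM : Q \subset Group gM.
    apply/fintype.subsetP => s; rewrite !finset.inE => /asboolP/ret gs.
    apply/asboolP; exists (g * (levels c s)^-1 * g^-1).
      move=> y ny; rewrite !apM (suppV (lA s)) ?apKV // => Ay; apply: ny.
      by rewrite -(apKV g y); exact: gA.
    rewrite !mulgA; apply: fixM; last exact: fixV.
    by rewrite !Defs.actM gs actKV.
  have cQ : (#|{perm I}| < p * #|Q|)%N by rewrite cardsE.
  move=> s sp; have := large_subset_contains pp QM cQ sp.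
  by rewrite finset.inE => /asboolP.
move=> f g /(sym_copies_levelsP _ ec)[s ->] /(sym_copies_levelsP _ ec)[t ->].
have [x0 _] := units_nonempty G.
rewrite -!levelsX // -(levels1 ec) => /(levels_inj ec x0) sp /(levels_inj ec x0) tp.
have [h hB sh] := key B1 g1 AB1 g1A g1z (fun s r => r.1) s sp.
have [k kB tk] := key B2 g2 AB2 g2A g2z (fun s r => r.2) t tp.
have comm u (w : F) B : A `&` B = set0 -> supp w B -> w * levels c u = levels c u * w.
  by move=> AB wB; rewrite (supp_comm (lA u) wB).
rewrite -(@commutator_cancel _ _ h k); [|exact: comm AB1 hB|exact: comm AB1 hB|exact: comm AB2 kB|exact: comm AB2 kB|exact: supp_comm hB kB B12].
by apply: fixM; [apply: fixM; [exact: fixM | exact: fixV] | exact: fixV].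
Qed.

End Freeness.
Section Freeness.
Variable G : etaleCantorGroupoid.
Hypothesis hpi : purely_infinite G.
Hypothesis hmin : minimal G.
Local Notation X := (units G).
Local Notation F := (full_group G).

(** Two disjoint copies of a set that g moves off itself, inside this set. *)
Lemma moved_clopen (g : F) : g <> 1 -> exists A B : set X,
  [/\ clopen A, clopen B, A !=set0, B !=set0 &
   [/\ A `&` B = set0, A `&` (ap g @` A) = set0 & B `&` (ap g @` A) = set0]].
Proof.
move=> /moved_off [V [oV [x Vx] gV]].
have [b [c [dbc Vb Vc]]] := pi_split hpi oV; have [_ lbc ibc] := dbc.
exists (b @` V), (c @` V); split.
- by apply: germ_image_clopen => // y; exact: (lbc false).
- by apply: germ_image_clopen => // y; exact: (lbc true).
- by exists (b x), x.
- by exists (c x), x.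
- split; apply/seteqP; split => // _ [[y Vy <-]].
  + by move=> [z Vz zy]; have [] := ibc true false _ _ Vz Vy zy.
  + by move=> [_ [z Vz <-] zy]; apply: (gV (b y) (b z)); rewrite ?zy //; exact: Vb.
  + by move=> [_ [z Vz <-] zy]; apply: (gV (c y) (b z)); rewrite ?zy //; [exact: Vc | exact: Vb].
Qed.

Variables (R : realType) (d : measure_display) (Z : measurableType d).
Variables (mu : probability Z R) (a : pmp_action F mu).
Hypothesis sb : standard_borel R Z.
Implicit Types (f g h : F) (A B : set X) (x y : X) (e b : nat -> X -> X).

(** Infinitely many sets of the same positive measure cannot be almost disjoint. *)
Lemma fixset_meet g (k : nat -> F) : mu (fixset a g) <> 0%E ->
  exists i j, [/\ (i < j)%N &
    mu (fixset a (k i * g * (k i)^-1) `&` fixset a (k j * g * (k j)^-1)) <> 0%E].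
Proof.
move=> g0; have mg f := fixset_measurable a f sb.
apply: contrapT => n; pose c := fine (mu (fixset a g)).
have cE : mu (fixset a g) = c%:E by rewrite fineK // fin_num_measure.
have c0 : (0 < c)%R.
  rewrite lt_neqAle fine_ge0 // andbT eq_sym; apply/eqP => c0.
  by apply: g0; rewrite cE c0.
have muk i : mu (fixset a (k i * g * (k i)^-1)) = c%:E.
  by rewrite fixsetJ act_preserving.
have null i j : (i < j)%N ->
    mu (fixset a (k i * g * (k i)^-1) `&` fixset a (k j * g * (k j)^-1)) = 0%E.
  by move=> ij; apply: contrapT => nz; apply: n; exists i, j.
have := pairwise_null_bound (Num.truncn c^-1).+1 (fun i => mg _) muk null.
by rewrite leNgt -ltr_pdivrMr // div1r truncnS_gt.
Qed.

(** Two conjugates of g that move A into disjoint sets have common fixed points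
    on a set of positive measure. The double commutator trick applies to them,
    and its bound does not depend on the number of copies placed inside A. *)
Lemma positive_common_fix g : g <> 1 -> mu (fixset a g) <> 0%E ->
  exists p e A, [/\ prime p, (2 < p)%N, copy_seq e, clopen A & A !=set0 /\
    (forall i x, ~ A (e i x)) /\ mu (common_fix a p e) <> 0%E].
Proof.
move=> g1 g0; have mg f := fixset_measurable a f sb.
have [A [B [oA oB A0 B0 [AB AgA BgA]]]] := moved_clopen g1.
have [z [ez zB]] := copy_seq_in hpi hmin oB.1 B0; have [_ lz iz] := ez.
have [e [ee eA]] := copy_seq_in hpi hmin oA.1 A0.
have ogA := ap_clopen g oA.
have dz i : @disjoint_copies G (ap g @` A) id (z i).
  apply: disjoint_copiesP => //.
  - by move=> x _; exact: germ_id.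
  - by move=> x _; exact: lz.
  - by move=> x y _ _ /(iz _ _ _ _ I I) [].
  - move=> x y gx _ xz; have : (B `&` (ap g @` A)) x by split => //; rewrite xz.
    by rewrite BgA.
(* The element k i pushes g(A) onto the copy z_i(g(A)) inside B and is trivial on
   A, so that its conjugate of g moves A into the range of z_i. *)
pose k i := swap (ap g @` A) id (z i); pose gk i := k i * g * (k i)^-1.
have kA i x : A x -> ap (k i) x = x.
  move=> Ax; have [_ _ kn] := swapP (dz i); apply: kn.
    by move=> [y gy yx]; have : (A `&` (ap g @` A)) x; [split; rewrite // -yx | rewrite AgA].
  by move=> [y _ zx]; have : (A `&` B) x; [split; rewrite // -zx | rewrite AB].
have kVA i x : A x -> ap (k i)^-1 x = x.
  by move=> Ax; apply: (@ap_inj _ (k i)); rewrite apKV kA.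
have gkA i x : A x -> (range (z i)) (ap (gk i) x).
  move=> Ax; rewrite /gk !apM kVA //; have [zk _ _] := swapP (dz i).
  by rewrite zk; [exists (ap g x) | exists x].
have [i [j [ij Sij]]] := fixset_meet k g0.
pose S := fixset a (gk i) `&` fixset a (gk j).
have mS : measurable S by exact: measurableI.
pose c := fine (mu S).
have cE : mu S = c%:E by rewrite fineK // fin_num_measure.
have c0 : (0 < c)%R.
  rewrite lt_neqAle fine_ge0 // andbT eq_sym; apply/eqP => c0.
  by apply: Sij; rewrite -[LHS]/(mu S) cE c0.
(* With 1/p < c, discarding a set of measure 1/p from S leaves a positive
   measure. *)
have [p pm pp] := prime_above (maxn 2 (Num.truncn c^-1)).
have p2 : (2 < p)%N by apply: leq_ltn_trans pm; exact: leq_maxl.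
have p0 : (0 < p)%N by exact: prime_gt0.
have pc : (p%:R^-1 < c)%R.
  rewrite invf_plt ?posrE ?ltr0n //; apply: lt_le_trans (truncnS_gt _) _.
  by rewrite ler_nat; apply: leq_ltn_trans pm; exact: leq_maxr.
exists p, e, B; split => //; split => //; split.
  by move=> l x Bx; have : (A `&` B) (e l x) by []; rewrite AB.
have low n : ((c - p%:R^-1)%:E <= mu (commutator_fix a p (initial e n)))%E.
  have en := initial_copies n ee.
  have [Q [mQ SQ Qmany]] := many_returns a (rho := levels (fun l : 'I_n => e l))
    (levelsM en) mS p0.
  have sub : S `&` Q `<=` commutator_fix a p (initial e n).
    move=> w [[wi wj] Qw].
    apply: (@returns_commutator_fix _ _ _ _ _ _ _ _ A (range (z i)) (range (z j)) (gk i) (gk j)) => //.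
    - apply/seteqP; split => // x [Ax [y _ zy]].
      by have : (A `&` B) x; [split; rewrite // -zy | rewrite AB].
    - apply/seteqP; split => // x [Ax [y _ zy]].
      by have : (A `&` B) x; [split; rewrite // -zy | rewrite AB].
    - apply/seteqP; split => // x [[y _ <-] [y' _ /(iz _ _ _ _ I I) [ji _]]].
      by move: ij; rewrite ji ltnn.
    - exact: gkA.
    - exact: gkA.
    - exact: Qmany.
  have : mu S = (mu (S `\` Q) + mu (S `&` Q))%E by exact: measureDI.
  have : (mu (S `&` Q) <= mu (commutator_fix a p (initial e n)))%E.
    apply: le_measure => //; rewrite inE; [exact: measurableI | exact: commutator_fix_measurable].
  move=> le1 SE; rewrite EFinB -cE leeBlDr // SE addeC.
  by apply: leeD.
move=> mu0; have cv := @common_fix_cvg _ _ _ _ mu a sb p e ee; rewrite mu0 in cv.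
have : ((c - p%:R^-1)%:E <= 0)%E.
  rewrite -(cvg_lim (@ereal_hausdorff R) cv); apply: lime_ge.
    by apply/cvg_ex; eexists; exact: cv.
  by apply: nearW => n; exact: low.
by rewrite lee_fin subr_le0 leNgt pc.
Qed.

(** The points fixed by all the commutators form an invariant set of positive
    measure, hence a conull set, although some of these commutators are not
    trivial. *)
Theorem faithful_ergodic_free : faithful_action a -> ergodic_action a ->
  essentially_free_action a.
Proof.
move=> fa er g g1; apply: contrapT => g0.
have [p [e [A [pp p2 ee oA [A0 [eA Y0]]]]]] := positive_common_fix g1 g0.
have mY := @common_fix_measurable _ _ _ _ mu a sb p e ee.
have [//|Y1] : mu (common_fix a p e) = 0%E \/ mu (common_fix a p e) = 1%E.
  by apply: er => // h; exact: (@common_fix_invariant _ hpi hmin _ _ _ mu a sb p e A h ee oA A0 eA).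
have [s [t [sp tp st]]] := noncommuting_order pp p2.
pose c (o : option 'I_p) := e (if o is Some i then val i else p).
have ec : @copies G _ setT c.
  have [oT le ie] := ee; split => // [u x _|u v x y _ _ /(ie _ _ _ _ I I)]; first exact: le.
  case: u v => [i|] [j|] [] //.
  - by move=> /val_inj -> ->.
  - by move=> ip; have := ltn_ord i; rewrite ip ltnn.
  - by move=> ip; have := ltn_ord j; rewrite -ip ltnn.
have sub : range c `<=` initial e p.+1.
  move=> _ [[i|] _ <-]; first by exists (widen_ord (leqnSn p) i).
  by exists ord_max.
have symc u : sym_copies (initial e p.+1) (levels c u).
  apply: (sym_copies_mono (range_disjoint_maps (initial_copies p.+1 ee)) sub).
  by apply/sym_copies_levelsP => //; exists u.
pose k := levels c s * levels c t * (levels c s)^-1 * (levels c t)^-1.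
have [x0 _] := units_nonempty G.
apply: (fa k).
  move=> k1; apply: st; apply: (levels_inj ec x0); rewrite !levelsM //.
  have e1 : levels c s * levels c t * (levels c s)^-1 = levels c t.
    by rewrite -[LHS](mulgVK (levels c t)) -/k k1 mul1g.
  by rewrite -[RHS]/(levels c t * levels c s) -{2}e1 mulgVK.
have Yk : ~` [set z | a k z = z] `<=` ~` common_fix a p e.
  apply: subsetC => z Yz.
  by apply: (Yz p.+1 Logic.I); [exact: symc | exact: symc | rewrite -levelsX // sp levels1 | rewrite -levelsX // tp levels1].
apply: (negligibleS Yk); apply/negligibleP; first exact: measurableC.
have e0 : mu (~` common_fix a p e) = (1 - mu (common_fix a p e))%E by exact: probability_setC.
by rewrite Y1 -EFinB subrr in e0; exact: e0.
Qed.

End Freeness.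

End EssentialFreeness.

(** * Abelian quotients *)

Section AbelianQuotients.
Local Open Scope group_scope.

Section AbelianQuotient.
Variables (K : groupType) (N : set K).
Hypothesis N1 : N 1.
Hypothesis NM : forall f g, N f -> N g -> N (f * g).
Hypothesis NV : forall f, N f -> N f^-1.
Hypothesis NC : forall f g, N [~ f, g].

Definition congruent (f g : K) : bool := `[< N (f^-1 * g) >].

Lemma congruent_refl : reflexive congruent.
Proof. by move=> f; apply/asboolP; rewrite mulVg. Qed.

Lemma congruent_sym : symmetric congruent.
Proof.
by move=> f g; apply/asboolP/asboolP => /NV; rewrite invMg invgK.
Qed.

Lemma congruent_trans : transitive congruent.
Proof.
move=> g f h /asboolP fg /asboolP gh; apply/asboolP.
by have := NM fg gh; rewrite !mulgA mulgK.
Qed.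

Definition congruence : equiv_rel K :=
  EquivRel congruent congruent_refl congruent_sym congruent_trans.

(** The hypothesis NC enters the type so that the instance below, whose proof of
    commutativity uses it, can be found from the type alone. *)
Definition abquot : Type := let _ := NC in {eq_quot congruence}%qT.
HB.instance Definition _ := Choice.on abquot.

Definition abproj (f : K) : abquot := (\pi_({eq_quot congruence}) f)%qT.

Lemma abprojP f g : abproj f = abproj g <-> N (f^-1 * g).
Proof.
split => [/eqP|fg]; first by rewrite /abproj eqmodE => /asboolP.
by apply/eqP; rewrite /abproj eqmodE; apply/asboolP.
Qed.

Definition abrepr (u : abquot) : K := generic_quotient.repr (u : {eq_quot congruence}%qT).

Lemma abreprK u : abproj (abrepr u) = u.
Proof. exact: reprK. Qed.

Lemma normalJ f g : N f -> N (g^-1 * f * g).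
Proof.
move=> Nf; have -> : g^-1 * f * g = f * [~ f, g].
  by rewrite commgEl mulgA mulgV mul1g conjgE mulgA.
exact: NM.
Qed.

Definition abadd (u v : abquot) : abquot := abproj (abrepr u * abrepr v).
Definition abopp (u : abquot) : abquot := abproj (abrepr u)^-1.

Lemma abaddE f g : abadd (abproj f) (abproj g) = abproj (f * g).
Proof.
have /abprojP Nf := abreprK (abproj f); have /abprojP Ng := abreprK (abproj g).
apply/abprojP; set f' := abrepr _ in Nf *; set g' := abrepr _ in Ng *.
have -> : (f' * g')^-1 * (f * g) = (g'^-1 * (f'^-1 * f) * g') * (g'^-1 * g).
  by rewrite invMg !mulgA mulgK.
by apply: NM => //; exact: normalJ.
Qed.

Lemma aboppE f : abopp (abproj f) = abproj f^-1.
Proof.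
have /abprojP/NV Nf := abreprK (abproj f).
apply/abprojP; set f' := abrepr _ in Nf *.
have := normalJ f'^-1 Nf; rewrite invMg !invgK.
by rewrite !mulgA mulgK.
Qed.

Lemma abaddA : associative abadd.
Proof.
move=> u v w; rewrite -(abreprK u) -(abreprK v) -(abreprK w).
by rewrite !abaddE mulgA.
Qed.

Lemma abaddC : commutative abadd.
Proof.
move=> u v; rewrite -(abreprK u) -(abreprK v) !abaddE.
apply/abprojP; set f := abrepr u; set g := abrepr v.
have -> : (f * g)^-1 * (g * f) = [~ g, f] by rewrite commgEl conjgE invMg !mulgA.
exact: NC.
Qed.

Lemma abadd0 : left_id (abproj 1) abadd.
Proof. by move=> u; rewrite -(abreprK u) abaddE mul1g. Qed.

Lemma abaddV : left_inverse (abproj 1) abopp abadd.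
Proof. by move=> u; rewrite -(abreprK u) aboppE abaddE mulVg. Qed.

HB.instance Definition _ := GRing.isZmodule.Build abquot abaddA abaddC abadd0 abaddV.

End AbelianQuotient.

Lemma abelian_quotient (K : groupType) (N : set K) :
  N 1 -> (forall f g, N f -> N g -> N (f * g)) -> (forall f, N f -> N f^-1) ->
  (forall f g, N [~ f, g]) ->
  exists (Q : zmodType) (q : K -> Q),
    (forall f g, q (f * g) = (q f + q g)%R) /\ (forall f, q f = 0%R <-> N f).
Proof.
move=> N1 NM NV NC; exists (abquot N1 NM NV NC), (abproj N1 NM NV NC); split=> [f g|f].
  by rewrite -[RHS]/(abadd _ _) abaddE.
rewrite -[0%R]/(abproj N1 NM NV NC 1) abprojP mulg1.
by split => /NV; rewrite ?invgK.
Qed.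

End AbelianQuotients.

(** * Transpositions and the zeroth homology *)

Section Transpositions.
Local Open Scope group_scope.

Definition multiplicity (T : Type) (As : seq (set T)) (x : T) : nat :=
  (\sum_(A <- As) `[< A x >])%N.

(** A finitely additive function on clopen sets extends to sums of indicators:
    its value on a function f is the sum of its values on the sets f > n. *)
Section AdditiveExtension.
Variables (T : topologicalType) (Q : zmodType) (theta : set T -> Q).
Local Open Scope ring_scope.
Hypothesis thetaU : forall A B, clopen A -> clopen B -> A `&` B = set0 ->
  theta (A `|` B) = theta A + theta B.

Lemma theta0 : theta set0 = 0.
Proof.
have := thetaU (@clopen0 T) (@clopen0 T) (set0I _); rewrite setU0 => /eqP.
by rewrite -[X in X == _]addr0 => /eqP/addrI <-.
Qed.

Implicit Types (A B : set T) (As Bs : seq (set T)) (x : T) (n : nat).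

Definition above As n : set T := [set x | (n < multiplicity As x)%N].
Definition level As n : set T := [set x | multiplicity As x = n].

Lemma multiplicity_cons A As x : multiplicity (A :: As) x = (`[< A x >] + multiplicity As x)%N.
Proof. by rewrite /multiplicity big_cons. Qed.

Lemma multiplicity_size As x : (multiplicity As x <= size As)%N.
Proof.
elim: As => [|A As IH]; first by rewrite /multiplicity big_nil.
by rewrite multiplicity_cons /= -add1n leq_add // leq_b1.
Qed.

Lemma above_cons A As n : above (A :: As) n = above As n `|` (A `&` level As n).
Proof.
apply/seteqP; split => x; rewrite /above /level /= multiplicity_cons.
  have [Ax|nAx] := pselect (A x); last by rewrite asboolF // => ?; left.
  by rewrite asboolT // add1n ltnS leq_eqVlt => /orP[/eqP ->|?]; [right|left].
move=> [h|[Ax <-]]; first by apply: leq_trans h _; exact: leq_addl.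
by rewrite asboolT.
Qed.

Lemma level_clopen As n : (forall A, A \in As -> clopen A) -> clopen (level As n).
Proof.
elim: As n => [|A As IH] n oAs.
  have [->|n0] := eqVneq n 0%N.
    rewrite (_ : level _ _ = setT); first exact: clopenT.
    by apply/seteqP; split => // x _; rewrite /level /= /multiplicity big_nil.
  rewrite (_ : level _ _ = set0); first exact: clopen0.
  apply/seteqP; split => // x; rewrite /level /= /multiplicity big_nil => n0'.
  by rewrite -n0' eqxx in n0.
have oA : clopen A by apply: oAs; rewrite inE eqxx.
have oAs' B : B \in As -> clopen B by move=> BAs; apply: oAs; rewrite inE BAs orbT.
have -> : level (A :: As) n = (~` A `&` level As n) `|` (A `&` (if n is m.+1 then level As m else set0)).
  apply/seteqP; split => x; rewrite /level /= multiplicity_cons; have [Ax|nAx] := pselect (A x).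
  - by rewrite asboolT //; case: n => // m; rewrite add1n => -[e]; right.
  - by rewrite asboolF // add0n => e; left.
  - by rewrite asboolT // => -[[]//|[_]]; case: n => // m <-.
  - by rewrite asboolF // => -[[_ <-]//|[]].
apply: clopenU; apply: clopenI => //; [exact: clopenC | exact: IH |].
by case: n => [|m]; [exact: clopen0 | exact: IH].
Qed.

Lemma above_clopen As n : (forall A, A \in As -> clopen A) -> clopen (above As n).
Proof.
elim: As n => [|A As IH] n oAs.
  rewrite (_ : above _ _ = set0); first exact: clopen0.
  by apply/seteqP; split => // x; rewrite /above /= /multiplicity big_nil.
have oA : clopen A by apply: oAs; rewrite inE eqxx.
have oAs' B : B \in As -> clopen B by move=> BAs; apply: oAs; rewrite inE BAs orbT.
rewrite above_cons; apply: clopenU; first exact: IH.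
by apply: clopenI => //; exact: level_clopen.
Qed.

(** Adding A to the list enlarges the set where the count exceeds i by the part
    of A where the count is i, and these parts add up to A. *)
Lemma sum_theta_above As n : (forall A, A \in As -> clopen A) -> (size As <= n)%N ->
  \sum_(A <- As) theta A = \sum_(i < n) theta (above As i).
Proof.
elim: As => [|A As IH] oAs sn.
  rewrite big_nil big1 // => i _; rewrite (_ : above _ _ = set0) ?theta0 //.
  by apply/seteqP; split => // x; rewrite /above /= /multiplicity big_nil.
have oA : clopen A by apply: oAs; rewrite inE eqxx.
have oAs' B : B \in As -> clopen B by move=> BAs; apply: oAs; rewrite inE BAs orbT.
have oAl i : clopen (A `&` level As i) by apply: clopenI => //; exact: level_clopen.
rewrite big_cons IH //; last exact: ltnW.
have -> : \sum_(i < n) theta (above (A :: As) i) =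
    \sum_(i < n) theta (A `&` level As i) + \sum_(i < n) theta (above As i).
  rewrite -big_split /=; apply: eq_bigr => i _; rewrite above_cons thetaU //.
  - by rewrite addrC.
  - exact: above_clopen.
  - apply/seteqP; split => // x [h [_ e]]; move: h.
    by rewrite /above /= e ltnn.
congr (_ + _).
have part m : theta (A `&` [set x | (multiplicity As x < m)%N]) = \sum_(i < m) theta (A `&` level As i).
  have lt_clopen k : clopen [set x | (multiplicity As x < k)%N].
    elim: k => [|k IHk].
      by rewrite (_ : [set x | _] = set0) ?set0P; [exact: clopen0 | apply/seteqP; split].
    rewrite (_ : [set x | _] = [set x | (multiplicity As x < k)%N] `|` level As k).
      by apply: clopenU => //; exact: level_clopen.
    apply/seteqP; split => x /=; last by move=> [/leqW|<-].
    by rewrite ltnS leq_eqVlt => /orP[/eqP|]; [right|left].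
  elim: m => [|m IHm].
    rewrite big_ord0 (_ : _ `&` _ = set0) ?theta0 //.
    by apply/seteqP; split => // x [].
  rewrite big_ord_recr /= -IHm -thetaU //.
  - congr theta; apply/seteqP; split => x /=.
      by rewrite ltnS leq_eqVlt => -[Ax /orP[/eqP|]]; [right|left].
    by move=> [[Ax /leqW]|[Ax <-]].
  - exact: clopenI.
  - by apply/seteqP; split => // x [[_ /= h] [_ e]]; move: h; rewrite e ltnn.
rewrite -part; congr theta; apply/seteqP; split => x; last by case.
by move=> Ax; split => //=; apply: leq_ltn_trans sn; exact: multiplicity_size.
Qed.

Lemma additive_extension As Bs : (forall A, A \in As -> clopen A) ->
  (forall B, B \in Bs -> clopen B) -> multiplicity As =1 multiplicity Bs ->
  \sum_(A <- As) theta A = \sum_(B <- Bs) theta B.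
Proof.
move=> oA oB AB.
rewrite (sum_theta_above oA (leq_maxl _ (size Bs))).
rewrite (sum_theta_above oB (leq_maxr (size As) _)).
by apply: eq_bigr => i _; congr theta; apply/seteqP; split => x; rewrite /above /= AB.
Qed.

End AdditiveExtension.

Section Theta.
Variable G : etaleCantorGroupoid.
Hypothesis hpi : purely_infinite G.
Hypothesis hmin : minimal G.
Local Notation X := (units G).
Local Notation F := (full_group G).
Implicit Types (A B C : set X) (f g h k : F) (x y z : X).

Section Hom.
Variables (Q : zmodType) (q : F -> Q).
Hypothesis qM : forall f g, q (f * g) = (q f + q g)%R.
Variable e : nat -> X -> X.
Hypothesis ee : copy_seq e.

Lemma q_one : q 1 = 0%R.
Proof. by apply: (@addrI _ (q 1)); rewrite -qM mulg1 addr0. Qed.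

Lemma q_inv f : q f^-1 = (- q f)%R.
Proof. by apply: (@addrI _ (q f)); rewrite -qM mulgV q_one subrr. Qed.

Lemma q_conj f h : q (h * f * h^-1) = q f.
Proof. by rewrite !qM q_inv addrAC subrr add0r. Qed.

Definition theta A : Q := q (swap A (e 0%N) (e 1%N)).

Lemma disjoint_levels A i j : clopen A -> i <> j -> disjoint_copies A (e i) (e j).
Proof.
move=> oA ij; have [_ le ie] := ee; apply: disjoint_copiesP => //.
- by move=> x _; exact: le.
- by move=> x _; exact: le.
- by move=> x y _ _ /(ie _ _ _ _ I I) [].
- by move=> x y _ _ /(ie _ _ _ _ I I) [].
- by move=> x y _ _ /(ie _ _ _ _ I I) [].
Qed.

Lemma swapU A B (b c : X -> X) : clopen A -> clopen B -> A `&` B = set0 ->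
  disjoint_copies (A `|` B) b c -> swap (A `|` B) b c = swap A b c * swap B b c.
Proof.
move=> oA oB AB dAB.
have dA : disjoint_copies A b c by apply: copiesS dAB => //; exact: subsetUl.
have dB : disjoint_copies B b c by apply: copiesS dAB => //; exact: subsetUr.
have [Ab Ac An] := swapP dA; have [Bb Bc Bn] := swapP dB.
have [_ _ ibc] := dAB.
have nAB x : A x -> ~ B x by move=> Ax Bx; have : (A `&` B) x by []; rewrite AB.
apply/esym/swap_uniq => //.
- move=> x [Ax|Bx]; rewrite apM.
    rewrite Bn ?Ab // => -[y By yx].
      by have [_ yx'] := ibc false false y x (or_intror By) (or_introl Ax) yx; subst y; case: (nAB x).
    by have [] := ibc true false y x (or_intror By) (or_introl Ax) yx.
  rewrite Bb // An // => -[y Ay yx].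
    by have [] := ibc false true y x (or_introl Ay) (or_intror Bx) yx.
  by have [_ yx'] := ibc true true y x (or_introl Ay) (or_intror Bx) yx; subst y; case: (nAB x).
- move=> x [Ax|Bx]; rewrite apM.
    rewrite Bn ?Ac // => -[y By yx].
      by have [] := ibc false true y x (or_intror By) (or_introl Ax) yx.
    by have [_ yx'] := ibc true true y x (or_intror By) (or_introl Ax) yx; subst y; case: (nAB x).
  rewrite Bc // An // => -[y Ay yx].
    by have [_ yx'] := ibc false false y x (or_introl Ay) (or_intror Bx) yx; subst y; case: (nAB x).
  by have [] := ibc true false y x (or_introl Ay) (or_intror Bx) yx.
- move=> y nb nc; rewrite apM Bn ?An // => -[x xAB xy]; (apply: nb + apply: nc); exists x => //; by [left|right].
Qed.

Lemma thetaU A B : clopen A -> clopen B -> A `&` B = set0 ->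
  theta (A `|` B) = (theta A + theta B)%R.
Proof.
move=> oA oB AB; rewrite /theta swapU ?qM //.
by apply: disjoint_levels => //; exact: clopenU.
Qed.

Lemma theta_double A : clopen A -> (theta A + theta A = 0)%R.
Proof. by move=> oA; rewrite /theta -qM swap_inv ?q_one //; exact: disjoint_levels. Qed.

(** The class of a transposition depends only on the set that is exchanged with
    a copy of itself: by homogeneity when the transposition leaves some room,
    and in general by cutting the set into two pieces. *)
Lemma theta_swap A (b c : X -> X) : disjoint_copies A b c -> q (swap A b c) = theta A.
Proof.
have proper B (b' c' : X -> X) : disjoint_copies B b' c' -> ~` union_copies B (pair_of b' c') !=set0 ->
    q (swap B b' c') = theta B.
  move=> dB room; have oB : clopen B by case: dB.
  have dBe : disjoint_copies B (e 0%N) (e 1%N) by exact: disjoint_levels.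
  have room' : ~` union_copies B (pair_of (e 0%N) (e 1%N)) !=set0.
    have [x0 _] := units_nonempty G; have [_ _ ie] := ee.
    by exists (e 2%N x0) => -[[] [x [_ /(ie _ _ _ _ I I) []]]].
  have [h hP] := homogeneity hpi hmin dB dBe room room'.
  rewrite /theta -(q_conj _ h); congr q; have [sb sc sn] := swapP dB.
  have hb x : B x -> ap h (b' x) = e 0%N x by exact: (hP false).
  have hc x : B x -> ap h (c' x) = e 1%N x by exact: (hP true).
  have Vb x : B x -> ap h^-1 (e 0%N x) = b' x by move=> /hb <-; rewrite apVK.
  have Vc x : B x -> ap h^-1 (e 1%N x) = c' x by move=> /hc <-; rewrite apVK.
  apply: swap_uniq => //.
  - by move=> x Bx; rewrite !apM Vb // sb // hc.
  - by move=> x Bx; rewrite !apM Vc // sc // hb.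
  - move=> y n0 n1; rewrite !apM sn ?apKV // => -[x Bx xy].
      by apply: n0; exists x => //; rewrite -hb // xy apKV.
    by apply: n1; exists x => //; rewrite -hc // xy apKV.
move=> dA; have oA : clopen A by case: dA.
have [room|full] := pselect (~` union_copies A (pair_of b c) !=set0); first exact: proper.
have [x0 _] := units_nonempty G.
have A0 : A !=set0.
  apply: contrapT => A0; apply: full; exists x0 => -[i [x [Ax _]]].
  by apply: A0; exists x.
have [C [D [oC oD [x Cx] [y Dy] [CA DA CD]]]] := two_rooms hpi oA oA A0 A0.
have nCD z : C z -> ~ D z by move=> Cz Dz; have : (C `&` D) z by []; rewrite CD.
have oAC : clopen (A `\` C) by rewrite setDE; apply: clopenI => //; exact: clopenC.
have AE : A = C `|` (A `\` C) by rewrite setDUK.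
have CAC : C `&` (A `\` C) = set0 by apply/seteqP; split => // z [? []].
have [_ _ ibc] := dA.
have e1 : swap A b c = swap C b c * swap (A `\` C) b c by rewrite {1}AE swapU // -AE.
have e2 : theta A = (theta C + theta (A `\` C))%R by rewrite {1}AE thetaU.
rewrite e1 e2 qM; congr (_ + _)%R; apply: proper.
- exact: copiesS dA.
- exists (b y) => -[i [z [Cz zy]]].
  by have [_ zy'] := ibc i false z y (CA _ Cz) (DA _ Dy) zy; apply: (nCD z) => //; rewrite zy'.
- by apply: copiesS dA => //; exact: subDsetl.
- exists (b x) => -[i [z [[Az nCz] zx]]].
  by have [_ zx'] := ibc i false z x Az (CA _ Cx) zx; apply: nCz; rewrite zx'.
Qed.

(** Transporting both copies along U turns a transposition of copies of rng(U)
    into one of copies of src(U). *)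
Lemma theta_slice (U : set G) : slice U -> theta (src @` U) = theta (rng @` U).
Proof.
move=> sU; have oU := slice_src_clopen sU; have [_ le ie] := ee.
have orU : clopen (rng @` U) := slice_rng_clopen sU.
have dU : disjoint_copies (src @` U) (e 0%N \o smap U) (e 1%N \o smap U).
  apply: disjoint_copiesP => //.
  - by move=> x Ux; apply: germ_comp; [exact: smap_germ | exact: le].
  - by move=> x Ux; apply: germ_comp; [exact: smap_germ | exact: le].
  - by move=> x y Ux Uy /(ie _ _ _ _ I I) [_]; exact: smap_inj.
  - by move=> x y Ux Uy /(ie _ _ _ _ I I) [_]; exact: smap_inj.
  - by move=> x y _ _ /(ie _ _ _ _ I I) [].
rewrite -(theta_swap dU); congr q.
have [sb sc sn] := swapP dU.
apply: swap_uniq; first exact: disjoint_levels.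
- by move=> _ [u Uu <-]; rewrite -(smapE sU Uu); apply: (sb (src u)); exists u.
- by move=> _ [u Uu <-]; rewrite -(smapE sU Uu); apply: (sc (src u)); exists u.
- move=> y n0 n1; apply: sn => -[_ [u Uu <-]] /=; rewrite smapE // => uy.
    by apply: n0; exists (rng u) => //; exists u.
  by apply: n1; exists (rng u) => //; exists u.
Qed.

End Hom.
End Theta.

End Transpositions.

(** * Compactly supported functions and the boundary maps *)

Section CompactlySupportedFunctions.
Local Open Scope ring_scope.

Definition signed_sum (T : Type) (l : seq (bool * set T)) (y : T) : int :=
  \sum_(p <- l) (-1) ^+ p.1 * (`[< p.2 y >])%:R.

Lemma Cc0 (Y : topologicalType) : @Cc Y (0 : Y -> int).
Proof.
split; first by move=> y; exact: cvg_cst.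
rewrite (_ : [set y | _] = set0) ?closure0; first exact: compact0.
by apply/seteqP; split => // y /=; rewrite eqxx.
Qed.

Lemma Cc_preimage_clopen (Y : topologicalType) (phi : Y -> int) (V : set int) :
  Cc phi -> clopen (phi @^-1` V).
Proof.
move=> [cphi _]; split.
  by apply: (@open_comp _ (discrete_topology int)) => //; exact: discrete_open.
by apply: (@closed_comp _ (discrete_topology int)) => //; exact: discrete_closed.
Qed.

(** Cut the support into finitely many basic clopen sets on which phi is
    constant. *)
Lemma Cc_decomposition (Y : topologicalType) (good : set Y -> Prop) (phi : Y -> int) :
  (forall y, exists A, [/\ clopen A, A y & forall B, clopen B -> B `<=` A -> good B]) ->
  Cc phi -> exists l, (forall p, p \in l -> good p.2) /\ phi =1 signed_sum l.
Proof.
move=> base cphi; pose K := [set y | phi y != 0].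
have oK : clopen K.
  by rewrite (_ : K = phi @^-1` [set i | i != 0]) //; exact: Cc_preimage_clopen.
have cK : compact K.
  apply: (subclosed_compact oK.2 cphi.2); exact: subset_closure.
pose P B := exists l, (forall p, p \in l -> good p.2) /\
  forall y, (if `[< B y >] then phi y else 0) = signed_sum l y.
have [l [gl lE]] : P K; last first.
  exists l; split => // y; rewrite -lE; case: asboolP => //.
  by move=> /negP; rewrite negbK => /eqP.
apply: (@compact_clopen_ind _ _ P) => //.
- by exists [::]; split => // y; rewrite asboolF // /signed_sum big_nil.
- move=> y _; have [A [oA Ay gA]] := base y.
  exists (A `&` phi @^-1` [set phi y]); split => //.
    by apply: clopenI => //; exact: Cc_preimage_clopen.
  move=> B oB BA; exists (nseq `|phi y|%N (phi y < 0, B)); split.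
    by move=> p /nseqP [-> _] /=; apply: gA => // z /BA [].
  move=> z; rewrite /signed_sum big_nseq iter_addr_0 /=.
  have [Bz|nBz] := pselect (B z).
    by rewrite !asboolT // mulr1 (BA _ Bz).2 -mulr_natr natz -intEsign.
  by rewrite !asboolF // mulr0 mul0rn.
- move=> A B oA oB AB [l [gl lE]] [m [gm mE]]; exists (l ++ m); split.
    by move=> p; rewrite mem_cat => /orP[/gl|/gm].
  move=> y; rewrite /signed_sum big_cat /= -/(signed_sum l y) -/(signed_sum m y) -lE -mE.
  have [Ay|nAy] := pselect (A y).
    have nBy : ~ B y by move=> By; have : (A `&` B) y by []; rewrite AB.
    by rewrite asboolT ?(asboolT Ay) ?(asboolF nBy) ?addr0 //; left.
  have [By|nBy] := pselect (B y).
    by rewrite asboolT ?(asboolT By) ?(asboolF nAy) ?add0r //; right.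
  by rewrite !asboolF ?addr0 // => -[].
Qed.

(** The map is injective on each set of the list, so that each fibre meets it in
    at most one point and the pushforward of its indicator is the indicator of
    its image. *)
Lemma pushforward_signed_sum (Y Z : topologicalType) (f : Y -> Z)
    (l : seq (bool * set Y)) z :
  (forall p, p \in l -> set_inj p.2 f) ->
  pushforward_int f (signed_sum l) z =
  signed_sum [seq (p.1, f @` p.2) | p <- l] z.
Proof.
move=> fl; pose P := f @^-1` [set z].
pose S := \bigcup_(p in [set` l]) (P `&` p.2).
have fib (p : bool * set Y) y : p \in l -> (P `&` p.2) y -> P `&` p.2 = [set y].
  move=> pl [Py py]; apply/seteqP; split => [y' [Py' py']|_ -> //].
  by apply: (fl p pl); rewrite ?inE // Py' Py.
have fS : finite_set S.
  apply: bigcup_finite; first exact: finite_seq.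
  move=> p pl; have [[y yp]|n] := pselect ((P `&` p.2) !=set0).
    by rewrite (fib _ _ pl yp); exact: finite_set1.
  by rewrite (_ : _ `&` _ = set0) //; apply/seteqP; split => // y yp; apply: n; exists y.
rewrite /pushforward_int -/P -(@fsbig_widen _ _ _ _ S P); first last.
- move=> y [Py nSy]; rewrite /preimage /= /signed_sum big1_seq // => p /andP[_ pl].
  by rewrite asboolF ?mulr0 // => py; apply: nSy; exists p.
- by move=> y [p _ []].
have exch m : {subset m <= l} -> \sum_(y \in S) signed_sum m y =
    \sum_(p <- m) \sum_(y \in S) ((-1) ^+ p.1 * (`[< p.2 y >])%:R : int).
  elim: m => [|p m IH] ml.
    by rewrite big_nil fsbig1 // => y _; rewrite /signed_sum big_nil.
  rewrite big_cons -IH; last by move=> p' pm; apply: ml; rewrite inE pm orbT.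
  rewrite -fsbig_split //; apply: eq_fsbigr => y _.
  by rewrite /signed_sum big_cons.
rewrite exch // /signed_sum big_map; apply: eq_big_seq => p pl /=.
have [[y yp]|n] := pselect ((P `&` p.2) !=set0).
  have Sy : S y by exists p.
  have yE := fib _ _ pl yp; case: yp => Py py.
  rewrite -(@fsbig_widen _ _ _ _ [set y] S).
  - by rewrite fsbig_set1 !asboolT //; exists y.
  - by move=> _ ->.
  - move=> y' [Sy' ny']; rewrite /preimage /= asboolF ?mulr0 // => py'.
    apply: ny'; rewrite -yE; split => //.
    by case: Sy' => p' _ [].
rewrite fsbig1 ?asboolF ?mulr0 //.
  by move=> [y py fy]; apply: n; exists y.
move=> y [p' _ [Py _]]; rewrite asboolF ?mulr0 // => py; apply: n; exists y; by split.
Qed.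
Section Boundaries.
Variable G : etaleCantorGroupoid.
Local Notation X := (units G).
Local Notation G2 := (@composable G).
Implicit Types (U V : set G) (x : X) (l : seq (bool * set G)).

Lemma slice_clopen U : slice U -> clopen U.
Proof.
move=> [oU cU _ _]; split => //; apply: compact_closed cU.
exact: garrow_hausdorff.
Qed.

Lemma sliceS U V : slice U -> clopen V -> V `<=` U -> slice V.
Proof.
move=> [oU cU sU rU] [oV cV] VU; split => //.
- exact: subclosed_compact cU VU.
- by move=> u v /set_mem/VU Uu /set_mem/VU Uv; apply: sU; exact: mem_set.
- by move=> u v /set_mem/VU Uu /set_mem/VU Uv; apply: rU; exact: mem_set.
Qed.

Lemma slice_base (u : G) : exists A : set G,
  [/\ clopen A, A u & forall B, clopen B -> B `<=` A -> slice B].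
Proof.
have [A [sA Au _]] := slice_basis openT (Logic.I : setT u).
by exists A; split => // [|B oB BA]; [exact: slice_clopen | exact: sliceS oB BA].
Qed.

Lemma boundary1_slices l x : (forall p, p \in l -> slice p.2) ->
  boundary1 (signed_sum l) x =
  \sum_(p <- l) (-1) ^+ p.1 * ((`[< (src @` p.2) x >])%:R - (`[< (rng @` p.2) x >])%:R).
Proof.
move=> sl; rewrite /boundary1 [LHS]/= !fctE.
rewrite !pushforward_signed_sum; last 2 first.
- by move=> p /sl [].
- by move=> p /sl [].
rewrite /signed_sum !big_map -sumrB.
by apply: eq_bigr => p _; rewrite /= mulrBr.
Qed.

Definition rect U V : set G2 := [set p : G2 | U (val p).1 /\ V (val p).2].

Lemma composableP (p : G2) : src (val p).1 = rng (val p).2.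
Proof. by case: p => p /= /set_mem /= pc; apply/src_rng_eq. Qed.

Lemma composable_pair (u v : G) : src u = rng v -> exists p : G2, val p = (u, v).
Proof.
move=> /src_rng_eq uv; have h : composable (u, v) by [].
by exists (SigSub (mem_set h)).
Qed.

Lemma comp_val_continuous : continuous (fun p : G2 => val p : G * G).
Proof. exact: initial_continuous. Qed.

Lemma face2_continuous : continuous (@face2 G).
Proof. by move=> p; apply: continuous_comp; [exact: comp_val_continuous | exact: cvg_fst]. Qed.

Lemma face0_continuous : continuous (@face0 G).
Proof. by move=> p; apply: continuous_comp; [exact: comp_val_continuous | exact: cvg_snd]. Qed.

Lemma open_rect (B : set G2) (p : G2) : open B -> B p -> exists U V : set G,
  [/\ open U, open V, U (val p).1, V (val p).2 & rect U V `<=` B].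
Proof.
move=> [W oW <-] Wp.
have [[P Q] /= [nP nQ] PQ] : nbhs (val p) W by apply: open_nbhs_nbhs.
move: nP nQ; rewrite !nbhsE => -[U [oU Up] UP] [V [oV Vp] VQ].
by exists U, V; split => // r [/UP Pr /VQ Qr]; apply: (PQ (val r)); split.
Qed.

Lemma face2_open (B : set G2) : open B -> open (@face2 G @` B).
Proof.
move=> oB; rewrite openE => _ [p Bp <-].
have [U [V [oU oV Up Vp UVB]]] := open_rect oB Bp.
have oW : open (U `&` src @^-1` (rng @` V)).
  apply: openI => //; apply: open_comp; last exact: rng_open.
  by move=> ? _; exact: src_continuous.
rewrite /interior nbhsE; exists (U `&` src @^-1` (rng @` V)).
  by split => //; split => //; exists (val p).2; rewrite // -composableP.
move=> u [Uu [v Vv uv]]; have [r rE] := composable_pair (esym uv).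
by exists r; [apply: UVB; rewrite /rect /= rE | rewrite /face2 rE].
Qed.

Lemma face0_open (B : set G2) : open B -> open (@face0 G @` B).
Proof.
move=> oB; rewrite openE => _ [p Bp <-].
have [U [V [oU oV Up Vp UVB]]] := open_rect oB Bp.
have oW : open (V `&` rng @^-1` (src @` U)).
  apply: openI => //; apply: open_comp; last exact: src_open.
  by move=> ? _; exact: rng_continuous.
rewrite /interior nbhsE; exists (V `&` rng @^-1` (src @` U)).
  by split => //; split => //; exists (val p).1; rewrite // composableP.
move=> v [Vv [u Uu uv]]; have [r rE] := composable_pair uv.
by exists r; [apply: UVB; rewrite /rect /= rE | rewrite /face0 rE].
Qed.

(** A clopen subset of a rectangle of slices is itself a rectangle of slices,
    since each of its points is determined by either of its coordinates. *)
Definition rectangle (B : set G2) : Prop := exists U V,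
  [/\ slice U, slice V, src @` U = rng @` V & B = rect U V].

(** The projections of a clopen subset B of a rectangle are open because faces
    are open maps, and closed because the rest of the rectangle also has open
    projections. *)
Lemma rectangle_base (p : G2) : exists A : set G2,
  [/\ clopen A, A p & forall B, clopen B -> B `<=` A -> rectangle B].
Proof.
have [U [sU Up _]] := slice_basis openT (Logic.I : setT (val p).1).
have [V [sV Vp _]] := slice_basis openT (Logic.I : setT (val p).2).
have [oU cU isU irU] := sU; have [oV cV isV irV] := sV.
have oA : clopen (rect U V).
  apply: clopenI.
    by apply: (@preimage_clopen _ _ (@face2 G)); [exact: slice_clopen | exact: face2_continuous].
  by apply: (@preimage_clopen _ _ (@face0 G)); [exact: slice_clopen | exact: face0_continuous].
exists (rect U V); split => // B oB BA.
have oAB : clopen (rect U V `\` B) by rewrite setDE; apply: clopenI => //; exact: clopenC.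
have eq1 r r' : rect U V r -> rect U V r' -> (val r).1 = (val r').1 -> r = r'.
  move=> [Ur Vr] [Ur' Vr'] e1; apply: val_inj; rewrite [LHS]surjective_pairing [RHS]surjective_pairing e1.
  congr (_, _); apply: irV; rewrite ?inE //.
  by rewrite -!composableP e1.
have eq2 r r' : rect U V r -> rect U V r' -> (val r).2 = (val r').2 -> r = r'.
  move=> [Ur Vr] [Ur' Vr'] e2; apply: val_inj; rewrite [LHS]surjective_pairing [RHS]surjective_pairing e2.
  congr (_, _); apply: isU; rewrite ?inE //.
  by rewrite !composableP e2.
exists (@face2 G @` B), (@face0 G @` B); split.
- apply: (sliceS sU); last by move=> _ [r /BA [? _] <-].
  split; first exact: face2_open oB.1.
  rewrite (_ : _ @` _ = U `&` ~` ((src @^-1` (~` (rng @` V))) `|` (@face2 G @` (rect U V `\` B)))).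
    apply: closedI; first exact: (slice_clopen sU).2.
    apply: open_closedC; apply: openU; last by apply: face2_open; case: oAB.
    apply: open_comp; first by move=> ? _; exact: src_continuous.
    by apply: closed_openC; exact: (slice_rng_clopen sV).2.
  apply/seteqP; split => [_ [r Br <-]|u [Uu nu]].
    have [Ur Vr] := BA _ Br; split => // -[|[r' [Ar' nBr'] r'r]].
      by apply; exists (val r).2; rewrite // -composableP.
    by apply: nBr'; rewrite (eq1 r' r) //; exact: BA.
  have [v Vv uv] : (rng @` V) (src u) by apply: contrapT => n; apply: nu; left.
  have [r rE] := composable_pair (esym uv).
  exists r; last by rewrite /face2 rE.
  apply: contrapT => nBr; apply: nu; right; exists r; last by rewrite /face2 rE.
  by split => //; rewrite /rect /= rE.
- apply: (sliceS sV); last by move=> _ [r /BA [_ ?] <-].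
  split; first exact: face0_open oB.1.
  rewrite (_ : _ @` _ = V `&` ~` ((rng @^-1` (~` (src @` U))) `|` (@face0 G @` (rect U V `\` B)))).
    apply: closedI; first exact: (slice_clopen sV).2.
    apply: open_closedC; apply: openU; last by apply: face0_open; case: oAB.
    apply: open_comp; first by move=> ? _; exact: rng_continuous.
    by apply: closed_openC; exact: (slice_src_clopen sU).2.
  apply/seteqP; split => [_ [r Br <-]|v [Vv nv]].
    have [Ur Vr] := BA _ Br; split => // -[|[r' [Ar' nBr'] r'r]].
      by apply; exists (val r).1; rewrite // composableP.
    by apply: nBr'; rewrite (eq2 r' r) //; exact: BA.
  have [u Uu uv] : (src @` U) (rng v) by apply: contrapT => n; apply: nv; left.
  have [r rE] := composable_pair uv.
  exists r; last by rewrite /face0 rE.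
  apply: contrapT => nBr; apply: nv; right; exists r; last by rewrite /face0 rE.
  by split => //; rewrite /rect /= rE.
- apply/seteqP; split => [_ [_ [r Br <-] <-]|_ [_ [r Br <-] <-]].
    by exists (face0 r); [exists r | rewrite /face0 /face2 -composableP].
  by exists (face2 r); [exists r | rewrite /face0 /face2 composableP].
- apply/seteqP; split => [r Br|r [[r1 Br1 e1] [r2 Br2 e2]]].
    by split; exists r.
  rewrite (_ : r = r2) //; apply: eq2; [|exact: BA|by rewrite -e2].
  by split; [rewrite -e1; case: (BA _ Br1) | rewrite -e2; case: (BA _ Br2)].
Qed.

Lemma rectangles_witness (l : seq (bool * set G2)) : (forall p, p \in l -> rectangle p.2) ->
  exists m : seq (bool * (set G * set G)),
  (forall p, p \in m -> [/\ slice p.2.1, slice p.2.2 & src @` p.2.1 = rng @` p.2.2]) /\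
  l = [seq (p.1, rect p.2.1 p.2.2) | p <- m].
Proof.
elim: l => [|[s B] l IH] gl; first by exists [::].
have [U [V [sU sV UV BE]]] : rectangle B by apply: (gl (s, B)); rewrite inE eqxx.
have [|m [gm ->]] := IH; first by move=> p pl; apply: gl; rewrite inE pl orbT.
exists ((s, (U, V)) :: m); split; last by rewrite /= BE.
by move=> p; rewrite inE => /orP[/eqP -> //|/gm].
Qed.

Lemma boundary2_rectangles (m : seq (bool * (set G * set G))) (u : G) :
  (forall p, p \in m -> [/\ slice p.2.1, slice p.2.2 & src @` p.2.1 = rng @` p.2.2]) ->
  boundary2 (signed_sum [seq (p.1, rect p.2.1 p.2.2) | p <- m]) u =
  \sum_(p <- m) (-1) ^+ p.1 * ((`[< p.2.2 u >])%:R - (`[< gprod p.2.1 p.2.2 u >])%:R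
     + (`[< p.2.1 u >])%:R).
Proof.
move=> gm; rewrite /boundary2 !fctE.
have i0 p : p \in m -> set_inj (rect p.2.1 p.2.2) (@face0 G).
  move=> /gm [[_ _ isU _] sV UV] r r' /set_mem[Ur Vr] /set_mem[Ur' Vr'] e.
  rewrite /face0 in e; apply: val_inj; rewrite [LHS]surjective_pairing [RHS]surjective_pairing e.
  by congr (_, _); apply: isU; rewrite ?inE // !composableP e.
have i2 p : p \in m -> set_inj (rect p.2.1 p.2.2) (@face2 G).
  move=> /gm [sU [_ _ _ irV] UV] r r' /set_mem[Ur Vr] /set_mem[Ur' Vr'] e.
  rewrite /face2 in e; apply: val_inj; rewrite [LHS]surjective_pairing [RHS]surjective_pairing e.
  by congr (_, _); apply: irV; rewrite ?inE // -!composableP e.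
have i1 p : p \in m -> set_inj (rect p.2.1 p.2.2) (@face1 G).
  move=> pm r r' /set_mem rr /set_mem rr' e.
  apply: (i2 p pm); rewrite ?inE //.
  have [[_ _ _ irU] _ _] := gm p pm; case: rr rr' => [Ur _] [Ur' _].
  apply: irU; rewrite ?inE // -(rng_mul (composableP r)) -(rng_mul (composableP r')).
  by congr rng.
rewrite !pushforward_signed_sum; last 3 first.
- by move=> _ /mapP [p pm ->]; exact: i2.
- by move=> _ /mapP [p pm ->]; exact: i1.
- by move=> _ /mapP [p pm ->]; exact: i0.
rewrite /signed_sum !big_map -sumrB -big_split /=; apply: eq_big_seq => p pm.
have [sU sV UV] := gm p pm.
rewrite -mulrBr -mulrDr; congr (_ * (_%:R - _%:R + _%:R)); congr nat_of_bool; congr asbool; rewrite propeqE; split.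
- by move=> [r [_ Vr] <-].
- move=> Vu; have [v Uv vu] : (src @` p.2.1) (rng u) by rewrite UV; exists u.
  have [r rE] := composable_pair vu.
  by exists r; rewrite ?/rect ?/face0 /= rE.
- move=> [r [Ur Vr] <-]; exists (val r).1, (val r).2; split => //.
  exact: composableP.
- move=> [v [w [Uv Vw vw ->]]]; have [r rE] := composable_pair vw.
  by exists r; rewrite ?/rect ?/face1 /= rE.
- by move=> [r [Ur _] <-].
- move=> Uu; have [v Vv vu] : (rng @` p.2.2) (src u) by rewrite -UV; exists u.
  have [r rE] := composable_pair (esym vu).
  by exists r; rewrite ?/rect ?/face2 /= rE.
Qed.

End Boundaries.

End CompactlySupportedFunctions.

(** * Configurations of arrows *)

Section Configurations.
Local Open Scope group_scope.

Lemma perm_eq_off_point (T : eqType) (y0 : T) (L L' : seq T) : size L = size L' ->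
  (forall y, y != y0 -> count_mem y L = count_mem y L') -> perm_eq L L'.
Proof.
move=> sLL cL.
have pC : perm_eq (seq.filter (predC1 y0) L) (seq.filter (predC1 y0) L').
  apply/allP => y _ /=; apply/eqP; rewrite !count_filter.
  have [->|yy0] := eqVneq y y0.
    by rewrite !(eq_count (a2 := pred0)) ?count_pred0 // => z /=; case: eqP.
  have pE : predI (pred1 y) (predC1 y0) =1 pred1 y.
    by move=> z /=; case: eqVneq => // ->.
  by rewrite !(eq_count pE) cL.
apply/allP => y _ /=; apply/eqP; have [->|] := eqVneq y y0; last exact: cL.
have := perm_size pC; rewrite !size_filter => e.
apply/eqP; rewrite -(eqn_add2r (count (predC1 y0) L)) count_predC e count_predC.
exact/eqP.
Qed.

Section Realizations.
Variable G : etaleCantorGroupoid.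
Hypothesis hpi : purely_infinite G.
Hypothesis hmin : minimal G.
Local Notation X := (units G).
Local Notation F := (full_group G).
Variables (Q : zmodType) (q : F -> Q).
Hypothesis qM : forall f g, q (f * g) = (q f + q g)%R.
Hypothesis q_swap : forall A (b c : X -> X), disjoint_copies A b c -> q (swap A b c) = 0%R.
Implicit Types (A B : set X) (f g h k : F) (x y z : X) (U V : set G).

Section VerticalTrivial.
Variables (I : finType) (a : I -> X -> X).

Lemma permute_tperm A (i j : I) : copies A a -> i != j ->
  permute_copies A a (fun=> tperm i j) = swap A (a i) (a j).
Proof.
move=> ea /eqP ij; have [oA la ia] := ea.
have [va vn] := permute_copiesP ea (@loc_const_cst _ _ A (tperm i j)).
apply: swap_uniq.
- apply: disjoint_copiesP => // [x|x|x y Ax Ay|x y Ax Ay|x y Ax Ay]; [exact: la|exact: la| | |].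
  + by move=> /(ia _ _ _ _ Ax Ay) [].
  + by move=> /(ia _ _ _ _ Ax Ay) [].
  + by move=> /(ia _ _ _ _ Ax Ay) [].
- by move=> x Ax; rewrite va // tpermL.
- by move=> x Ax; rewrite va // tpermR.
- move=> y ni nj; have [[k [x [Ax ky]]]|n] := pselect (union_copies A a y); last exact: vn.
  rewrite -ky va // tpermD //; apply/eqP => ik.
    by apply: ni; exists x => //; rewrite ik.
  by apply: nj; exists x => //; rewrite ik.
Qed.

Lemma q_permute_constant A (s : {perm I}) : copies A a -> q (permute_copies A a (fun=> s)) = 0%R.
Proof.
move=> ea; have [ts -> dts] := prod_tpermP s.
elim: ts dts => [|[i j] ts IH] /=; first by rewrite big_nil permute_copies1 // (q_one qM).
move=> /andP[ij dts]; rewrite /dpair /= in ij; rewrite big_cons /= permute_copiesM // qM IH // permute_tperm //.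
by rewrite q_swap ?addr0 //; have [oA la ia] := ea; apply: disjoint_copiesP => // [x|x|x y Ax Ay|x y Ax Ay|x y Ax Ay];
  [exact: la|exact: la| | |]; move=> /(ia _ _ _ _ Ax Ay) [] // e; rewrite e eqxx in ij.
Qed.

(** Elements that only permute the copies of each point are products of
    transpositions: a locally constant family of permutations is constant on
    the pieces of a finite clopen partition. *)
Lemma q_permute (s : X -> {perm I}) : copies setT a -> loc_const setT s ->
  q (permute_copies setT a s) = 0%R.
Proof.
move=> ea ls.
have eA A : clopen A -> copies A a by move=> oA; exact: copiesS ea.
have lA A : loc_const A s by move=> x _; exact: ls.
apply: (@clopen_ind G (fun A => q (permute_copies A a s) = 0%R)).
- rewrite (_ : permute_copies _ _ _ = 1) ?(q_one qM) //; apply: ap_ext => y.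
  by have [_ ->] := permute_copiesP (eA _ clopen0) (lA set0) => // -[i [x []]].
- move=> x; have [B [oB Bx sB]] := ls x Logic.I.
  have [A [oA Ax AB]] := clopen_basis oB Bx.
  exists A; split => // C oC CA.
  rewrite (_ : permute_copies _ _ _ = permute_copies C a (fun=> s x)); first exact/q_permute_constant/eA.
  have [va vn] := permute_copiesP (eA _ oC) (lA C).
  apply: (permutes_copies_uniq _ (permute_copiesP (eA _ oC) (loc_const_cst _))); split => // i y Cy.
  by rewrite va // sB //; apply: AB; exact: CA.
- move=> A B oA oB AB qA qB; rewrite -[RHS](addr0 0%R) -{1}qA -qB -qM; congr q.
  have [va vn] := permute_copiesP (eA _ oA) (lA A); have [wa wn] := permute_copiesP (eA _ oB) (lA B).
  have [_ _ ia] := ea.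
  apply: (permutes_copies_uniq (permute_copiesP (eA _ (clopenU oA oB)) (lA _))); split.
    move=> i x ABx; rewrite apM; have [Bx|nBx] := pselect (B x).
      rewrite wa // vn // => -[j [y [Ay /(ia _ _ _ _ Logic.I Logic.I) [_ yx]]]].
      by have : (A `&` B) x; [split; rewrite // -yx | rewrite AB].
    rewrite wn; last by move=> [j [y [By /(ia _ _ _ _ Logic.I Logic.I) [_ yx]]]]; apply: nBx; rewrite -yx.
    by rewrite va //; case: ABx.
  by move=> y n; rewrite apM wn ?vn // => -[i [x [h xy]]]; apply: n; exists i, x; split => //; [left|right].
Qed.

End VerticalTrivial.
Lemma sections_agree_clopen (t t' : X -> G) : continuous t -> continuous t' ->
  cancel t src -> cancel t' src -> forall x, nbhs x [set y | (t y == t' y) = (t x == t' x)].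
Proof.
move=> ct ct' tK tK' x; have [e|ne] := eqVneq (t x) (t' x).
  have [W [[oW _ sW _] Wx _]] := slice_basis openT (Logic.I : setT (t x)).
  have nW : nbhs x (t @^-1` W) by apply: ct; exact: open_nbhs_nbhs.
  have nW' : nbhs x (t' @^-1` W) by apply: ct'; apply: open_nbhs_nbhs; rewrite -e.
  apply: filterS (filterI nW nW') => y [/= ty t'y].
  by apply/eqP; apply: sW; rewrite ?inE // tK tK'.
have /= := garrow_hausdorff (t := G); rewrite open_hausdorff => /(_ _ _ ne).
move=> [[U V] /= [/set_mem Ux /set_mem Vx]] [oU oV /eqP UV].
have nU : nbhs x (t @^-1` U) by apply: ct; exact: open_nbhs_nbhs.
have nV : nbhs x (t' @^-1` V) by apply: ct'; exact: open_nbhs_nbhs.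
apply: filterS (filterI nU nV) => y [/= ty t'y].
apply/negbTE/eqP => e; have : (U `&` V) (t y) by split; rewrite // e.
by rewrite UV.
Qed.

Variable e : nat -> X -> X.
Hypothesis ee : copy_seq e.

(** The points of the copies of the unit space on the levels n, ..., n + m - 1. *)
Definition band n m : set X := [set y | exists i x, (i < m)%N /\ e (n + i) x = y].

Definition global_section (t : X -> G) : Prop := continuous t /\ cancel t src.

Definition nth_section (ts : seq (X -> G)) i : X -> G := nth (fun x => val x) ts i.

(** The element f follows the arrows of ts: over the point x of level i it
    applies the arrow ts_i(x), and changes levels in some unspecified way. *)
Definition realizes n f (ts : seq (X -> G)) : Prop :=
  supp f (band n (size ts)) /\
  forall i x, (i < size ts)%N -> exists2 j, (j < size ts)%N &
    ap f (e (n + i) x) = e (n + j) (rng (nth_section ts i x)).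

Lemma e_inj i j x y : e i x = e j y -> i = j /\ x = y.
Proof. by have [_ _ ie] := ee; exact: ie. Qed.

Lemma realizes_cat n f f' ts ts' : realizes n f ts -> realizes (n + size ts) f' ts' ->
  realizes n (f * f') (ts ++ ts').
Proof.
move=> [sf rf] [sf' rf'].
have nb i x : (i < size ts)%N -> ~ band (n + size ts) (size ts') (e (n + i) x).
  move=> it [j [y [_ /e_inj [h _]]]]; move: it.
  by move/eqP: h; rewrite -addnA eqn_add2l => /eqP <-; rewrite ltnNge leq_addr.
have nb' i x : ~ band n (size ts) (e (n + (size ts + i)) x).
  move=> [j [y [jt /e_inj [h _]]]]; move: jt.
  by move/eqP: h; rewrite eqn_add2l => /eqP ->; rewrite ltnNge leq_addr.
split=> [y nby|i x].
  rewrite apM sf'; last first.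
    move=> [i [x [it xy]]]; apply: nby; exists (size ts + i)%N, x.
    by rewrite size_cat ltn_add2l addnA.
  by apply: sf => -[i [x [it xy]]]; apply: nby; exists i, x; rewrite size_cat ltn_addr.
rewrite /nth_section nth_cat size_cat apM => it; case: ifPn => [iS|].
  rewrite sf'; last exact: nb.
  by have [j jt ->] := rf i x iS; exists j => //; rewrite ltn_addr.
rewrite -leqNgt => ti; have iE : i = (size ts + (i - size ts))%N by rewrite subnKC.
have it' : (i - size ts < size ts')%N by rewrite -(ltn_add2l (size ts)) -iE.
have [j jt rj] := rf' _ x it'.
rewrite {1}iE addnA rj; exists (size ts + j)%N; first by rewrite ltn_add2l.
by rewrite sf -addnA //; exact: nb'.
Qed.

(** An element that moves points between levels only permutes, over each base
    point, the copies of that point. *)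
Lemma q_level_permutation n k : supp k (band 0 n) ->
  (forall j y, (j < n)%N -> exists2 j', (j' < n)%N & ap k (e j y) = e j' y) ->
  q k = 0%R.
Proof.
move=> sk vk; have en := initial_copies n ee; pose a (i : 'I_n) := e i.
have [x0 _] := units_nonempty G.
have ex (y : X) (j : 'I_n) : exists j' : 'I_n, ap k (a j y) = a j' y.
  by have [j' jn kj] := vk j y (ltn_ord j); exists (Ordinal jn).
pose s y j := projT1 (cid (ex y j)).
have sE y j : ap k (a j y) = a (s y j) y by rewrite /s; case: cid.
have sI y : injective (s y).
  move=> i j ij; have : ap k (a i y) = ap k (a j y) by rewrite !sE ij.
  by move=> /ap_inj/e_inj [/ord_inj].
have ls : loc_const setT (fun y => perm (sI y)).
  move=> x _.
  suff : nbhs x [set y | forall j, s y j = s x j].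
    rewrite nbhsE => -[B [oB Bx] sB]; exists B; split => // y By.
    by apply/permP => j; rewrite !permE; exact: sB.
  suff H j : nbhs x [set y | s y j = s x j].
    exact: (@filter_forall _ _ (fun j => [set y | s y j = s x j]) _ (nbhs_filter x) H).
  have oj : open (e (s x j) @` setT).
    by apply: germ_image_open; [exact: openT | move=> z _; case: ee => _ le _; exact: le].
  have ck : {for x, continuous (ap k \o a j)}.
    apply: germ_cont; apply: germ_comp; last exact: ap_germ.
    by case: ee => _ le _; exact: le.
  have : nbhs x ((ap k \o a j) @^-1` (e (s x j) @` setT)).
    by apply: ck; apply: open_nbhs_nbhs; split => //=; rewrite sE; exists x.
  apply: filterS => y [z _ /=]; rewrite sE => /esym/e_inj [h _].
  exact: ord_inj.
rewrite -(q_permute en ls); congr q.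
apply: (permutes_copies_uniq _ (permute_copiesP en ls)); split => [i x _|y ny]; first by rewrite permE; exact: sE.
apply: sk => -[i [x [it xy]]]; apply: ny.
by exists (Ordinal it), x.
Qed.

(** The class of an element depends only on how often each arrow that is not a
    unit occurs among the arrows that it follows: at each point, the arrows of
    the two elements agree up to a permutation of levels, which depends on the
    point in a locally constant way, and the elements then differ by level
    permutations only. *)
Lemma realizes_count f f' ts ts' : realizes 0 f ts -> realizes 0 f' ts' ->
  (forall i, global_section (nth_section ts i)) -> (forall i, global_section (nth_section ts' i)) ->
  size ts = size ts' ->
  (forall u : G, ~ units G u -> count (fun t => t (src u) == u) ts =
                                count (fun t => t (src u) == u) ts') ->
  q f = q f'.
Proof.
move=> [sf rf] [sf' rf'] gs gs' ss cc.
set n := size ts in sf rf ss *; rewrite -ss in sf' rf'.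
have en := initial_copies n ee; pose a (i : 'I_n) := e i.
pose goodp x (p : 'S_n) := [forall i : 'I_n, nth_section ts i x == nth_section ts' (p i) x].
have ex x : exists p, goodp x p.
  pose L := [seq t x | t <- ts]; pose L' := [seq t x | t <- ts'].
  have sL' : size L' == n by rewrite size_map -ss.
  have srct t : t \in ts -> src (t x) = x.
    by move=> /(nthP (fun x => val x)) [i _ <-]; have [_] := gs i.
  have srct' t : t \in ts' -> src (t x) = x.
    by move=> /(nthP (fun x => val x)) [i _ <-]; have [_] := gs' i.
  have pL : perm_eq L L'.
    apply: (@perm_eq_off_point _ (val x)) => [|y /eqP yx]; first by rewrite (eqP sL') size_map.
    rewrite !count_map; have [yE|nyE] := pselect (src y = x).
      have ny : ~ units G y.
        move=> uy; apply: yx; rewrite -yE; have [w <-] : exists w : X, val w = y.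
          by exists (SigSub (mem_set uy)).
        by rewrite src_val.
      by have := cc y ny; rewrite yE.
    rewrite (eq_in_count (a2 := pred0)) ?count_pred0.
      rewrite (eq_in_count (a2 := pred0)) ?count_pred0 // => t /srct' tx /=.
      by apply/negbTE/eqP => ty; apply: nyE; rewrite -ty.
    by move=> t /srct tx /=; apply/negbTE/eqP => ty; apply: nyE; rewrite -ty.
  have /tuple_permP [p Lp] : perm_eq L (Tuple sL') by [].
  exists p; apply/forallP => i; apply/eqP.
  have := congr1 (fun M => nth (val x) M i) Lp.
  rewrite (nth_map (fun x => val x)) // => eL; apply: (etrans eL).
  rewrite -tnth_nth tnth_mktuple (tnth_nth (val x)) /= (nth_map (fun x => val x)) //.
  by rewrite -ss.
pose s x : 'S_n := odflt 1 [pick p | goodp x p].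
have sP x (i : 'I_n) : nth_section ts i x = nth_section ts' (s x i) x.
  have : goodp x (s x).
    by rewrite /s; case: pickP => [p //|n0]; have [p gp] := ex x; have := n0 p; rewrite gp.
  by move=> /forallP/(_ i)/eqP.
have ls : loc_const setT s.
  move=> x _; pose same (ij : 'I_n * 'I_n) : set X :=
    [set y | (nth_section ts ij.1 y == nth_section ts' ij.2 y) = (nth_section ts ij.1 x == nth_section ts' ij.2 x)].
  have H ij : nbhs x (same ij).
    have [ci iK] := gs ij.1; have [cj jK] := gs' ij.2.
    exact: sections_agree_clopen.
  have := @filter_forall _ _ same _ (nbhs_filter x) H.
  rewrite /= nbhsE => -[B [oB Bx] sB]; exists B; split => // y By.
  rewrite /s; congr odflt; apply: eq_pick => p; apply: eq_forallb => i.
  exact: (sB y By (i, p i)).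
pose v := permute_copies setT a s; have [va vn] := permute_copiesP en ls.
have sv : supp v (band 0 n).
  move=> y ny; apply: vn => -[i [x [_ xy]]]; apply: ny.
  by exists i, x; split => //; exact: ltn_ord.
have vE i x : (i < n)%N -> exists j, [/\ (j < n)%N, ap v (e i x) = e j x & nth_section ts i x = nth_section ts' j x].
  move=> it; exists (s x (Ordinal it)); split; first exact: ltn_ord.
    exact: (va (Ordinal it) x I).
  exact: (sP x (Ordinal it)).
(* The element v rearranges the levels so that f' v and f follow the same arrows
   and differ only in the levels on which they end. *)
suff : q (f' * v * f^-1) = 0%R.
  rewrite !qM (q_permute en ls) addr0 (q_inv qM) => /eqP.
  by rewrite subr_eq0 => /eqP.
apply: (@q_level_permutation n); first by apply: suppM; [exact: suppM | exact: suppV].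
move=> j y jn; have [i [x [it xy]]] : band 0 n (ap f^-1 (e j y)).
  by apply: supp_stable; [exact: suppV | exists j, y].
rewrite !apM -xy add0n; have [i' [i't -> tt']] := vE i x it.
have [j' j't ->] := rf' i' x i't; exists j' => //; rewrite !add0n -tt'.
have [j'' _ fe] := rf i x it.
have : e j'' (rng (nth_section ts i x)) = e j y by rewrite -[RHS](apKV f) -xy -fe.
by move=> /e_inj [_ ->].
Qed.

End Realizations.
Section Slices.
Variable G : etaleCantorGroupoid.
Local Notation X := (units G).
Implicit Types (U V : set G) (x : X).

Lemma src_slice_inv U : src @` (@ginv G @` U) = rng @` U.
Proof.
apply/seteqP; split => [_ [_ [u Uu <-] <-]|_ [u Uu <-]].
  by exists u; rewrite ?src_inv.
by exists (ginv u); [exists u | rewrite src_inv].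
Qed.

Lemma slice_inv U : slice U -> slice (@ginv G @` U).
Proof.
move=> [oU cU sU rU]; split.
- exact: ginv_open.
- by apply: continuous_compact => //; apply: continuous_subspaceT; exact: ginv_continuous.
- move=> _ _ /set_mem[u Uu <-] /set_mem[v Uv <-]; rewrite !src_inv => uv.
  by congr ginv; apply: rU; rewrite ?inE.
- move=> _ _ /set_mem[u Uu <-] /set_mem[v Uv <-]; rewrite !rng_inv => uv.
  by congr ginv; apply: sU; rewrite ?inE.
Qed.

Lemma smap_inv U u : slice U -> U u -> smap (@ginv G @` U) (rng u) = src u.
Proof.
by move=> sU Uu; rewrite -src_inv smapE ?rng_inv //; exact: slice_inv.
Qed.

Lemma slice_mul U V : slice U -> slice V -> src @` U = rng @` V -> slice (gprod U V).
Proof.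
move=> sU sV UV; have [oU cU isU irU] := sU; have [oV cV isV irV] := sV.
split; first exact: gprod_open.
- pose D := src @` V; pose t x := gmul (sect U (smap V x)) (sect V x).
  have oD : clopen D := slice_src_clopen sV.
  have tE (v : G) : V v -> exists u, [/\ U u, src u = rng v & t (src v) = gmul u v].
    move=> Vv; have [u Uu uv] : (src @` U) (rng v) by rewrite UV; exists v.
    by exists u; split => //; rewrite /t smapE // -uv !sectK.
  have -> : gprod U V = t @` D.
    apply/seteqP; split => [_ [u [v [Uu Vv uv ->]]]|_ [_ [v Vv <-] <-]].
      exists (src v); first by exists v.
      have [u' [Uu' u'v ->]] := tE v Vv; congr gmul.
      by apply: isU; rewrite ?inE // uv.
    by have [u [Uu uv ->]] := tE v Vv; exists u, v.
  apply: continuous_compact; last exact: clopen_compact.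
  rewrite continuous_open_subspace; last by case: oD.
  move=> x /set_mem Dx; apply: (gmul_cvg oD.1 Dx).
  + apply: (@continuous_comp _ _ _ (smap V) (sect U)); last exact: sect_cont.
    by apply: germ_cont; exact: smap_germ.
  + exact: sect_cont.
  + by move=> y _; rewrite src_sect.
- move=> _ _ /set_mem[u [v [Uu Vv uv ->]]] /set_mem[u' [v' [Uu' Vv' uv' ->]]].
  rewrite !src_mul // => vv'; have vE : v = v' by apply: isV; rewrite ?inE.
  by congr gmul => //; apply: isU; rewrite ?inE // uv vE uv'.
- move=> _ _ /set_mem[u [v [Uu Vv uv ->]]] /set_mem[u' [v' [Uu' Vv' uv' ->]]].
  rewrite !rng_mul // => uu'; have uE : u = u' by apply: irU; rewrite ?inE.
  by congr gmul => //; apply: irV; rewrite ?inE // -uv uE uv'.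
Qed.

Lemma rng_gprod U V : src @` U = rng @` V -> rng @` gprod U V = rng @` U.
Proof.
move=> UV; apply/seteqP; split => [_ [_ [u [v [Uu Vv uv ->]]] <-]|_ [u Uu <-]].
  by exists u => //; rewrite rng_mul.
have [v Vv uv] : (rng @` V) (src u) by rewrite -UV; exists u.
by exists (gmul u v); [exists u, v | rewrite rng_mul].
Qed.

Lemma sect_global U : slice U -> global_section (sect U).
Proof. by move=> sU; split; [exact: sect_cont | move=> x; exact: src_sect]. Qed.

Lemma units_global : global_section (fun x : X => val x : G).
Proof. by split; [exact: val_units_continuous | exact: src_val]. Qed.

Lemma sect_count U (u : G) : slice U -> ~ units G u ->
  (sect U (src u) == u) = `[< U u >].
Proof.
move=> sU nu; apply/eqP/asboolP => [uE|Uu]; last by rewrite sectK.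
have [[w Uw wu]|n] := pselect ((src @` U) (src u)); first by rewrite -uE -wu sectK.
case: nu; rewrite -uE sect_out //; apply: set_mem; exact: valP.
Qed.

End Slices.

Section Index.
Variable G : etaleCantorGroupoid.
Hypothesis hpi : purely_infinite G.
Hypothesis hmin : minimal G.
Local Notation X := (units G).
Local Notation F := (full_group G).
Variables (Q : zmodType) (q : F -> Q).
Hypothesis qM : forall f g, q (f * g) = (q f + q g)%R.
Hypothesis q_swap : forall A (b c : X -> X), disjoint_copies A b c -> q (swap A b c) = 0%R.
Implicit Types (A B : set X) (f g h k : F) (x y z : X) (U V : set G).
Variable e : nat -> X -> X.
Hypothesis ee : copy_seq e.

(** Moving an element to a copy of the unit space does not change its class.
    Up to a transposition, the element fixes a nonempty open set; the rest is
    then moved to the copy by an element of the full group. *)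
Lemma lift_to_copy f : exists f', [/\ supp f' (range (e 0%N)),
  forall x, ap f' (e 0%N x) = e 0%N (ap f x) & q f' = q f].
Proof.
have [_ le ie] := ee; have e0i x y : e 0%N x = e 0%N y -> x = y.
  by move=> /(ie _ _ _ _ I I) [].
have [->|f1] := pselect (f = 1).
  by exists 1; split => // x _.
have [U [oU [x Ux] fU]] := moved_off f1.
have dU : disjoint_copies U id (ap f).
  apply: disjoint_copiesP => // [y _|y _|y z _ _ /ap_inj //]; [exact: germ_id | exact: ap_germ].
have dU' : disjoint_copies U (e 0%N) (e 0%N \o ap f).
  apply: disjoint_copiesP => //.
  - by move=> y _; exact: le.
  - by move=> y _; apply: germ_comp; [exact: ap_germ | exact: le].
  - by move=> y z _ _ /e0i.
  - by move=> y z _ _ /e0i/ap_inj.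
  - by move=> y z Uy Uz /e0i; exact: fU.
have [s1 s2 s3] := swapP dU; have [t1 t2 t3] := swapP dU'.
set s := swap U id (ap f) in s1 s2 s3; set t := swap U _ _ in t1 t2 t3.
have [b bE] : exists b, b = s * f by exists (s * f).
have fE : f = s * b by rewrite bE mulgA swap_inv // mul1g.
have bU y : U y -> ap b y = y by move=> Uy; rewrite bE apM s2.
have oA : clopen (~` U) by exact: clopenC.
have [h hP] : exists h, forall y, ~ U y -> ap h y = e 0%N y.
  have eid : @copies G unit (~` U) (fun=> id).
    by split => // [i y _|[] [] y z _ _ ->]; [exact: germ_id | split].
  have ee0 : @copies G unit (~` U) (fun=> e 0%N).
    by split => // [i y _|[] [] y z _ _ /e0i ->]; [exact: le | split].
  have [||h hP] := homogeneity hpi hmin eid ee0.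
  - by exists x => -[_ [y [nUy yx]]]; apply: nUy; rewrite yx.
  - by exists (e 1%N x) => -[_ [y [_ /(ie _ _ _ _ I I) []]]].
  by exists h => y nUy; exact: (hP tt).
have hV y : ~ U y -> ap h^-1 (e 0%N y) = y by move=> nU; rewrite -hP // apVK.
have bN y : ~ U y -> ~ U (ap b y).
  by move=> nU Ub; have := bU _ Ub => /ap_inj by_; apply: nU; rewrite -by_.
have lb y : ap (h * b * h^-1) (e 0%N y) = e 0%N (ap b y).
  rewrite !apM; have [Uy|nUy] := pselect (U y); last first.
    by rewrite hV // hP //; exact: bN.
  rewrite [ap b (ap h^-1 _)]bU; first by rewrite apKV bU.
  apply: contrapT => nU; have := hP _ nU; rewrite apKV => /e0i yE.
  by apply: nU; rewrite -yE.
have lt y : ap t (e 0%N y) = e 0%N (ap s y).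
  have [Uy|nUy] := pselect (U y); first by rewrite t1 // (s1 y Uy).
  have [[z Uz zy]|nfU] := pselect ((ap f @` U) y).
    by rewrite -zy (s2 z Uz) -(t2 z Uz).
  rewrite s3 //; last by move=> [z Uz zy]; apply: nUy; rewrite -zy.
  rewrite t3 // => -[z Uz] /=; first by move=> /e0i zy; apply: nUy; rewrite -zy.
  by move=> /e0i zy; apply: nfU; exists z.
exists (t * (h * b * h^-1)); split.
- move=> y ny; rewrite apM.
  have -> : ap (h * b * h^-1) y = y.
    rewrite !apM [ap b _]bU ?apKV //; apply: contrapT => nU.
    by have := hP _ nU; rewrite apKV => yE; apply: ny; exists (ap h^-1 y).
  by apply: t3 => -[z Uz zy]; apply: ny; [exists z | exists (ap f z)].
- by move=> y; rewrite apM lb lt -apM -fE.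
- by rewrite qM q_swap // add0r (q_conj qM) bE qM q_swap // add0r.
Qed.

(** For u in U, the points over src u on level i and over rng u on level j are
    exchanged. *)
Definition level_swap i j U : F := swap (src @` U) (e i) (e j \o smap U).

Lemma level_swap_disj i j U : slice U -> i <> j -> disjoint_copies (src @` U) (e i) (e j \o smap U).
Proof.
move=> sU ij; have [_ le ie] := ee; apply: disjoint_copiesP.
- exact: slice_src_clopen.
- by move=> x _; exact: le.
- by move=> x Ux; apply: germ_comp; [exact: smap_germ | exact: le].
- by move=> x y _ _ /(ie _ _ _ _ I I) [].
- by move=> x y Ux Uy /(ie _ _ _ _ I I) [_]; exact: smap_inj.
- by move=> x y _ _ /(ie _ _ _ _ I I) [].
Qed.

Lemma level_swapP i j U : slice U -> i <> j -> let s := level_swap i j U in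
  [/\ forall u, U u -> ap s (e i (src u)) = e j (rng u),
      forall u, U u -> ap s (e j (rng u)) = e i (src u),
      forall x, ~ (src @` U) x -> ap s (e i x) = e i x,
      forall x, ~ (rng @` U) x -> ap s (e j x) = e j x &
      forall y, (forall x, e i x <> y) -> (forall x, e j x <> y) -> ap s y = y].
Proof.
move=> sU ij s; have [s1 s2 s3] := swapP (level_swap_disj sU ij); split.
- by move=> u Uu; rewrite s1 /= ?smapE //; exists u.
- by move=> u Uu; rewrite -(smapE sU Uu); apply: s2; exists u.
- move=> x nx; apply: s3 => -[_ [u Uu <-]]; last by move=> /(e_inj ee) [/esym].
  by move=> /(e_inj ee) [_ ux]; apply: nx; exists u.
- move=> x nx; apply: s3 => -[_ [u Uu <-]]; first by move=> /(e_inj ee) [].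
  by rewrite /= smapE // => /(e_inj ee) [_ ux]; apply: nx; exists u.
- by move=> y n1 n2; apply: s3 => -[x _ xy]; [exact: n1 xy | exact: n2 xy].
Qed.

Lemma sect_rng_out U x : ~ (src @` U) x -> rng (sect U x) = x.
Proof. by move=> nx; rewrite sect_out // rng_val. Qed.

(** The transposition along U follows the arrows of U in one direction and their
    inverses in the other. *)
Lemma realizes_inverse_pair n U : slice U ->
  realizes e n (level_swap n n.+1 U) [:: sect U; sect (@ginv G @` U)].
Proof.
move=> sU; have nn : n <> n.+1 by move/eqP; rewrite -[X in X == _]addn0 -addn1 eqn_add2l.
have [s1 s2 s3 s4 s5] := level_swapP sU nn; split.
  move=> y ny; apply: s5 => x xy; apply: ny.
    by exists 0%N, x; rewrite addn0.
  by exists 1%N, x; rewrite addn1.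
move=> [|[|//]] x _ /=; rewrite /nth_section /= ?addn0 ?addn1.
  have [[u Uu <-]|nx] := pselect ((src @` U) x).
    by exists 1%N => //; rewrite s1 // sectK // addn1.
  by exists 0%N => //; rewrite s3 // sect_rng_out // addn0.
have [[u Uu <-]|nx] := pselect ((rng @` U) x).
  by exists 0%N => //; rewrite s2 // -/(smap _ _) smap_inv // addn0.
by exists 1%N => //; rewrite s4 // sect_rng_out ?addn1 // src_slice_inv.
Qed.

(** On the first three levels, the cyclic exchange along U V, U^-1 and V^-1. *)
Lemma realizes_product n U V : slice U -> slice V -> src @` U = rng @` V ->
  realizes e n (level_swap n n.+2 (gprod U V) * level_swap n.+1 n.+2 U)
    [:: sect (gprod U V); sect (@ginv G @` V); sect (@ginv G @` U); (fun x => val x)].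
Proof.
move=> sU sV UV; have sW := slice_mul sU sV UV.
have n02 : n <> n.+2 by move/eqP; rewrite -[X in X == _]addn0 -addn2 eqn_add2l.
have n12 : n.+1 <> n.+2 by case=> /eqP; rewrite -[X in X == _]addn0 -addn1 eqn_add2l.
have n01 : n <> n.+1 by move/eqP; rewrite -[X in X == _]addn0 -addn1 eqn_add2l.
have n3 i : (i < 3)%N -> (n + i)%N <> (n + 3)%N by move=> + /eqP; rewrite eqn_add2l => + /eqP h; rewrite h.
have [s1 s2 s3 s4 s5] := level_swapP sW n02; have [t1 t2 t3 t4 t5] := level_swapP sU n12.
have off i j x : i <> j -> forall y, e i y <> e j x by move=> ij y /(e_inj ee) [].
split.
  move=> y ny; have ny' i x : (i < 4)%N -> e (n + i) x <> y by move=> i4 xy; apply: ny; exists i, x.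
  have ny0 x : e n x <> y by have := ny' 0%N x; rewrite addn0; exact.
  have ny1 x : e n.+1 x <> y by have := ny' 1%N x; rewrite addn1; exact.
  have ny2 x : e n.+2 x <> y by have := ny' 2%N x; rewrite addn2; exact.
  by rewrite apM t5 // s5.
move=> [|[|[|[|//]]]] x _ /=; rewrite /nth_section /= ?addn0 ?addn1 ?addn2 apM.
- rewrite t5; [|by apply: off => /esym|by apply: off => /esym].
  have [[w Ww <-]|nx] := pselect ((src @` gprod U V) x).
    by exists 2%N => //; rewrite s1 // sectK // addn2.
  by exists 0%N => //; rewrite s3 // sect_rng_out // addn0.
- have [[u Uu <-]|nx] := pselect ((src @` U) x); last first.
    exists 1%N => //; rewrite t3 // s5 ?sect_rng_out ?addn1 //; try exact: off.
      by rewrite src_slice_inv -UV.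
    by apply: off => /esym.
  have [v Vv vu] : (rng @` V) (src u) by rewrite -UV; exists u.
  exists 0%N => //; rewrite t1 //.
  have Wuv : gprod U V (gmul u v) by exists u, v.
  rewrite -(@rng_mul _ u v) // s2 // src_mul // -vu -/(smap _ _) smap_inv // addn0 //.
- have [[u Uu <-]|nx] := pselect ((rng @` U) x); last first.
    exists 2%N => //; rewrite t4 // s4 ?rng_gprod // sect_rng_out ?addn2 //.
    by rewrite src_slice_inv.
  exists 1%N => //; rewrite t2 // s5 -/(smap _ _) ?smap_inv ?addn1 //; try exact: off.
  by apply: off => /esym.
- exists 3%N => //; rewrite rng_val.
  have o3 i y : (i < 3)%N -> e (n + i) y <> e (n + 3) x by move=> i3; apply: off; exact: n3.
  have o0 y : e n y <> e (n + 3) x by have := o3 0%N y; rewrite addn0; exact.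
  have o1 y : e n.+1 y <> e (n + 3) x by have := o3 1%N y; rewrite addn1; exact.
  have o2 y : e n.+2 y <> e (n + 3) x by have := o3 2%N y; rewrite addn2; exact.
  by rewrite t5 // s5.
Qed.

End Index.
Definition indicator (T : Type) (A : set T) (x : T) : int := (`[< A x >])%:R.

Lemma locally_constant_continuous (Y : topologicalType) (phi : Y -> int) :
  (forall y, nbhs y [set z | phi z = phi y]) ->
  continuous (phi : Y -> discrete_topology int).
Proof. by move=> lc y; exact: (@cvg_near_cst _ (discrete_topology int)) (lc y). Qed.

Lemma indicator_Cc (Y : topologicalType) (A : set Y) : clopen A -> compact A ->
  Cc (indicator A).
Proof.
move=> [oA cA] kA; split.
  apply: locally_constant_continuous => y.
  have [Ay|nAy] := pselect (A y).
    have nA : nbhs y A by exact: open_nbhs_nbhs.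
    by apply: filterS nA => z Az /=; rewrite /indicator !asboolT.
  have nA : nbhs y (~` A) by apply: open_nbhs_nbhs; split => //; exact: closed_openC.
  by apply: filterS nA => z nAz /=; rewrite /indicator !asboolF.
apply: subclosed_compact kA _; first exact: closed_closure.
rewrite [X in _ `<=` X](closure_id A).1 //; apply: closure_subset => y /=.
by apply: contraNP => nAy; rewrite /indicator asboolF.
Qed.

Section Index.
Variable G : etaleCantorGroupoid.
Hypothesis hpi : purely_infinite G.
Hypothesis hmin : minimal G.
Local Notation X := (units G).
Local Notation F := (full_group G).
Implicit Types (A B : set X) (f g h k : F) (x y z : X) (U V : set G).
Variable e : nat -> X -> X.
Hypothesis ee : copy_seq e.

Definition slice_pair (p : bool * (set G * set G)) : Prop :=
  [/\ slice p.2.1, slice p.2.2 & src @` p.2.1 = rng @` p.2.2].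

Section Hom.
Variables (Q : zmodType) (q : F -> Q).
Hypothesis qM : forall f g, q (f * g) = (q f + q g)%R.
Hypothesis q_swap : forall A (b c : X -> X), disjoint_copies A b c -> q (swap A b c) = 0%R.

Definition hits (ts : seq (X -> G)) (u : G) : nat := count (fun t => t (src u) == u) ts.

Lemma nth_section_cat (ts ts' : seq (X -> G)) : (forall i, global_section (nth_section ts i)) ->
  (forall i, global_section (nth_section ts' i)) -> forall i, global_section (nth_section (ts ++ ts') i).
Proof. by move=> g g' i; rewrite /nth_section nth_cat; case: ifP => _; [exact: g | exact: g']. Qed.

Lemma nth_section_nil : forall i, global_section (nth_section [::] i : X -> G).
Proof. by move=> i; rewrite /nth_section nth_nil; exact: units_global. Qed.

Lemma nth_section_cons t (ts : seq (X -> G)) : global_section t ->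
  (forall i, global_section (nth_section ts i)) -> forall i, global_section (nth_section (t :: ts) i).
Proof. by move=> gt gts [|i]; [exact: gt | exact: gts]. Qed.

Lemma q_level_swap i j U : slice U -> i <> j -> q (level_swap e i j U) = 0%R.
Proof. by move=> sU ij; apply: q_swap; exact: level_swap_disj. Qed.

Lemma hits_units (u : G) : ~ units G u -> ((fun x : X => val x : G) (src u) == u) = false.
Proof.
move=> nu; apply/negbTE/eqP => uE; apply: nu; rewrite -uE; apply: set_mem; exact: valP.
Qed.

(** The boundary of a rectangle (U, V) is the difference of two configurations of
   arrows, each closed up by the inverses of U and V, and each followed by a
   product of transpositions. *)
Lemma realizes_rectangle n (p : bool * (set G * set G)) : slice_pair p ->
  exists g g' ts ts', [/\ realizes e n g ts, realizes e n g' ts', q g = 0%R, q g' = 0%R &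
    [/\ size ts = size ts', forall i, global_section (nth_section ts i),
        forall i, global_section (nth_section ts' i) &
        forall u, ~ units G u -> ((hits ts' u)%:Z - (hits ts u)%:Z =
          (-1) ^+ p.1 * ((`[< p.2.2 u >])%:R - (`[< gprod p.2.1 p.2.2 u >])%:R
            + (`[< p.2.1 u >])%:R))%R ]].
Proof.
case: p => s [U V] [/= sU sV UV]; have sW := slice_mul sU sV UV.
have siU := slice_inv sU; have siV := slice_inv sV.
have nS i : i <> i.+1 by move/eqP; rewrite -[X in X == _]addn0 -addn1 eqn_add2l.
have nSS i : i <> i.+2 by move/eqP; rewrite -[X in X == _]addn0 -addn2 eqn_add2l.
pose ts1 := [:: sect (gprod U V); sect (@ginv G @` V); sect (@ginv G @` U); (fun x => val x)].
pose ts2 := [:: sect U; sect (@ginv G @` U)] ++ [:: sect V; sect (@ginv G @` V)].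
pose g1 := level_swap e n n.+2 (gprod U V) * level_swap e n.+1 n.+2 U.
pose g2 := level_swap e n n.+1 U * level_swap e (n + 2) (n + 2).+1 V.
have r1 : realizes e n g1 ts1 by exact: realizes_product.
have r2 : realizes e n g2 ts2.
  by apply: realizes_cat => //; exact: realizes_inverse_pair.
have qg1 : q g1 = 0%R by rewrite qM !q_level_swap ?addr0.
have qg2 : q g2 = 0%R by rewrite qM !q_level_swap ?addr0.
have gs1 : forall i, global_section (nth_section ts1 i).
  do 4!(apply: nth_section_cons; first by exact: sect_global || exact: units_global); exact: nth_section_nil.
have gs2 : forall i, global_section (nth_section ts2 i).
  do 4!(apply: nth_section_cons; first by exact: sect_global); exact: nth_section_nil.
have cc u : ~ units G u -> ((hits ts2 u)%:Z - (hits ts1 u)%:Z =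
    (`[< V u >])%:R - (`[< gprod U V u >])%:R + (`[< U u >])%:R)%R.
  move=> nu; rewrite /hits /= hits_units // !sect_count //.
  rewrite !addn0 !PoszD; move: (`[< U u >]) (`[< V u >]) (`[< gprod U V u >]) => a b c.
  move: (`[< _ >]) (`[< _ >]) => a' b'; by case: a; case: b; case: c; case: a'; case: b'.
case: s.
  exists g2, g1, ts2, ts1; split => //; split => // u nu /=.
  by rewrite expr1 mulN1r -cc // opprB.
by exists g1, g2, ts1, ts2; split => //; split => // u nu /=; rewrite expr0 mul1r -cc.
Qed.

Lemma realizes_boundary (m : seq (bool * (set G * set G))) n : (forall p, p \in m -> slice_pair p) ->
  exists g g' ts ts', [/\ realizes e n g ts, realizes e n g' ts', q g = 0%R, q g' = 0%R &
    [/\ size ts = size ts', forall i, global_section (nth_section ts i),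
        forall i, global_section (nth_section ts' i) &
        forall u, ~ units G u -> ((hits ts' u)%:Z - (hits ts u)%:Z =
          \sum_(p <- m) (-1) ^+ p.1 * ((`[< p.2.2 u >])%:R - (`[< gprod p.2.1 p.2.2 u >])%:R
            + (`[< p.2.1 u >])%:R))%R ]].
Proof.
elim: m n => [|p m IH] n gm.
  exists 1, 1, [::], [::]; split.
  - by split => // y _.
  - by split => // y _.
  - exact: (q_one qM).
  - exact: (q_one qM).
  - by split => // [||u _]; [exact: nth_section_nil | exact: nth_section_nil | rewrite big_nil].
have [g [g' [ts [ts' [r r' qg qg' [ss gs gs' cc]]]]]] := realizes_rectangle n (gm p (mem_head _ _)).
have [|k [k' [ws [ws' [t t' qk qk' [ss1 gs1 gs1' cc1]]]]]] := IH (n + size ts)%N.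
  by move=> p' pm; apply: gm; rewrite inE pm orbT.
exists (g * k), (g' * k'), (ts ++ ws), (ts' ++ ws'); split.
- exact: realizes_cat.
- by apply: realizes_cat => //; rewrite -ss.
- by rewrite qM qg qk addr0.
- by rewrite qM qg' qk' addr0.
- split; [by rewrite !size_cat ss ss1 | exact: nth_section_cat | exact: nth_section_cat |].
  move=> u nu; rewrite big_cons -cc // -cc1 // /hits !count_cat !PoszD.
  by rewrite opprD addrACA.
Qed.

Definition full_slice f U : Prop :=
  [/\ slice U, src @` U = setT, rng @` U = setT & forall u, U u -> ap f (src u) = rng u].

(** The right-hand side of the last hypothesis is the boundary of a signed sum of
    rectangles. Lift f and f' to level 0 and let elements of trivial class act on
    the next levels along the configurations of these rectangles; the two
    products then follow every arrow that is not a unit equally often. *)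
Lemma homologous_class f f' U U' m : full_slice f U -> full_slice f' U' ->
  (forall p, p \in m -> slice_pair p) ->
  (forall u, ((indicator U u) - (indicator U' u) =
     \sum_(p <- m) (-1) ^+ p.1 * ((`[< p.2.2 u >])%:R - (`[< gprod p.2.1 p.2.2 u >])%:R
            + (`[< p.2.1 u >])%:R))%R) ->
  q f = q f'.
Proof.
move=> fU fU' gm mE.
have [g [g' [ts [ts' [r r' qg qg' [ss gs gs' cc]]]]]] := realizes_boundary 1 gm.
have lift k (W : set G) : full_slice k W -> exists k',
    q k' = q k /\ realizes e 0 k' [:: sect W].
  move=> [sW srcW _ kW]; have [k' [sk kE qk]] := lift_to_copy hpi hmin qM q_swap ee k.
  exists k'; split => //; split.
    by move=> y ny; apply: sk => -[x _ xy]; apply: ny; exists 0%N, x.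
  move=> [|//] x _; exists 0%N => //; rewrite /nth_section /= kE; congr (e _ _).
  have [u Uu <-] : (src @` W) x by rewrite srcW.
  by rewrite kW // sectK.
have [h [<- rh]] := lift f U fU; have [h' [<- rh']] := lift f' U' fU'.
have [sU _ _ _] := fU; have [sU' _ _ _] := fU'.
suff : q (h * g) = q (h' * g') by rewrite !qM qg qg' !addr0.
apply: (realizes_count qM q_swap ee (realizes_cat ee rh r) (realizes_cat ee rh' r')).
- by apply: nth_section_cons => //; exact: sect_global.
- by apply: nth_section_cons => //; exact: sect_global.
- by rewrite /= ss.
- move=> u nu; rewrite /= !sect_count //; have := cc u nu; rewrite -mE /indicator /hits.
  move: (count _ ts) (count _ ts') => a a'.
  by case: `[< U u >]; case: `[< U' u >] => /= h0; lia.
Qed.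

End Hom.
End Index.

End Configurations.

(** * Finiteness of the abelianisation *)

Section Finiteness.
Local Open Scope group_scope.

Section CommutatorSubgroup.
Variable K : groupType.

Lemma commutator_subgroup1 : commutator_subgroup K 1.
Proof. by move=> H. Qed.

Lemma commutator_subgroupM f g : commutator_subgroup K f -> commutator_subgroup K g ->
  commutator_subgroup K (f * g).
Proof. by move=> Df Dg H H1 HM HV HC; exact: (HM _ _ (Df H H1 HM HV HC) (Dg H H1 HM HV HC)). Qed.

Lemma commutator_subgroupV f : commutator_subgroup K f -> commutator_subgroup K f^-1.
Proof. by move=> Df H H1 HM HV HC; exact: (HV _ (Df H H1 HM HV HC)). Qed.

Lemma commutator_subgroupC f g : commutator_subgroup K [~ f, g].
Proof. by move=> H H1 HM HV HC; exact: HC. Qed.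

Lemma abelianisation_finite (T : Type) (key : K -> T) (S : set T) : finite_set S ->
  (forall f, S (key f)) ->
  (forall f g, key f = key g -> commutator_subgroup K (f^-1 * g)) ->
  finite_set (abelianisation K).
Proof.
move=> fS Sk kD; pose coset f := [set f * b | b in commutator_subgroup K].
pose r t : K := xget 1 [set f | key f = t].
have fim : finite_set ((coset \o r) @` S) by apply: finite_image.
apply: (sub_finite_set _ fim).
move=> _ [f _ <-]; exists (key f) => //=.
have kr : key (r (key f)) = key f by rewrite /r; case: xgetP => [g _ //|/(_ f) []].
rewrite -/(coset f); apply/seteqP; split => [_ [b Db <-]|_ [b Db <-]].
  exists (f^-1 * r (key f) * b); last by rewrite !mulgA mulgV mul1g.
  by apply: commutator_subgroupM => //; exact: kD.
exists ((r (key f))^-1 * f * b); last by rewrite !mulgA mulgV mul1g.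
by apply: commutator_subgroupM => //; exact: kD.
Qed.

End CommutatorSubgroup.

Lemma coset_eq (V : zmodType) (a b : V) (B : set V) : B 0%R ->
  [set (a + c)%R | c in B] = [set (b + c)%R | c in B] -> exists2 c, B c & (a - b)%R = c.
Proof.
move=> B0 ab; have : [set (a + c)%R | c in B] a by exists 0%R; rewrite // addr0.
by rewrite ab => -[c Bc <-]; exists c => //; rewrite addrAC subrr add0r.
Qed.

Section FiniteAbelianisation.
Variable G : etaleCantorGroupoid.
Hypothesis hpi : purely_infinite G.
Hypothesis hmin : minimal G.
Local Notation X := (units G).
Local Notation F := (full_group G).
Implicit Types (A B : set X) (f g h k : F) (x y z : X) (U V : set G).

Lemma full_slice_ex f : exists U, full_slice f U.
Proof.
have /asboolP [U [cU bU sU rU fU]] := valP f.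
by exists U; split => //; exact: bisection_slice.
Qed.

Definition slice_of f : set G := projT1 (cid (full_slice_ex f)).

Lemma slice_ofP f : full_slice f (slice_of f).
Proof. by rewrite /slice_of; case: cid. Qed.

Lemma boundary1_0 : boundary1 (0%R : G -> int) = 0%R.
Proof.
have -> : (0%R : G -> int) = signed_sum [::].
  by apply/funext => u; rewrite /signed_sum big_nil.
by apply/funext => x; rewrite boundary1_slices // big_nil.
Qed.

Lemma boundary2_0 : boundary2 (0%R : @composable G -> int) = 0%R.
Proof.
have -> : (0%R : @composable G -> int) = signed_sum [::].
  by apply/funext => u; rewrite /signed_sum big_nil.
apply/funext => u; have := @boundary2_rectangles G [::] u; rewrite /= big_nil; exact.
Qed.

Definition bisection_class f : set (G -> int) :=
  [set (indicator (slice_of f) + b)%R | b in (@boundary2 G) @` @Cc (@composable G)].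

Lemma bisection_classP f : homology1 G (bisection_class f).
Proof.
exists (indicator (slice_of f)) => //; have [sU sT rT _] := slice_ofP f.
split; first by apply: indicator_Cc; [exact: slice_clopen | case: sU].
rewrite /=; have -> : indicator (slice_of f) = signed_sum [:: (false, slice_of f)].
  by apply/funext => u; rewrite /signed_sum big_seq1 expr0 mul1r.
apply/funext => x; rewrite boundary1_slices; last by move=> p; rewrite inE => /eqP ->.
by rewrite big_seq1 (_ : (false, slice_of f).2 = slice_of f) // sT rT subrr mulr0.
Qed.

Definition count_function (l : seq (set X)) (x : X) : int := (multiplicity l x)%:Z.

Definition count_class (l : seq (set X)) : set (X -> int) :=
  [set (count_function l + b)%R | b in (@boundary1 G) @` @Cc G].

Lemma count_function_Cc l : (forall A, A \in l -> clopen A) -> Cc (count_function l).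
Proof.
move=> ol; split; last first.
  apply: subclosed_compact (@units_compact G) _ => //; exact: closed_closure.
apply: locally_constant_continuous => x.
have [oL _] := level_clopen (multiplicity l x) ol.
have nl : nbhs x (level l (multiplicity l x)) by exact: open_nbhs_nbhs.
by apply: filterS nl => y ly /=; rewrite /count_function ly.
Qed.

Lemma count_classP l : (forall A, A \in l -> clopen A) -> homology0 G (count_class l).
Proof. by move=> ol; exists (count_function l) => //; exact: count_function_Cc. Qed.

(** An element f is encoded by the homology class of its bisection, which
    determines f modulo transpositions, and by the class in H_0(G) of clopen sets
    whose transpositions represent the quotient of f by a standard element with
    the same first class. *)
Theorem finite_abelianisation : finite_set (homology0 G) -> finite_set (homology1 G) ->
  finite_set (abelianisation F).
Proof.
move=> f0 f1.
have [x0 _] := units_nonempty G.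
have [e [ee _]] := @copy_seq_in G hpi hmin setT openT (ex_intro _ x0 Logic.I).
have [Q [q [qM qD]]] := abelian_quotient (@commutator_subgroup1 F)
  (@commutator_subgroupM F) (@commutator_subgroupV F) (@commutator_subgroupC F).
have qC f g : q [~ f, g] = 0%R by apply/qD; exact: commutator_subgroupC.
pose th := theta q e.
pose rep f (l : seq (set X)) := (forall A, A \in l -> clopen A) /\ q f = (\sum_(A <- l) th A)%R.
pose T : set F := [set f | exists l, rep f l].
have thU := thetaU qM ee.
have TD f : q f = 0%R -> T f by move=> qf; exists [::]; split; rewrite ?big_nil.
have T1 : T 1 by apply: TD; exact: q_one.
have TM f g : T f -> T g -> T (f * g).
  move=> [l [ol fl]] [m [om gm]]; exists (l ++ m); split.
    by move=> A; rewrite mem_cat => /orP[/ol|/om].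
  by rewrite qM fl gm big_cat.
have TV f : T f -> T f^-1.
  move=> [l [ol fl]]; exists l; split => //; rewrite (q_inv qM) fl -sumrN.
  apply: eq_big_seq => A /ol oA; apply/eqP; rewrite eq_sym -addr_eq0.
  by apply/eqP; exact: (theta_double qM ee).
have TC f g : T [~ f, g] by exact: TD.
have Tswap A (b c : X -> X) : disjoint_copies A b c -> T (swap A b c).
  move=> d; exists [:: A]; split; first by move=> B; rewrite inE => /eqP ->; case: d.
  by rewrite big_seq1; exact: (theta_swap hpi hmin qM ee).
have [P [p [pM pT]]] := abelian_quotient T1 TM TV TC.
have p_swap A (b c : X -> X) : disjoint_copies A b c -> p (swap A b c) = 0%R.
  by move=> d; apply/pT; exact: Tswap.
have bisection_class_inj f g : bisection_class f = bisection_class g -> p f = p g.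
  move=> fg; have [|_ [phi cphi <-] dphi] := coset_eq _ fg.
    by exists (0%R : @composable G -> int); [exact: Cc0 | exact: boundary2_0].
  have [l [gl lE]] := Cc_decomposition (@rectangle_base G) cphi.
  have [m [gm lm]] := rectangles_witness gl.
  apply: (homologous_class hpi hmin ee pM p_swap (slice_ofP f) (slice_ofP g) (m := m)) => // u.
  rewrite -(boundary2_rectangles u gm) -lm.
  have -> : signed_sum l = phi by apply/funext => r; rewrite lE.
  by rewrite -dphi.
have count_class_inj f g l m : rep f l -> rep g m -> count_class l = count_class m -> q f = q g.
  move=> [ol fl] [om gm] lm; have [|_ [phi cphi <-] dphi] := coset_eq _ lm.
    by exists (0%R : G -> int); [exact: Cc0 | exact: boundary1_0].
  have [w [gw wE]] := Cc_decomposition (@slice_base G) cphi.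
  have {dphi}wE x : ((multiplicity l x)%:Z - (multiplicity m x)%:Z =
     \sum_(r <- w) (-1) ^+ r.1 * ((`[< (src @` r.2) x >])%:R - (`[< (rng @` r.2) x >])%:R))%R.
    rewrite -(boundary1_slices x gw).
    have -> : signed_sum w = phi by apply/funext => u; rewrite wE.
    by rewrite -dphi.
  (* Move the terms with a negative sign to the other side, so that both sides
   count how often clopen sets contain a point. *)
  pose plus := [seq (if r.1 then rng @` r.2 else src @` r.2) | r : bool * set G <- w].
  pose minus := [seq (if r.1 then src @` r.2 else rng @` r.2) | r : bool * set G <- w].
  have oplus A : A \in plus -> clopen A.
    by move=> /mapP [[[] U] /gw sU ->]; [exact: slice_rng_clopen | exact: slice_src_clopen].
  have ominus A : A \in minus -> clopen A.
    by move=> /mapP [[[] U] /gw sU ->]; [exact: slice_src_clopen | exact: slice_rng_clopen].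
  have thE : (\sum_(A <- plus) th A = \sum_(A <- minus) th A)%R.
    rewrite !big_map; apply: eq_big_seq => -[[] U] /gw sU /=; rewrite /th.
      by rewrite (theta_slice hpi hmin qM ee).
    by rewrite (theta_slice hpi hmin qM ee).
  have mult : multiplicity (l ++ minus) =1 multiplicity (m ++ plus).
    move=> x; apply/eqP; rewrite -eqz_nat; apply/eqP; rewrite /multiplicity !big_cat !PoszD.
    rewrite -/(multiplicity l x) -/(multiplicity m x) -/(multiplicity minus x) -/(multiplicity plus x).
    have pm : ((multiplicity plus x)%:Z - (multiplicity minus x)%:Z = \sum_(r <- w) (-1) ^+ r.1 *
        ((`[< (src @` r.2) x >])%:R - (`[< (rng @` r.2) x >])%:R))%R.
      rewrite /multiplicity !big_map; elim: (w) => [|r w' IH]; first by rewrite !big_nil.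
      rewrite !big_cons !PoszD opprD addrACA IH; congr (_ + _)%R.
      by case: r => [[] U]; rewrite /= !natz ?expr1 ?expr0 ?mulN1r ?mul1r ?opprB.
    apply/eqP; rewrite -subr_eq0 opprD addrACA wE -pm; apply/eqP.
    by rewrite -[X in (_ + X)%R]opprB subrr.
  have := additive_extension thU _ _ mult; rewrite !big_cat /= thE => /(_ _ _)/addIr.
  rewrite fl gm; apply.
    by move=> A; rewrite mem_cat => /orP[/ol|/ominus].
  by move=> A; rewrite mem_cat => /orP[/om|/oplus].
(* A standard element of each class; the quotient of f by the standard element
   of its class is a product of commutators and transpositions. *)
pose r1 c : F := xget 1 [set g | bisection_class g = c].
have r1P f : bisection_class (r1 (bisection_class f)) = bisection_class f by rewrite /r1; case: xgetP => [g _ //|/(_ f) []].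
have Tr f : T (f * (r1 (bisection_class f))^-1).
  by apply/pT; rewrite pM (q_inv pM) (bisection_class_inj _ _ (r1P f)) subrr.
pose lf f := projT1 (cid (Tr f)).
have lfP f : rep (f * (r1 (bisection_class f))^-1) (lf f) by rewrite /lf; case: cid.
apply: (@abelianisation_finite F _ (fun f => (bisection_class f, count_class (lf f))) (homology1 G `*` homology0 G)).
- exact: finite_setX.
- by move=> f; split => /=; [exact: bisection_classP | apply: count_classP; case: (lfP f)].
- move=> f g [c1 c0]; have := count_class_inj _ _ _ _ (lfP f) (lfP g) c0.
  rewrite c1 !qM => /addIr qfg; apply/qD.
  by rewrite qM (q_inv qM) qfg addrC subrr.
Qed.

End FiniteAbelianisation.

End Finiteness.

Theorem corollaryE (G : etaleCantorGroupoid)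
    (hprinc : essentially_principal G)
    (hpi : purely_infinite G)
    (hmin : minimal G) :
  (finite_set (homology0 G) -> finite_set (homology1 G) ->
     finite_set (abelianisation (full_group G))) /\
  (finite_set (abelianisation (full_group G)) ->
     forall (R : realType) (d : measure_display) (Z : measurableType d)
       (mu : probability Z R) (a : pmp_action (full_group G) mu),
       standard_borel R Z ->
       faithful_action a -> ergodic_action a ->
       essentially_free_action a).
Proof.
split=> [|_ R d Z mu a]; first exact: finite_abelianisation.
exact: faithful_ergodic_free.
Qed.
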